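(* Let $S=N\rtimes A$ be the harmonic solvable extension of an $H$-type group $N$, and let $\lambda\in\mathfrak{a}_\mathbb{C}^*$ be positive. Then $\mathrm{Cr}(S)$ is the largest $S$-invariant domain in $S_\mathbb{C}$ containing $S$ to which the Poisson kernel $P_\lambda$ extends holomorphically.
   Context: $H$-type algebra: a real two-step nilpotent Lie algebra $\mathfrak{n}$ with inner product $\langle\cdot,\cdot\rangle$ (norm $|\cdot|$), center $\mathfrak{z}$, $\mathfrak{v}=\mathfrak{z}^\perp$, such that the maps $J_Z:\mathfrak{v}\to\mathfrak{v}$ ($Z\in\mathfrak{z}$) defined by $\langle J_ZV,V'\rangle=\langle Z,[V,V']\rangle$ satisfy $J_Z^2=-|Z|^2\mathrm{id}_\mathfrak{v}$. $N$ is the connected simply connected Lie group with Lie algebra $\mathfrak{n}$; elements $\exp(V+Z)$ are written $(V,Z)$. Let $\mathfrak{a}=\mathbb{R}H$ with $|H|=1$, $A=\exp\mathfrak{a}\cong\mathbb{R}^+$, and $S=N\rtimes A$ the simply connected group with Lie algebra $\mathfrak{s}=\mathfrak{v}\oplus\mathfrak{z}\oplus\mathfrak{a}$, where $[H,V]=\tfrac12V$, $[H,Z]=Z$ for $V\in\mathfrak{v}$, $Z\in\mathfrak{z}$. $S$ carries the left-invariant Riemannian metric for which $\mathfrak{n}\perp\mathfrak{a}$. Complexification: $N_\mathbb{C}$ is the simply connected complex Lie group with Lie algebra $\mathfrak{n}_\mathbb{C}$; $A_\mathbb{C}=\mathbb{C}^*$ acts on it by $t\cdot(V,Z)=(tV,t^2Z)$;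 $S_\mathbb{C}=N_\mathbb{C}\rtimes A_\mathbb{C}$, where $\exp(zH)$ corresponds to $e^{z/2}\in\mathbb{C}^*$; $S\subset S_\mathbb{C}$ acts on $S_\mathbb{C}$ by left multiplication, and ''$S$-invariant'' refers to this action. Writing $(V,Z,t)$ for $V+Z+tH\in\mathfrak{s}$, $$\mathcal{D}=\left\{(V,Z,t)\in\mathfrak{s}:\ \cos t\,\bigl(1-\tfrac12|V|^2-|Z|\bigr)>\tfrac14(1-\cos t)|V|^2\right\}_0,$$ with $\{\cdot\}_0$ the connected component containing $0$, $D=\{\exp(itH)\exp(iV+iZ):(V,Z,t)\in\mathcal{D}\}\subset S_\mathbb{C}$, and the complex crown is $\mathrm{Cr}(S)=NAD\subset S_\mathbb{C}$. Poisson kernel: let $s:S\to S$ be the geodesic symmetry of the Riemannian manifold $S$ centered at the identity $e$ (it maps $\gamma(1)$ to $\gamma(-1)$ for every geodesic $\gamma$ with $\gamma(0)=e$). For $x=na\in S$ with $n\in N$, $a\in A$, put $a(x)=a$, and for $\lambda\in\mathfrak{a}_\mathbb{C}^*$ put $a^\lambda(x)=e^{\lambda(\log a(x))}$. The Poisson kernel on $S$ with parameter $\lambda$ is $P_\lambda=a^\lambda\circ s:S\to\mathbb{C}$. The parameter $\lambda$ is called positive if $\mathrm{Re}\,\lambda$ is a positive multiple of $\beta$, where $\beta(H)=1$. *)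

(* Defs.v *)
From HB Require Import structures.
From mathcomp Require Import all_boot all_order all_algebra.
From mathcomp Require Import all_classical all_reals all_analysis.
From mathcomp Require Export complex.
Import Order.TTheory GRing.Theory Num.Theory numFieldNormedType.Exports.

Set Implicit Arguments.
Unset Strict Implicit.
Unset Printing Implicit Defensive.

Local Open Scope classical_set_scope.
Local Open Scope ring_scope.

Section HTypeAlgebra.
Variables (R : realType) (n : vectType R) (br : n -> n -> n) (ip : n -> n -> R).

Definition is_bilinear (W : lmodType R) (f : n -> n -> W) : Prop :=
  (forall y, linear (f^~ y)) /\ (forall x, linear (f x)).

Definition is_lie_bracket : Prop :=
  [/\ is_bilinear br,
      forall x, br x x = 0
    & forall x y z, br x (br y z) + br y (br z x) + br z (br x y) = 0].

Definition is_inner_product : Prop :=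
  [/\ is_bilinear (ip : n -> n -> R^o),
      forall x y, ip x y = ip y x
    & forall x, x != 0 -> 0 < ip x x].

Definition lie_center : set n := [set z | forall x, br z x = 0].

Definition center_orth : set n := [set x | forall z, lie_center z -> ip x z = 0].

Definition two_step_nilpotent : Prop :=
  (forall x y, lie_center (br x y)) /\ (exists x y, br x y != 0).

(* J Z is determined on center_orth by the first two properties; its values   *)
(* elsewhere, and for Z outside the center, are irrelevant.                   *)
Definition is_Jmap (J : n -> n -> n) : Prop :=
  forall Z V, lie_center Z -> center_orth V ->
    center_orth (J Z V) /\
    (forall V', center_orth V' -> ip (J Z V) V' = ip Z (br V V')).

Definition is_htype_algebra : Prop :=
  [/\ is_lie_bracket, is_inner_product, two_step_nilpotent
    & exists J, is_Jmap J /\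
        forall Z V, lie_center Z -> center_orth V ->
          J Z (J Z V) = - ip Z Z *: V].

Definition is_orthonormal_basis (U : set n) d (e : 'I_d -> n) : Prop :=
  [/\ forall i, U (e i),
      forall i j, ip (e i) (e j) = (i == j)%:R
    & forall x, U x -> exists a : 'I_d -> R, x = \sum_i a i *: e i].

Definition structure_constants m k (e : 'I_m -> n) (f : 'I_k -> n) :
    'I_m -> 'I_m -> 'I_k -> R :=
  fun i j c => ip (br (e i) (e j)) (f c).

End HTypeAlgebra.

(* In orthonormal bases of v and z, with structure constants b, an element    *)
(* exp(V + Z) of N (K = R) or of N_C (K = R[i]) is represented by (V, Z); the *)
(* product is the Baker-Campbell-Hausdorff formula.                           *)
Section NilpotentGroup.
Variables (K : numFieldType) (m k : nat) (b : 'I_m -> 'I_m -> 'I_k -> K).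

Definition bracket (x y : 'rV[K]_m) : 'rV[K]_k :=
  \row_c \sum_i \sum_j b i j c * x 0 i * y 0 j.

Definition nmul (x y : 'rV[K]_m * 'rV[K]_k) : 'rV[K]_m * 'rV[K]_k :=
  (x.1 + y.1, x.2 + y.2 + 2^-1 *: bracket x.1 y.1).

Definition dilation (t : K) (x : 'rV[K]_m * 'rV[K]_k) : 'rV[K]_m * 'rV[K]_k :=
  (t *: x.1, t ^+ 2 *: x.2).

End NilpotentGroup.

(* Both the Lie algebra s, where (V, Z, t) stands for V + Z + t H, and the    *)
(* group S, where (V, Z, r) stands for exp(V + Z) exp(r H); the latter is a   *)
(* global chart in which the identity of S is 0.                              *)
Notation solv R m k := ('rV[R]_m * 'rV[R]_k * R^o)%type.

(* The ambient space of S_C = N_C >< C^*, which is the open subset where the  *)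
(* last component does not vanish.                                            *)
Notation csolv R m k := ('rV[R[i]]_m * 'rV[R[i]]_k * (R[i])^o)%type.

Definition csolv_normed (R : realType) m k : normedModType R[i] := csolv R m k.

Section Dot.
Variable R : realType.

(* The library norm on row vectors is the sup norm, hence this one.           *)
Definition dot d (x y : 'rV[R]_d) : R := \sum_i x 0 i * y 0 i.
Definition enorm d (x : 'rV[R]_d) : R := Num.sqrt (dot x x).

Definition cexp (z : R[i]) : R[i] :=
  Complex (expR (complex.Re z) * cos (complex.Im z))
          (expR (complex.Re z) * sin (complex.Im z)).

Definition ci : R[i] := Complex 0 1.

End Dot.

Arguments ci {R}.

Section SolvableGroup.
Variables (R : realType) (m k : nat) (b : 'I_m -> 'I_m -> 'I_k -> R).
Implicit Types (p q X Y W : solv R m k).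

(* exp(r H) acts on v by e^(r/2) and on z by e^r, as [H, V] = V/2, [H, Z] = Z *)
Definition smul p q : solv R m k :=
  (nmul b p.1 (dilation (expR (p.2 / 2)) q.1), p.2 + q.2).

Definition sinv p : solv R m k := (dilation (expR (- p.2 / 2)) (- p.1), - p.2).

Definition sip X Y : R := dot X.1.1 Y.1.1 + dot X.1.2 Y.1.2 + X.2 * Y.2.

(* The left-invariant Riemannian metric in the chart: tangent vectors at p    *)
(* are pulled back to the identity by the differential of the left            *)
(* translation by p^-1.                                                       *)
Definition metric p X Y : R :=
  sip ('D_X (smul (sinv p)) p) ('D_Y (smul (sinv p)) p).

(* <nabla_X Y, W> for constant coordinate vector fields X, Y, W, nabla being  *)
(* the Levi-Civita connection of the metric (Koszul's formula).               *)
Definition christoffel p X Y W : R :=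
  2^-1 * ('D_X (fun q => metric q Y W : R^o) p
          + 'D_Y (fun q => metric q X W : R^o) p
          - 'D_W (fun q => metric q X Y : R^o) p).

Definition geodesic (g : R -> solv R m k) : Prop :=
  [/\ forall t, derivable g t 1,
      forall t, derivable (derive1 g) t 1
    & forall t W, metric (g t) (derive1 (derive1 g) t) W
                  + christoffel (g t) (derive1 g t) (derive1 g t) W = 0].

(* S is complete, so that it suffices to consider geodesics defined on R, and *)
(* every point of S lies on a geodesic through the identity.                  *)
Definition geodesic_symmetry (s : solv R m k -> solv R m k) : Prop :=
  forall g, geodesic g -> g 0 = 0 -> s (g 1) = g (- 1).

(* An element l of the complex dual of a is represented by the complex number *)
(* l(H), so that a^l(exp(V + Z) exp(r H)) = e^(l r).                          *)
Definition apow (l : R[i]) p : R[i] := cexp (l * (p.2)%:C%C).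

Definition poisson_kernel (s : solv R m k -> solv R m k) (l : R[i]) :
    solv R m k -> R[i] := apow l \o s.

Definition positive_param (l : R[i]) : Prop := 0 < complex.Re l.

End SolvableGroup.

Section Complexification.
Variables (R : realType) (m k : nat) (b : 'I_m -> 'I_m -> 'I_k -> R).

Definition SC : set (csolv R m k) := [set p | p.2 != 0].

Definition cmul (p q : csolv R m k) : csolv R m k :=
  (nmul (fun i j c => (b i j c)%:C%C) p.1 (dilation p.2 q.1), p.2 * q.2).

(* exp(z H) corresponds to e^(z/2) in C^*.                                    *)
Definition cexpA (z : R[i]) : csolv R m k := ((0, 0), cexp (z / 2)).

Definition cexpN (V : 'rV[R[i]]_m) (Z : 'rV[R[i]]_k) : csolv R m k :=
  ((V, Z), 1).

Definition cvec d (x : 'rV[R]_d) : 'rV[R[i]]_d := map_mx (real_complex R) x.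

Definition S_to_SC (p : solv R m k) : csolv R m k :=
  cmul (cexpN (cvec p.1.1) (cvec p.1.2)) (cexpA (p.2)%:C%C).

Definition calD : set (solv R m k) :=
  connected_component
    [set X : solv R m k |
       cos X.2 * (1 - 2^-1 * enorm X.1.1 ^+ 2 - enorm X.1.2)
         > 4^-1 * (1 - cos X.2) * enorm X.1.1 ^+ 2] 0.

Definition domD : set (csolv R m k) :=
  [set cmul (cexpA (ci * (X.2)%:C%C))
            (cexpN (ci *: cvec X.1.1) (ci *: cvec X.1.2)) | X in calD].

Definition crown : set (csolv R m k) :=
  [set p | exists x d, domD d /\ p = cmul (S_to_SC x) d].

(* Omega contains S, hence is not empty.                                      *)
Definition invariant_domain (Omega : set (csolv R m k)) : Prop :=
  [/\ Omega `<=` SC,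
      open (Omega : set (csolv_normed R m k)),
      connected (Omega : set (csolv_normed R m k)),
      (forall x, Omega (S_to_SC x))
    & (forall x p, Omega p -> Omega (cmul (S_to_SC x) p))].

(* Differentiability is over R[i]: the differentials are complex-linear.      *)
Definition holomorphic_on (Omega : set (csolv R m k))
    (F : csolv R m k -> R[i]) : Prop :=
  forall p : csolv_normed R m k, Omega p ->
    differentiable (F : csolv_normed R m k -> (R[i])^o) p.

Definition extends_holomorphically (P : solv R m k -> R[i])
    (Omega : set (csolv R m k)) : Prop :=
  exists F, holomorphic_on Omega F /\ forall x, F (S_to_SC x) = P x.

Definition largest_invariant_domain (P : solv R m k -> R[i])
    (Omega : set (csolv R m k)) : Prop :=
  [/\ invariant_domain Omega, extends_holomorphically P Omega
    & forall Omega', invariant_domain Omega' ->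
        extends_holomorphically P Omega' -> Omega' `<=` Omega].

End Complexification.

(* Main.v *)
Require Import Defs.
From HB Require Import structures.
From mathcomp Require Import all_boot all_order all_algebra.
From mathcomp Require Import all_classical all_reals all_analysis.
From mathcomp Require Import ring lra.
Import Order.TTheory GRing.Theory Num.Theory numFieldNormedType.Exports.

Set Implicit Arguments.
Unset Strict Implicit.
Unset Printing Implicit Defensive.

Local Open Scope classical_set_scope.
Local Open Scope ring_scope.

Import Normc.

(** Let [V], [Z] be the components of a point of the complex group and [t] its
    last coordinate, and put [h = t ^ 2 + V.V / 4], [N = h ^ 2 + Z.Z], where the
    dot is bilinear over the complex numbers.  The theorem holds because the
    Poisson kernel is [(t ^ 2 / N) ^ l], because the crown is the largest
    connected set around the real group that is stable under it and avoids the
    zeros of [N], and because [(t ^ 2 / N) ^ l] is unbounded near these zeros.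

    The formula for the kernel comes from the geodesics through the identity.
    With [J_Z ^ 2 = - |Z| ^ 2] the vectors [V], [J_Z V] span a plane in which
    the first component of such a geodesic stays, and the geodesic equation
    reduces to identities between rational functions of [expR (L * t)] ([geodesic_ray]).
    Every point lies on one of these curves, by a Cayley transform, and
    comparing the times [1] and [- 1] gives the last coordinate of the reflected
    point ([geodesic_symmetry_height]).

    A real translation can be used to make [V] purely imaginary.  After that the
    crown is given by two inequalities: it is the set [tube] of the points with
    [0 < Re t] and [Re (t ^ 2) > |Im V| ^ 2 / 2 + |vertical|], where
    [vertical = Im Z - [Re V, Im V] / 2] ([crown_tube]).  It follows from
    [|[x, y]| <= |x| |y|] that [|Im Z| < Re h] on the tube.  Hence [N] takes no
    value in the nonpositive reals there, and principal logarithms of [t ^ 2] and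
    [N] extend the kernel ([holomorphic_poisson_ext]).

    For maximality, let an extension [F] be given on an invariant domain.  The
    set [agree] where [F] is locally the explicit extension contains the real
    group, is open, and is stable under the translations by the nilpotent group
    because their orbits are connected.  If the domain were not contained in the
    tube, then by connectedness it would contain a limit of [agree] with
    [Re (t ^ 2) = |Im V| ^ 2 / 2 + |vertical|].  For [y = Im V] the equation
    [[v, y] = |y| ^ 2 u] can be solved with [|v| = |y|] for every unit vector
    [u], and this yields a translate of the limit where [N] vanishes
    ([boundary_zero]).  Near it the modulus of the explicit extension is at
    least [|t ^ 2 / N| ^ (Re l) * exp (- 2 * pi * |Im l|)], whereas [F] is
    continuous: a contradiction, as [0 < Re l].

    The argument uses that a function which is merely complex differentiable and
    vanishes on a totally real subspace, or on an open set, vanishes nearby.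
    Restriction to complex lines reduces this to one variable.  There it follows
    from a maximum principle, itself a consequence of Goursat's theorem through
    the mean value property: if a function vanishes on one side of a square, the
    product of its four quarter turns about the centre vanishes on the whole
    boundary, hence at the centre ([square_side]). *)

(** * Real derivatives and primitives *)

Section RealDerivative.
Variable R : realType.
Implicit Types (f g : R -> R) (df dg x : R).

(** The derivation rules are in pointwise form, with products in place of
    scalings, so that [ring] and [field] apply to the computed derivatives. *)
Lemma derD f g df dg x : is_derive x 1 f df -> is_derive x 1 g dg ->
  is_derive x 1 (fun y => f y + g y) (df + dg).
Proof. by move=> ? ?; apply: is_deriveD. Qed.

Lemma derN f df x : is_derive x 1 f df -> is_derive x 1 (fun y => - f y) (- df).
Proof. by move=> ?; apply: is_deriveN. Qed.

Lemma derM f g df dg x : is_derive x 1 f df -> is_derive x 1 g dg ->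
  is_derive x 1 (fun y => f y * g y) (f x * dg + g x * df).
Proof. by move=> ? ?; apply: is_deriveM. Qed.

Lemma derC (a x : R) : is_derive x 1 (fun=> a) 0.
Proof. exact: is_derive_cst. Qed.

Lemma derI (x : R) : is_derive x 1 (fun y => y) 1.
Proof. exact: is_derive_id. Qed.

Lemma derV f df x : f x != 0 -> is_derive x 1 f df ->
  is_derive x 1 (fun y => (f y)^-1) (- (f x) ^- 2 * df).
Proof. by move=> ? ?; apply: is_deriveV. Qed.

Lemma derX f df n x : is_derive x 1 f df ->
  is_derive x 1 (fun y => f y ^+ n) (n%:R * f x ^+ n.-1 * df).
Proof.
move=> dfx; have -> : (fun y => f y ^+ n) = f ^+ n by apply/funext => y; rewrite exprfctE.
exact: is_deriveX.
Qed.

Lemma der_comp g f dg df x : is_derive (f x) 1 g dg -> is_derive x 1 f df ->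
  is_derive x 1 (fun y => g (f y)) (dg * df).
Proof. by move=> ? ?; apply: is_derive1_comp. Qed.

Lemma der_eq f df df' x : is_derive x 1 f df -> df = df' -> is_derive x 1 f df'.
Proof. by move=> ? <-. Qed.

End RealDerivative.

Ltac derive_step := first
  [ exact: derI | eapply derC | eassumption
  | eapply derX | eapply derD | eapply derN | eapply derM ].
Ltac derive_tac := eapply der_eq; [repeat derive_step |].

Section Primitive.
Variable R : realType.
Implicit Types (u U : R -> R).

(** Every line integral below is a difference of values of a primitive. *)
Lemma primitive_exists u (L : R) : continuous u ->
  exists U, forall x, L < x -> is_derive x 1 U (u x).
Proof.
move=> cu; exists (fun x => \int[lebesgue_measure]_(t in `[L, x]) u t)%R.
move=> x Lx.
have Lx1 : x < x + 1 by rewrite ltrDl.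
have iu : (@lebesgue_measure R).-integrable `[L, x + 1] (EFin \o u).
  apply: continuous_compact_integrable; first exact: segment_compact.
  exact: continuous_subspaceT.
have [d e] := continuous_FTC1_closed Lx1 iu Lx (cu x).
by apply: DeriveDef d _; rewrite -e derive1E.
Qed.

Lemma derive_diff_le (U u : R -> R) (a b e : R) : a <= b ->
  (forall x, a <= x <= b -> is_derive x 1 U (u x)) ->
  (forall x, a <= x <= b -> `|u x| <= e) ->
  `|U b - U a| <= e * (b - a).
Proof.
move=> ab dU bu.
have dU' x : x \in `]a, b[ -> is_derive x 1 U (u x).
  by rewrite in_itv /= => /andP[ax xb]; apply: dU; rewrite !ltW.
have cU : {within `[a, b], continuous U}.
  apply: derivable_within_continuous => x; rewrite in_itv /= => xab.
  by have := dU x xab => -[].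
have [c cab ->] := MVT_segment ab dU' cU.
rewrite normrM [X in _ * X]ger0_norm ?subr_ge0 //.
by apply: ler_wpM2r; [rewrite subr_ge0 | apply: bu; move: cab; rewrite in_itv].
Qed.

(** The integral of a function close to an affine one is close to the integral of
    the latter, which is explicit. *)
Lemma derive_diff_affine_le (U u : R -> R) (a b al be e : R) : a <= b ->
  (forall x, a <= x <= b -> is_derive x 1 U (u x)) ->
  (forall x, a <= x <= b -> `|u x - (al + be * x)| <= e) ->
  `|U b - U a - (al * (b - a) + be * (b ^+ 2 - a ^+ 2) / 2)| <= e * (b - a).
Proof.
move=> ab dU bu.
have -> : U b - U a - (al * (b - a) + be * (b ^+ 2 - a ^+ 2) / 2) =
  (U b - (al * b + be / 2 * b ^+ 2)) - (U a - (al * a + be / 2 * a ^+ 2)).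
  by field.
apply: (@derive_diff_le (fun x => U x - (al * x + be / 2 * x ^+ 2))
  (fun x => u x - (al + be * x)) _ _ _ ab) => // x xab.
have dUx := dU x xab; derive_tac.
by rewrite /= expr1; field.
Qed.

End Primitive.

(** * Goursat's theorem for closed forms on a rectangle *)

Lemma nested_segments (R : realType) (x w : nat -> R) :
  (forall n, 0 <= w n) -> (forall n, x n <= x n.+1) ->
  (forall n, x n.+1 + w n.+1 <= x n + w n) ->
  exists X, forall n, x n <= X <= x n + w n.
Proof.
move=> w0 xm ym.
have xmono m n : (m <= n)%N -> x m <= x n.
  by elim: n => [|n IH]; [rewrite leqn0 => /eqP -> | rewrite leq_eqVlt =>
     /orP[/eqP -> //|/IH h]; apply: le_trans (xm n)].
have ymono m n : (m <= n)%N -> x n + w n <= x m + w m.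
  by elim: n => [|n IH]; [rewrite leqn0 => /eqP -> | rewrite leq_eqVlt =>
     /orP[/eqP -> //|/IH h]; apply: le_trans h].
have xy m n : x m <= x n + w n.
  case: (leqP m n) => [mn|/ltnW nm].
    by apply: le_trans (xmono _ _ mn) _; rewrite lerDl.
  by apply: le_trans (ymono _ _ nm); rewrite lerDl.
exists (sup (range x)) => n; apply/andP; split.
  apply: ub_le_sup; last by exists n.
  by exists (x 0 + w 0) => _ [m _ <-]; apply: xy.
by apply: ge_sup; [exists (x 0), 0%N | move=> _ [m _ <-]; apply: xy].
Qed.

Lemma expr2_unbounded (R : realType) (K : R) : exists n, K < 2 ^+ n.
Proof. by exists (Num.bound K); exact: upper_nthrootP. Qed.

(** The form is [P dx + Q dy]; [U y] and [V x] are primitives of [P] along the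
    horizontal of height [y] and of [Q] along the vertical of abscissa [x].  Of
    the partial derivatives only the existence at each point is assumed, so the
    theorem is proved by subdivision and not by differentiating an integral. *)
Section Goursat.
Variables (R : realType) (P Q U V : R -> R -> R) (a b c d : R).
Hypotheses (ab : a <= b) (cd : c <= d).

Let inrect x y := (a <= x <= b) && (c <= y <= d).

Hypothesis dU : forall x y, inrect x y -> is_derive x 1 (U y) (P x y).
Hypothesis dV : forall x y, inrect x y -> is_derive y 1 (V x) (Q x y).
Hypothesis equal_cross_derivatives : forall x y, inrect x y -> exists A B D : R,
  forall e, 0 < e -> exists2 del, 0 < del & forall x' y', inrect x' y' ->
   `|x' - x| < del -> `|y' - y| < del ->
   `|P x' y' - (P x y + A * (x' - x) + B * (y' - y))|
      <= e * (`|x' - x| + `|y' - y|) /\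
   `|Q x' y' - (Q x y + B * (x' - x) + D * (y' - y))|
      <= e * (`|x' - x| + `|y' - y|).

Definition circulation x0 x1 y0 y1 := (U y0 x1 - U y0 x0) + (V x1 y1 - V x1 y0)
  - (U y1 x1 - U y1 x0) - (V x0 y1 - V x0 y0).

(** An affine closed form has circulation zero around every rectangle, so only the
    error in the first order expansion at [(X, Y)] contributes. *)
Lemma circulation_local X Y e : inrect X Y -> 0 < e ->
  exists2 del, 0 < del & forall x0 x1 y0 y1, inrect x0 y0 -> inrect x1 y1 ->
    x0 <= X <= x1 -> y0 <= Y <= y1 -> x1 - x0 < del -> y1 - y0 < del ->
    `|circulation x0 x1 y0 y1| <= e * (x1 - x0 + (y1 - y0)) ^+ 2.
Proof.
move=> XY e0; have [A [B [D H]]] := equal_cross_derivatives XY.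
have [|del del0 {}H] := H (e / 2); first by rewrite divr_gt0.
exists del => // x0 x1 y0 y1 r0 r1 Xi Yi wdel hdel.
move: r0 r1 Xi Yi => /andP[/andP[? ?] /andP[? ?]] /andP[/andP[? ?] /andP[? ?]]
  /andP[? ?] /andP[? ?].
have eb x y : x0 <= x <= x1 -> y0 <= y <= y1 ->
   `|P x y - (P X Y + A * (x - X) + B * (y - Y))| <= e / 2 * (x1 - x0 + (y1 - y0))
   /\ `|Q x y - (Q X Y + B * (x - X) + D * (y - Y))|
        <= e / 2 * (x1 - x0 + (y1 - y0)).
  move=> /andP[? ?] /andP[? ?].
  have bx : `|x - X| <= x1 - x0 by rewrite ler_norml; apply/andP; split; lra.
  have by' : `|y - Y| <= y1 - y0 by rewrite ler_norml; apply/andP; split; lra.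
  have [|||h1 h2] := H x y.
  - by apply/andP; split; apply/andP; split; lra.
  - exact: le_lt_trans wdel.
  - exact: le_lt_trans hdel.
  have e2 : e / 2 * (`|x - X| + `|y - Y|) <= e / 2 * (x1 - x0 + (y1 - y0)).
    by apply: ler_wpM2l; [rewrite divr_ge0 // ltW | apply: lerD].
  by split; [apply: le_trans h1 e2 | apply: le_trans h2 e2].
have x01 : x0 <= x1 by lra.
have y01 : y0 <= y1 by lra.
have xx0 : x0 <= x0 <= x1 by rewrite lexx.
have xx1 : x0 <= x1 <= x1 by rewrite lexx x01.
have yy0 : y0 <= y0 <= y1 by rewrite lexx.
have yy1 : y0 <= y1 <= y1 by rewrite lexx y01.
have inr x y : x0 <= x <= x1 -> y0 <= y <= y1 -> inrect x y.
  by move=> /andP[? ?] /andP[? ?]; apply/andP; split; apply/andP; split; lra.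
set E := e / 2 * (x1 - x0 + (y1 - y0)) in eb.
have hor y : y0 <= y <= y1 ->
  `|U y x1 - U y x0 - ((P X Y - A * X + B * (y - Y)) * (x1 - x0)
      + A * (x1 ^+ 2 - x0 ^+ 2) / 2)| <= E * (x1 - x0).
  move=> yi; apply: (@derive_diff_affine_le _ (U y) (P^~ y)) => // x xi.
    exact/dU/inr.
  by apply: le_trans (eb _ _ xi yi).1; rewrite le_eqVlt; apply/orP; left;
     apply/eqP; congr (`|_|); ring.
have ver x : x0 <= x <= x1 ->
  `|V x y1 - V x y0 - ((Q X Y - D * Y + B * (x - X)) * (y1 - y0)
      + D * (y1 ^+ 2 - y0 ^+ 2) / 2)| <= E * (y1 - y0).
  move=> xi; apply: (@derive_diff_affine_le _ (V x) (Q x)) => // y yi.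
    exact/dV/inr.
  by apply: le_trans (eb _ _ xi yi).2; rewrite le_eqVlt; apply/orP; left;
     apply/eqP; congr (`|_|); ring.
have := hor _ yy0; have := hor _ yy1; have := ver _ xx0; have := ver _ xx1.
rewrite !ler_norml => /andP[? ?] /andP[? ?] /andP[? ?] /andP[? ?].
have -> : e * (x1 - x0 + (y1 - y0)) ^+ 2 = E * (x1 - x0) + E * (x1 - x0)
  + E * (y1 - y0) + E * (y1 - y0) by rewrite /E; field.
by rewrite /circulation; apply/andP; split; lra.
Qed.

Let W n := (b - a) / 2 ^+ n.
Let H n := (d - c) / 2 ^+ n.
Let circ n (p : R * R) := circulation p.1 (p.1 + W n) p.2 (p.2 + H n).

Let WS n : W n = W n.+1 + W n.+1.
Proof. by rewrite /W exprS; field; rewrite expf_neq0. Qed.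

Let HS n : H n = H n.+1 + H n.+1.
Proof. by rewrite /H exprS; field; rewrite expf_neq0. Qed.

Let W0 n : 0 <= W n.
Proof. by rewrite divr_ge0 ?subr_ge0 // exprn_ge0. Qed.

Let H0 n : 0 <= H n.
Proof. by rewrite divr_ge0 ?subr_ge0 // exprn_ge0. Qed.

(** The circulation is the sum of those around the four quarters, one of which is
    therefore at least a fourth of it in modulus. *)
Let bisection (np : nat * (R * R)) : exists q : R * R,
  let: (n, p) := np in [/\ p.1 <= q.1 <= p.1 + W n.+1,
    p.2 <= q.2 <= p.2 + H n.+1 & `|circ n p| <= 4 * `|circ n.+1 q|].
Proof.
case: np => n p; set w := W n.+1; set h := H n.+1.
have w0 : 0 <= w by exact: W0.
have h0 : 0 <= h by exact: H0.
pose q1 := (p.1, p.2); pose q2 := (p.1 + w, p.2).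
pose q3 := (p.1, p.2 + h); pose q4 := (p.1 + w, p.2 + h).
have sum4 : circ n p = circ n.+1 q1 + circ n.+1 q2 + circ n.+1 q3 + circ n.+1 q4.
  rewrite /circ /circulation WS HS -/w -/h /= !addrA; ring.
have t1 := ler_normD (circ n.+1 q1) (circ n.+1 q2).
have t2 := ler_normD (circ n.+1 q3) (circ n.+1 q4).
have t3 : `|circ n p| <= `|circ n.+1 q1 + circ n.+1 q2|
    + `|circ n.+1 q3 + circ n.+1 q4| by rewrite sum4 -addrA ler_normD.
have [g1|g1] := leP `|circ n p| (4 * `|circ n.+1 q1|).
  by exists q1; split; rewrite //= ?lexx ?lerDl.
have [g2|g2] := leP `|circ n p| (4 * `|circ n.+1 q2|).
  by exists q2; split; rewrite //= ?lexx ?lerDl ?w0 ?h0.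
have [g3|g3] := leP `|circ n p| (4 * `|circ n.+1 q3|).
  by exists q3; split; rewrite //= ?lexx ?lerDl ?w0 ?h0.
exists q4; split; rewrite //= ?lexx ?lerDl ?w0 ?h0 //; lra.
Qed.

Theorem goursat : circulation a b c d = 0.
Proof.
have [g gP] := choice bisection.
pose s := fix s n := if n is n'.+1 then g (n', s n') else (a, c).
have sP n : [/\ (s n).1 <= (s n.+1).1 <= (s n).1 + W n.+1,
    (s n).2 <= (s n.+1).2 <= (s n).2 + H n.+1
    & `|circ n (s n)| <= 4 * `|circ n.+1 (s n.+1)|] := gP (n, s n).
have xmono n : (s n).1 <= (s n.+1).1 by have [/andP[]] := sP n.
have ymono n : (s n).2 <= (s n.+1).2 by have [_ /andP[]] := sP n.
have xmono' n : (s n.+1).1 + W n.+1 <= (s n).1 + W n.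
  by have [/andP[_ h] _ _] := sP n; rewrite (WS n) addrA lerD2r.
have ymono' n : (s n.+1).2 + H n.+1 <= (s n).2 + H n.
  by have [_ /andP[_ h] _] := sP n; rewrite (HS n) addrA lerD2r.
have [X XP] := nested_segments W0 xmono xmono'.
have [Y YP] := nested_segments H0 ymono ymono'.
have Wz : W 0 = b - a by rewrite /W expr0 divr1.
have Hz : H 0 = d - c by rewrite /H expr0 divr1.
have low n : a <= (s n).1 /\ c <= (s n).2.
  elim: n => [|n [h1 h2]]; first by [].
  by split; [apply: le_trans h1 (xmono n) | apply: le_trans h2 (ymono n)].
have high n : (s n).1 + W n <= b /\ (s n).2 + H n <= d.
  elim: n => [|n [h1 h2]]; first by rewrite /= Wz Hz !subrKC.
  by split; [apply: le_trans (xmono' n) h1 | apply: le_trans (ymono' n) h2].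
have cn n : `|circulation a b c d| <= 4 ^+ n * `|circ n (s n)|.
  elim: n => [|n IH]; first by rewrite expr0 mul1r /circ /= Wz Hz !subrKC.
  apply: le_trans IH _; rewrite exprSr -mulrA.
  by apply: ler_wpM2l; [rewrite exprn_ge0 | have [] := sP n].
have XY : inrect X Y.
  have := XP 0; have := YP 0; rewrite /= Wz Hz !subrKC => h1 h2.
  by rewrite /inrect h1 h2.
apply/eqP; rewrite -normr_le0; apply/ler_addgt0Pr => e e0; rewrite add0r.
pose K := (b - a) + (d - c).
have K0 : 0 <= K by rewrite addr_ge0 ?subr_ge0.
have K1 : 0 < K ^+ 2 + 1 by rewrite ltr_wpDl // sqr_ge0.
have [|del del0 loc] := circulation_local XY (_ : 0 < e / (K ^+ 2 + 1)).
  by rewrite divr_gt0.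
have [n Kn] := expr2_unbounded (K / del).
have n0 : 0 < 2 ^+ n :> R by rewrite exprn_gt0.
have Kn' : K / 2 ^+ n < del.
  by rewrite (ltr_pdivrMr _ _ n0) -(ltr_pdivrMl _ _ del0) mulrC.
have WHn : W n + H n = K / 2 ^+ n by rewrite /W /H -mulrDl.
have wn := W0 n; have hn := H0 n.
apply: le_trans (cn n) _.
have [l1 l2] := low n; have [h1 h2] := high n.
have := loc (s n).1 ((s n).1 + W n) (s n).2 ((s n).2 + H n).
rewrite !(addrC (s n).1) !(addrC (s n).2) !addrK => {}loc.
have {}loc : `|circ n (s n)| <= e / (K ^+ 2 + 1) * (W n + H n) ^+ 2.
  rewrite /circ !(addrC (s n).1) !(addrC (s n).2).
  have XPn := XP n; have YPn := YP n.
  apply: loc; rewrite ?(addrC (W n)) ?(addrC (H n)) //.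
  - by apply/andP; split; apply/andP; split; lra.
  - by apply/andP; split; apply/andP; split; lra.
  - lra.
  - lra.
apply: le_trans (_ : 4 ^+ n * (e / (K ^+ 2 + 1) * (W n + H n) ^+ 2) <= _).
  by apply: ler_wpM2l => //; rewrite exprn_ge0.
have -> : 4 ^+ n * (e / (K ^+ 2 + 1) * (W n + H n) ^+ 2)
   = e * (K ^+ 2 / (K ^+ 2 + 1)).
  have -> : 4 = 2 ^+ 2 :> R by ring.
  rewrite WHn exprAC; field.
  by rewrite gt_eqF // gt_eqF.
rewrite ger_pMr // ler_pdivrMr // mul1r; lra.
Qed.

End Goursat.

(** * Complex differentiability *)

Section ComplexModulus.
Variable R : realType.
Implicit Types z w : R[i].

Lemma normC_normc z : `|z| = (normc z)%:C%C.
Proof. by []. Qed.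

Lemma normc_sqr z : normc z ^+ 2 = complex.Re z ^+ 2 + complex.Im z ^+ 2.
Proof. by case: z => x y; rewrite /= sqr_sqrtr // addr_ge0 // sqr_ge0. Qed.

Lemma normc_ge0 z : 0 <= normc z.
Proof. by case: z => x y; exact: sqrtr_ge0. Qed.

Lemma normc_gt0 z : (0 < normc z) = (z != 0).
Proof.
rewrite lt_neqAle normc_ge0 andbT eq_sym; apply/idP/idP.
  by apply: contra => /eqP ->; rewrite normc0.
by apply: contra => /eqP /eq0_normc ->.
Qed.

Lemma Re_normc z : `|complex.Re z| <= normc z.
Proof.
rewrite -ler_sqr ?nnegrE ?normc_ge0 //.
by rewrite real_normK ?num_real // normc_sqr lerDl sqr_ge0.
Qed.

Lemma Im_normc z : `|complex.Im z| <= normc z.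
Proof.
rewrite -ler_sqr ?nnegrE ?normc_ge0 //.
by rewrite real_normK ?num_real // normc_sqr lerDr sqr_ge0.
Qed.

Lemma normc_real (x : R) : normc (x%:C)%C = `|x|.
Proof. by rewrite /= expr0n addr0 sqrtr_sqr. Qed.

Lemma normc_imag (x : R) : normc (Complex 0 x) = `|x|.
Proof. by rewrite /= expr0n add0r sqrtr_sqr. Qed.

Lemma normc_le z : normc z <= `|complex.Re z| + `|complex.Im z|.
Proof.
case: z => x y.
have -> : Complex x y = (x%:C)%C + Complex 0 y.
  by apply/eqP; rewrite eq_complex /= addr0 add0r !eqxx.
by apply: le_trans (le_normcD _ _) _; rewrite normc_real normc_imag /= addr0 add0r.
Qed.

Lemma normcB z w : normc (z - w) = normc (w - z).
Proof. by rewrite -normcN opprB. Qed.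

Lemma complex_gt0 z : 0 < z -> exists2 r : R, 0 < r & z = (r%:C)%C.
Proof.
case: z => x y; rewrite ltcE /= => /andP[/eqP -> x0].
by exists x.
Qed.

Lemma ReD z w : complex.Re (z + w) = complex.Re z + complex.Re w.
Proof. by case: z; case: w. Qed.
Lemma ImD z w : complex.Im (z + w) = complex.Im z + complex.Im w.
Proof. by case: z; case: w. Qed.
Lemma ReN z : complex.Re (- z) = - complex.Re z. Proof. by case: z. Qed.
Lemma ImN z : complex.Im (- z) = - complex.Im z. Proof. by case: z. Qed.
Lemma ReM z w : complex.Re (z * w) =
  complex.Re z * complex.Re w - complex.Im z * complex.Im w.
Proof. by case: z; case: w. Qed.
Lemma ImM z w : complex.Im (z * w) =
  complex.Re z * complex.Im w + complex.Im z * complex.Re w.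
Proof. by case: z; case: w. Qed.

Definition ReImE := (ReD, ImD, ReN, ImN, ReM, ImM).

Lemma complex_ext z w : complex.Re z = complex.Re w ->
  complex.Im z = complex.Im w -> z = w.
Proof. by case: z; case: w => ? ? ? ? /= -> ->. Qed.

End ComplexModulus.

Section ComplexDerivative.
Variable R : realType.
Local Notation C := ((R[i])^o).
Implicit Types (f g : C -> C) (z w : C).

Lemma nbhs_normcP z (A : set C) :
  nbhs z A <-> exists2 r : R, 0 < r & forall w, normc (w - z) < r -> A w.
Proof.
have H := @nbhs_normP R[i] C z A.
split=> [/H[e /= /complex_gt0[r r0 ->]] h|[r r0 h]].
  by exists r => // w wr; apply: h => /=; rewrite distrC normC_normc ltcR.
apply/H; exists (r%:C)%C; first by rewrite /= ltcR.
by move=> w /=; rewrite distrC normC_normc ltcR; apply: h.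
Qed.

(** The bridge between differentials over the complex numbers, where a norm is a complex
    number, and estimates with the real modulus [normc]. *)
Lemma complex_differentiableP f z : differentiable f z <->
  exists d : R[i], forall e : R, 0 < e -> exists2 r : R, 0 < r &
    forall w, normc (w - z) < r ->
      normc (f w - f z - d * (w - z)) <= e * normc (w - z).
Proof.
rewrite -(derivable1_diffP f z); split => [df|[d H]].
  move: df; rewrite /derivable => /cvgrPdist_le H.
  set d := lim _ in H; exists d => e e0.
  have /H : 0 < (e%:C)%C :> R[i] by rewrite ltcR.
  case/nbhs_normcP => r r0 {}H; exists r => // w wr.
  have [->|wz] := eqVneq w z; first by rewrite !subrr mulr0 subrr normc0 mulr0.
  have wz0 : w - z != 0 by rewrite subr_eq0.
  have := H (w - z); rewrite subr0 => /(_ wr wz0).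
  rewrite normC_normc lecR /= => {}H.
  have -> : f w - f z - d * (w - z) =
    - (w - z) * (d - (w - z)^-1 *: (f ((w - z) *: (1:C) + z) - f z)).
    rewrite /GRing.scale /= mulr1 subrK.
    by field.
  by rewrite normcM normcN mulrC; apply: ler_wpM2r => //; exact: normc_ge0.
apply/cvg_ex; exists d; apply/cvgrPdist_le => e /complex_gt0[r r0 ->].
have [s s0 {}H] := H r r0; apply/nbhs_normcP; exists s => // h.
rewrite subr0 => hs h0; rewrite normC_normc lecR /=.
have := H (h *: (1:C) + z); rewrite addrK /GRing.scale /= mulr1 => /(_ hs) {}H.
have -> : d - h^-1 * (f (h + z) - f z) =
  - h^-1 * (f (h + z) - f z - d * h) by field.
rewrite normcM normcN normcV.
have h1 : 0 < normc h by rewrite normc_gt0.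
by rewrite ler_pdivrMl // [leRHS]mulrC.
Qed.

Lemma continuous_Re : continuous (@complex.Re R : C -> R).
Proof.
move=> z; apply/(@cvgrPdist_le _ _ _ (nbhs (z : C))) => e e0; apply/nbhs_normcP; exists e => // w.
by rewrite normcB -ReN -ReD => /ltW; apply: le_trans; apply: Re_normc.
Qed.

Lemma continuous_Im : continuous (@complex.Im R : C -> R).
Proof.
move=> z; apply/(@cvgrPdist_le _ _ _ (nbhs (z : C))) => e e0; apply/nbhs_normcP; exists e => // w.
by rewrite normcB -ImN -ImD => /ltW; apply: le_trans; apply: Im_normc.
Qed.

Lemma continuous_normc : continuous (@normc R : C -> R).
Proof.
move=> z; apply/(@cvgrPdist_le _ _ _ (nbhs (z : C))) => e e0.
apply/nbhs_normcP; exists e => // w /ltW zw; apply: le_trans zw.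
have := le_normcD w (z - w); have := le_normcD z (w - z).
rewrite !subrKC (normcB z w) => ? ?.
by rewrite ler_norml; apply/andP; split; lra.
Qed.

Lemma continuous_complex (T : topologicalType) (f g : T -> R) (t : T) :
  {for t, continuous f} -> {for t, continuous g} ->
  {for t, continuous (fun t => Complex (f t) (g t) : C)}.
Proof.
move=> cf cg; apply/cvgrPdist_le => e /complex_gt0[r r0 ->].
move/cvgrPdist_le : cf => /(_ (r / 2)); rewrite divr_gt0 // => /(_ isT) cf.
move/cvgrPdist_le : cg => /(_ (r / 2)); rewrite divr_gt0 // => /(_ isT) cg.
near=> s; rewrite normC_normc lecR; apply: le_trans (normc_le _) _.
rewrite [leRHS]splitr; apply: lerD; rewrite /=.
  by near: s.
by near: s.
Unshelve. all: by end_near. Qed.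

End ComplexDerivative.

Lemma is_derive_le (R : realType) (f : R -> R) (x d : R) : is_derive x 1 f d ->
  forall e : R, 0 < e -> exists2 r : R, 0 < r &
    forall h : R, `|h| < r -> `|f (x + h) - f x - d * h| <= e * `|h|.
Proof.
case=> df <- e e0; move: df; rewrite /derivable => /cvgrPdist_le H.
have /nbhs_normP[r /= r0 {}H] := H e e0.
exists r => // h hr; have [->|h0] := eqVneq h 0.
  by rewrite addr0 subrr mulr0 subrr normr0 mulr0.
have := H h; rewrite /= distrC subr0 => /(_ hr h0).
rewrite -/(derive _ _ _) /GRing.scale /= mulr1 (addrC h).
set D := 'D_1 f x => {}H.
have -> : f (x + h) - f x - D * h = - h * (D - h^-1 * (f (x + h) - f x)) by field.
by rewrite normrM normrN mulrC; apply: ler_wpM2r.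
Qed.

(** * The mean value property *)

Section ComplexExponential.
Variable R : realType.
Local Notation C := ((R[i])^o).
Implicit Types z w : C.

Lemma cexpD z w : cexp (z + w) = cexp z * cexp w :> R[i].
Proof.
apply: complex_ext; rewrite ?ReM ?ImM /= ReD ImD expRD ?cosD ?sinD; ring.
Qed.

Lemma normc_cexp z : normc (cexp z) = expR (complex.Re z).
Proof.
rewrite /= !exprMn -mulrDr cos2Dsin2 mulr1 sqrtr_sqr.
by rewrite ger0_norm // expR_ge0.
Qed.

Lemma cexp_neq0 z : cexp z != 0.
Proof. by rewrite -normc_gt0 normc_cexp expR_gt0. Qed.

(** The functional equation reduces the differentiability of the exponential to
    this estimate at the origin. *)
Lemma cexp_derivative0 (e : R) : 0 < e -> exists2 r : R, 0 < r &
  forall w, normc w < r -> normc (cexp w - 1 - w) <= e * normc w.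
Proof.
move=> e0; have [e' [e'0 e'1 e'e]] : exists e' : R, [/\ 0 < e', e' <= 1 & 16 * e' <= e].
  exists (Num.min (e / 16) 1); split; first by rewrite lt_min ltr01 andbT divr_gt0.
    by rewrite ge_min lexx orbT.
  by rewrite -ler_pdivlMl // mulrC ge_min lexx.
have [r1 r10 H1] := is_derive_le (is_derive_expR (0:R)) e'0.
have [r2 r20 H2] := is_derive_le (is_derive_cos (0:R)) e'0.
have [r3 r30 H3] := is_derive_le (is_derive_sin (0:R)) e'0.
exists (Num.min (Num.min r1 (Num.min r2 r3)) e'); first by rewrite !lt_min r10 r20 r30 e'0.
move=> w; rewrite !lt_min -!andbA => /and4P[w1 w2 w3 we'].
have Rw := Re_normc w; have Iw := Im_normc w.
case: w Rw Iw w1 w2 w3 we' => x y; move: (normc_ge0 (Complex x y)) (normc_le (Complex x y)).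
have [n nE] : exists n : R, n = normc (Complex x y) by exists (normc (Complex x y)).
rewrite -nE => n0 _ Rw Iw w1 w2 w3 we'.
rewrite /= in Rw Iw.
have {}H1 := H1 x (le_lt_trans Rw w1).
have {}H2 := H2 y (le_lt_trans Iw w2).
have {}H3 := H3 y (le_lt_trans Iw w3).
rewrite !add0r expR0 mul1r in H1.
rewrite !add0r cos0 sin0 oppr0 mul0r subr0 in H2.
rewrite !add0r cos0 sin0 mul1r subr0 in H3.
have H1' : `|expR x - 1 - x| <= e' * n by apply: le_trans H1 _; rewrite ler_wpM2l // ltW.
have H2' : `|cos y - 1| <= e' * n by apply: le_trans H2 _; rewrite ler_wpM2l // ltW.
have H3' : `|sin y - y| <= e' * n by apply: le_trans H3 _; rewrite ler_wpM2l // ltW.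
have n1 : n <= 1 by exact: (@le_trans _ R _ _ _ (ltW we') e'1).
have en : e' * n <= e' by rewrite -[leRHS]mulr1 ler_wpM2l // ltW.
have en1 : e' * n <= n by rewrite -[leRHS]mul1r ler_wpM2r.
have := H1'; have := Rw; rewrite !ler_norml => /andP[? ?] /andP[? ?].
have ex2 : `|expR x| <= 4.
  by rewrite ler_norml; apply/andP; split; lra.
have ex1 : `|expR x - 1| <= 2 * e' by rewrite ler_norml; apply/andP; split; lra.
apply: le_trans (normc_le _) _; rewrite !ReImE /=.
have -> : expR x * cos y - 1 - x = (expR x - 1 - x) + expR x * (cos y - 1) by ring.
have -> : expR x * sin y - 0 - y = expR x * (sin y - y) + (expR x - 1) * y by ring.
apply: le_trans (lerD (ler_normD _ _) (ler_normD _ _)) _; rewrite !normrM.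
have b1 : `|expR x| * `|cos y - 1| <= 4 * (e' * n) by exact: ler_pM.
have b2 : `|expR x| * `|sin y - y| <= 4 * (e' * n) by exact: ler_pM.
have b3 : `|expR x - 1| * `|y| <= 2 * e' * n by exact: ler_pM.
have b4 : 16 * e' * n <= e * n by exact: ler_wpM2r.
lra.
Qed.

Lemma differentiable_cexp z : differentiable (@cexp R : C -> C) z.
Proof.
apply/complex_differentiableP; exists (cexp z) => e e0.
have n0 : 0 < normc (cexp z) by rewrite normc_gt0 cexp_neq0.
have [|r r0 H] := @cexp_derivative0 (e / normc (cexp z)); first exact: divr_gt0.
exists r => // w /H {}H.
have -> : cexp w - cexp z - cexp z * (w - z) =
  cexp z * (cexp (w - z) - 1 - (w - z)).
  have -> : cexp w = cexp z * cexp (w - z) :> R[i] by rewrite -cexpD subrKC.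
  by ring.
by rewrite normcM -ler_pdivlMl // mulrA (mulrC _ e).
Qed.

Lemma cexp_periodic (x y : R) : cexp (Complex x (2 * pi + y)) = cexp (Complex x y).
Proof.
have -> : 2 * pi + y = y + pi *+ 2 by rewrite mulr2n; ring.
by rewrite /cexp /= cosD2pi sinD2pi.
Qed.

Lemma cexp_ln (r : R) (y : R) : 0 < r ->
  cexp (Complex (ln r) y) = (r%:C)%C * cexp (Complex 0 y).
Proof. by move=> r0; apply: complex_ext; rewrite !ReImE /= lnK // expR0; ring. Qed.

End ComplexExponential.

(** In the variable [z = x + i y] the function [f (exp z)] is holomorphic on the
    half plane [x <= ln rho] with period [2 * pi * i].  Goursat's theorem on the
    rectangle [[s0, ln rho] x [0, 2 * pi]] says that the integral over [y] does
    not depend on [x]; as [s0] goes to minus infinity it tends to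
    [2 * pi * f 0]. *)
Section MeanValue.
Variables (R : realType) (f : (R[i])^o -> (R[i])^o) (rho : R).
Local Notation C := ((R[i])^o).
Hypothesis rho0 : 0 < rho.
Hypothesis df : forall z : C, normc z <= rho -> differentiable f z.

Let s1 := ln rho.
(* Truncating [x] makes [P] and [Q] continuous everywhere, so that they have
   global primitives. *)
Let z_ (x y : R) : C := Complex (Num.min x s1) y.
Let g (z : C) : C := f (cexp z).
Let P (x y : R) : R := complex.Im (g (z_ x y)).
Let Q (x y : R) : R := complex.Re (g (z_ x y)).

Let dg (z : C) : complex.Re z <= s1 -> differentiable g z.
Proof.
move=> zs; apply: (@differentiable_comp R[i] C C C (@cexp R) f z).
  exact: differentiable_cexp.
by apply: df; rewrite normc_cexp -ler_ln ?posrE ?expR_gt0 // expRK.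
Qed.

Let cont (h : C -> R) (a b : R -> R) : continuous h -> continuous a -> continuous b ->
  continuous (fun t => h (g (z_ (a t) (b t)))).
Proof.
move=> ch ca cb t.
apply: (@continuous_comp R C R (fun t => g (z_ (a t) (b t))) h t); last exact: ch.
apply: (@continuous_comp R C C (fun t => z_ (a t) (b t)) g t).
  apply: continuous_complex; last exact: cb.
  by apply: continuous_min; [exact: ca | exact: cst_continuous].
by apply: differentiable_continuous; apply: dg; rewrite /= ge_min lexx orbT.
Qed.

Lemma mean_value (T : R -> R) :
  (forall t : R, -1 < t -> is_derive t 1 T
     (complex.Re (f ((rho%:C)%C * cexp (Complex 0 t))))) ->
  T (2 * pi) - T 0 = 2 * pi * complex.Re (f 0).
Proof.
move=> dT; have pi0 : 0 < 2 * pi :> R by rewrite mulr_gt0 // pi_gt0.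
apply/eqP; rewrite -subr_eq0 -normr_le0; apply/ler_addgt0Pr => e e0; rewrite add0r.
pose e' := e / (2 * pi).
have e'0 : 0 < e' by rewrite divr_gt0.
have [d dP] : exists2 d : R, 0 < d &
    forall w, normc w < d -> normc (f w - f 0) <= e'.
  have /differentiable_continuous : differentiable f 0.
    by apply: df; rewrite normc0 ltW.
  move/(@cvgrPdist_le _ _ _ (nbhs (0 : C)))/(_ (e'%:C)%C).
  rewrite ltcR => /(_ e'0) /nbhs_normcP[d d0 H]; exists d => // w wd.
  by have := H w; rewrite subr0 => /(_ wd); rewrite normC_normc lecR normcB.
move=> fw.
(* The circle of radius [expR s0] lies where [f] is within [e'] of [f 0]. *)
pose s0 := Num.min s1 (ln d) - 1.
have s01 : s0 <= s1.
  by rewrite lerBlDr; apply: le_trans (_ : s1 <= _); rewrite ?ge_min ?lexx ?lerDl.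
have exs0 : expR s0 < d.
  rewrite -[ltRHS](lnK (_ : d \is Num.pos)) ?posrE // ltr_expR.
  by rewrite ltrBlDr; apply: le_lt_trans (_ : ln d < _); rewrite ?ge_min ?lexx ?orbT ?ltrDl.
have cP y : continuous (P^~ y).
  by apply: (@cont _ (fun x => x) (fun=> y));
    [exact: continuous_Im | move=> ?; exact: cvg_id | exact: cst_continuous].
have cQ x : continuous (Q x).
  by apply: (@cont _ (fun=> x) (fun y => y));
    [exact: continuous_Re | exact: cst_continuous | move=> ?; exact: cvg_id].
have [U UP] := choice (fun y => primitive_exists (s0 - 1) (cP y)).
have [V VP] := choice (fun x => primitive_exists (-1) (cQ x)).
have Ls0 x : s0 <= x -> s0 - 1 < x by move=> h; rewrite ltrBlDr ltr_pwDr.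
have Lt x : 0 <= x -> -1 < x :> R by apply: lt_le_trans; rewrite oppr_lt0.
have step1 x y : (s0 <= x <= s1) && (0 <= y <= 2 * pi) -> is_derive x 1 (U y) (P x y).
  by move=> /andP[/andP[xs _] _]; apply: UP; apply: Ls0.
have step2 x y : (s0 <= x <= s1) && (0 <= y <= 2 * pi) -> is_derive y 1 (V x) (Q x y).
  by move=> /andP[_ /andP[ys _]]; apply: VP; apply: Lt.
have : circulation U V s0 s1 0 (2 * pi) = 0.
  apply: (@goursat R P Q U V s0 s1 0 (2 * pi) s01 (ltW pi0) step1 step2) => x y /andP[/andP[_ xs1] _].
  have /complex_differentiableP[D HD] := @dg (Complex x y) xs1.
  exists (complex.Im D), (complex.Re D), (- complex.Im D) => eps eps0.
  have [r r0 H] := HD eps eps0; exists (r / 2); first exact: divr_gt0.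
  move=> x' y' /andP[/andP[_ x's1] _] hx hy.
  have zE (u v : R) : u <= s1 -> z_ u v = Complex u v by move=> h; rewrite /z_ min_l.
  have dn : normc (Complex x' y' - Complex x y) <= `|x' - x| + `|y' - y|.
    exact: le_trans (normc_le _) _.
  have {}H := H (Complex x' y') (le_lt_trans dn _).
  have {}H : normc (g (Complex x' y') - g (Complex x y) -
     D * (Complex x' y' - Complex x y)) <= eps * (`|x' - x| + `|y' - y|).
    apply: le_trans (H _) _; first by rewrite [ltRHS]splitr ltrD.
    by rewrite ler_wpM2l // ltW.
  rewrite /P /Q !zE //; split.
    apply: le_trans H; apply: le_trans (Im_normc _); rewrite !ReImE /=.
    by rewrite le_eqVlt; apply/orP; left; apply/eqP; congr (`|_|); ring.
  apply: le_trans H; apply: le_trans (Re_normc _); rewrite !ReImE /=.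
  by rewrite le_eqVlt; apply/orP; left; apply/eqP; congr (`|_|); ring.
rewrite /circulation => circ.
(* The horizontal sides cancel, as [g] has period [2 * pi * i]. *)
have hU : (U (2 * pi) s1 - U 0 s1) - (U (2 * pi) s0 - U 0 s0) = 0.
  apply/eqP; rewrite -normr_le0 -[leRHS](mul0r (s1 - s0)).
  apply: (@derive_diff_le R (fun x => U (2 * pi) x - U 0 x) (fun=> 0)) => //.
    move=> x /andP[xs _]; have d1 := UP (2 * pi) x (Ls0 _ xs).
    have d2 := UP 0 x (Ls0 _ xs); derive_tac.
    by rewrite /P /g /z_ -{1}(addr0 (2 * pi)) cexp_periodic subrr.
  by move=> x _; rewrite normr0.
have hV : (V s1 (2 * pi) - T (2 * pi)) - (V s1 0 - T 0) = 0.
  apply/eqP; rewrite -normr_le0 -[leRHS](mul0r (2 * pi - 0)).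
  apply: (@derive_diff_le R (fun x => V s1 x - T x) (fun=> 0) 0) => //; first exact: ltW.
    move=> x /andP[xs _]; have d1 := VP s1 x (Lt _ xs); have d2 := dT x (Lt _ xs).
    by derive_tac; rewrite /Q /g /z_ minxx cexp_ln // subrr.
  by move=> x _; rewrite normr0.
have hV0 : `|V s0 (2 * pi) - V s0 0 - (complex.Re (f 0) * (2 * pi - 0) +
   0 * ((2 * pi) ^+ 2 - 0 ^+ 2) / 2)| <= e' * (2 * pi - 0).
  apply: (@derive_diff_affine_le R (V s0) (Q s0)); first exact: ltW.
    by move=> x /andP[xs _]; apply: VP; apply: Lt.
  move=> x _; rewrite mul0r addr0 /Q -ReN -ReD; apply: le_trans (Re_normc _) _.
  by apply: fw; rewrite normc_cexp /= min_l.
have -> : T (2 * pi) - T 0 - 2 * pi * complex.Re (f 0) =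
  V s0 (2 * pi) - V s0 0 - (complex.Re (f 0) * (2 * pi - 0) +
   0 * ((2 * pi) ^+ 2 - 0 ^+ 2) / 2) by lra.
by apply: le_trans hV0 _; rewrite subr0 /e' mulfVK // gt_eqF.
Qed.

End MeanValue.

(** * The maximum principle and the identity theorem in one variable *)

Section ComplexDifferentiableOps.
Variables (R : realType) (V : normedModType R[i]).
Local Notation C := ((R[i])^o).
Implicit Types f g : V -> C.

Lemma cdiffD f g x : differentiable f x -> differentiable g x ->
  differentiable (fun z => f z + g z : C) x.
Proof. by move=> ? ?; apply: differentiableD. Qed.

Lemma cdiffN f x : differentiable f x -> differentiable (fun z => - f z : C) x.
Proof. by move=> ?; apply: differentiableN. Qed.

Lemma cdiffM f g x : differentiable f x -> differentiable g x ->
  differentiable (fun z => f z * g z : C) x.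
Proof. by move=> df dg; exact: (differentiableM df dg). Qed.

Lemma cdiff_cst (a : C) x : differentiable (fun _ : V => a) x.
Proof. exact: differentiable_cst. Qed.

Lemma cdiff_sum n (F : 'I_n -> V -> C) x : (forall i, differentiable (F i) x) ->
  differentiable (fun z => \sum_i F i z : C) x.
Proof.
move=> h; have -> : (fun z => \sum_i F i z : C) = \sum_i F i.
  by apply/funext => z; rewrite fct_sumE.
exact: differentiable_sum.
Qed.

Lemma cdiff_comp f (g : C -> C) x : differentiable f x -> differentiable g (f x) ->
  differentiable (fun z => g (f z) : C) x.
Proof. by move=> df dg; exact: (differentiable_comp df dg). Qed.

End ComplexDifferentiableOps.

Lemma cdiff_affine (R : realType) (a b z : (R[i])^o) :
  differentiable ((fun z => a + b * z) : (R[i])^o -> (R[i])^o) z.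
Proof.
apply: cdiffD; first exact: cdiff_cst.
apply: cdiffM; first exact: cdiff_cst.
exact: (ex_diff (is_diff_def := is_diff_id z)).
Qed.

Lemma cdiff_comp_affine (R : realType) (f : (R[i])^o -> (R[i])^o) (a b z : (R[i])^o) :
  differentiable f (a + b * z) -> differentiable (fun z => f (a + b * z) : (R[i])^o) z.
Proof. by move=> h; apply: (cdiff_comp (@cdiff_affine R a b z)). Qed.

Lemma derive_ge0_le (R : realType) (S dS : R -> R) (a b : R) : a <= b ->
  (forall x, a <= x <= b -> is_derive x 1 S (dS x)) ->
  (forall x, a <= x <= b -> 0 <= dS x) -> S a <= S b.
Proof.
move=> ab dd d0.
have dU' x : x \in `]a, b[ -> is_derive x 1 S (dS x).
  by rewrite in_itv /= => /andP[ax xb]; apply: dd; rewrite !ltW.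
have cU : {within `[a, b], continuous S}.
  apply: derivable_within_continuous => x; rewrite in_itv /= => xab.
  by have := dd x xab => -[].
have [c cab] := MVT_segment ab dU' cU; rewrite in_itv /= in cab.
by rewrite -subr_ge0 => ->; rewrite mulr_ge0 ?subr_ge0 // d0.
Qed.

Section MaximumPrinciple.
Variable R : realType.
Local Notation C := ((R[i])^o).
Implicit Types (f : C -> C) (z w : C) (r rho : R).

(** Write [w] for the conjugate of [f 0].  The real part of [w * f] is at most
    [M = |f 0| ^ 2] on the circle and has mean [M], hence equals [M] on the
    circle.  The point of argument [pi] is singled out only because it is interior
    to the interval of integration. *)
Lemma circle_max f rho : 0 < rho ->
  (forall z, normc z <= rho -> differentiable f z) ->
  (forall z, normc z <= rho -> normc (f z) <= normc (f 0)) ->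
  normc (f 0) <= normc (f (- (rho%:C)%C)).
Proof.
move=> rho0 df fmax.
have [w0|w0] := eqVneq (f 0) 0; first by rewrite w0 normc0 normc_ge0.
pose w := conjc (f 0); pose h z : C := w * f z.
have M0 : 0 < normc (f 0) by rewrite normc_gt0.
pose M : R := normc (f 0) ^+ 2.
have wN : normc w = normc (f 0) by rewrite /w; case: (f 0) => a b; rewrite /= sqrrN.
have h0 : complex.Re (h 0) = M.
  by rewrite /M normc_sqr /h /w; case: (f 0) => a b; rewrite /= mulNr opprK !expr2.
have dh z : normc z <= rho -> differentiable h z.
  by move=> zr; apply: cdiffM; [exact: cdiff_cst | exact: df].
pose c (t : R) : C := (rho%:C)%C * cexp (Complex 0 t).
have cN (t : R) : normc (c t) = rho.
  by rewrite normcM normc_real normc_cexp expR0 mulr1 ger0_norm // ltW.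
have cu : continuous (fun t => complex.Re (h (c t))).
  move=> t; apply: (@continuous_comp R C R (fun t => h (c t)) _ t).
    apply: (@continuous_comp R C C c h t).
      apply: (@continuous_comp R C C (fun t => Complex 0 t : C)
        (fun z => (rho%:C)%C * cexp z) t).
        by apply: continuous_complex; [exact: cst_continuous | exact: cvg_id].
      apply: differentiable_continuous; apply: cdiffM; first exact: cdiff_cst.
      exact: differentiable_cexp.
    by apply: differentiable_continuous; apply: dh; rewrite cN.
  exact: continuous_Re.
have [T TP] := primitive_exists (-1) cu.
have := mean_value rho0 dh TP; rewrite h0 => mv.
have pi0 : 0 < pi :> R by exact: pi_gt0.
pose S (t : R) : R := M * t - T t; pose dS (t : R) : R := M - complex.Re (h (c t)).
have dSP (t : R) : -1 < t -> is_derive t 1 S (dS t).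
  by move=> /TP dT; derive_tac; rewrite /dS mulr0 mulr1 addr0.
have dS0 (t : R) : 0 <= dS t.
  rewrite subr_ge0; apply: le_trans (ler_norm _) _.
  apply: le_trans (Re_normc _) _; rewrite normcM wN /M expr2.
  by rewrite ler_wpM2l ?normc_ge0 // fmax // cN.
have Smono (s t : R) : 0 <= s -> s <= t -> S s <= S t.
  move=> s0 st; apply: (@derive_ge0_le _ S dS) => // x /andP[sx _].
  by apply: dSP; apply: lt_le_trans sx; apply: lt_le_trans s0; rewrite oppr_lt0.
have Scst (t : R) : 0 <= t -> t <= 2 * pi -> S t = S 0.
  move=> t0 t2pi; apply/eqP; rewrite eq_le (Smono 0 t) // andbT.
  by apply: le_trans (Smono _ _ t0 t2pi) _; rewrite /S; lra.
have dSpi : dS pi = 0.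
  apply/eqP; rewrite -normr_le0; apply/ler_addgt0Pr => e e0; rewrite add0r.
  have [|r r0 H] := is_derive_le (dSP pi _) e0; first by lra.
  pose k : R := Num.min (r / 2) pi.
  have k0 : 0 < k by rewrite lt_min pi0 divr_gt0.
  have kr : k < r.
    by apply: le_lt_trans (_ : r / 2 < _); [rewrite ge_min lexx | lra].
  have kp : k <= pi by rewrite ge_min lexx orbT.
  have := H k; rewrite (ger0_norm (ltW k0)) => /(_ kr).
  rewrite (Scst (pi + k)) ?(Scst pi); [|lra..].
  by rewrite subrr sub0r normrN normrM (ger0_norm (ltW k0)) ler_pM2r //.
have cpi : c pi = - (rho%:C)%C.
  apply: complex_ext; rewrite /c ?ReM ?ImM ?ReN ?ImN /= expR0 cospi sinpi; ring.
move/eqP: dSpi; rewrite /dS subr_eq0 cpi => /eqP ME.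
rewrite -(ler_pM2l M0) -expr2 -/M ME -wN -normcM.
by apply: le_trans (Re_normc _); rewrite ler_norm.
Qed.

Definition in_square r z := (`|complex.Re z| <= r) && (`|complex.Im z| <= r).

(** The largest circle around a maximum point that lies in the square touches the
    boundary; by [circle_max], applied after a rotation that brings the point of
    contact to [- rho], the maximum is attained there, so it is zero. *)
Lemma square_max f r : 0 < r -> (forall z, in_square r z -> differentiable f z) ->
  (forall z, in_square r z -> (`|complex.Re z| == r) || (`|complex.Im z| == r) ->
     f z = 0) -> f 0 = 0.
Proof.
move=> r0 df fb.
pose K : set (R * R) := `[- r, r] `*` `[- r, r].
pose u (p : R * R) : R := normc (f (Complex p.1 p.2)).
have KE p : K p <-> in_square r (Complex p.1 p.2).
  rewrite /K /in_square /= !in_itv /= !ler_norml; split=> [[-> ->//]|/andP[? ?]].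
  by split.
have cK : compact K by apply: compact_setX; exact: segment_compact.
have [||p0 pK pmax] := @compact_EVT_max _ R u K _ cK.
- by exists (0, 0); apply/KE; rewrite /in_square /= normr0 ltW.
- apply: continuous_in_subspaceT => p; rewrite inE => /KE sp.
  apply: (@continuous_comp (R * R)%type C R (fun p => f (Complex p.1 p.2)) _ p).
    apply: (@continuous_comp (R * R)%type C C (fun p => Complex p.1 p.2 : C) f p).
      by apply: continuous_complex; [exact: cvg_fst | exact: cvg_snd].
    by apply: differentiable_continuous; apply: df.
  exact: continuous_normc.
move: pK; rewrite inE => /KE; set z0 : C := Complex p0.1 p0.2 => sz0.
have {}pmax z : in_square r z -> normc (f z) <= normc (f z0).
  move=> sz; have := pmax (complex.Re z, complex.Im z).
  by rewrite inE KE /u /=; case: z sz => a b sz; apply.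
have [fz0|fz0] := eqVneq (f z0) 0.
  apply: eq0_normc; apply/eqP; rewrite eq_le normc_ge0 andbT.
  have := pmax 0; rewrite fz0 normc0; apply.
  by rewrite /in_square /= normr0 ltW.
pose rho : R := r - Num.max `|complex.Re z0| `|complex.Im z0|.
have /andP[R0 I0] := sz0.
have mr : Num.max `|complex.Re z0| `|complex.Im z0| <= r by rewrite ge_max R0 I0.
have rho0 : 0 < rho.
  rewrite lt_neqAle subr_ge0 mr andbT eq_sym subr_eq0.
  apply/negP => /eqP rm; move/negP: fz0; apply; apply/eqP; apply: fb => //.
  by rewrite [in X in _ == X]rm [in X in _ || (_ == X)]rm; case: leP => _; rewrite eqxx ?orbT.
have key (v : C) : normc v = 1 -> f (z0 - v * (rho%:C)%C) != 0.
  move=> v1; rewrite -normc_gt0.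
  have inS z : normc z <= rho -> in_square r (z0 + v * z).
    move=> zr; have vz : normc (v * z) <= rho by rewrite normcM v1 mul1r.
    have h1 : `|complex.Re (v * z)| <= rho by apply: le_trans (Re_normc _) vz.
    have h2 : `|complex.Im (v * z)| <= rho by apply: le_trans (Im_normc _) vz.
    have m1 : `|complex.Re z0| <= Num.max `|complex.Re z0| `|complex.Im z0|.
      by rewrite le_max lexx.
    have m2 : `|complex.Im z0| <= Num.max `|complex.Re z0| `|complex.Im z0|.
      by rewrite le_max lexx orbT.
    rewrite /in_square ReD ImD; apply/andP.
    by split; apply: le_trans (ler_normD _ _) _; rewrite /rho in h1 h2; lra.
  have := @circle_max (fun z => f (z0 + v * z)) rho rho0.
  rewrite mulr0 addr0 mulrN => cm; apply: lt_le_trans (cm _ _).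
  - by rewrite normc_gt0.
  - by move=> z zr; apply: cdiff_comp_affine; apply: df; apply: inS.
  - by move=> z zr; apply: pmax; apply: inS.
have inS' (v : C) : normc v = 1 -> in_square r (z0 - v * (rho%:C)%C).
  move=> v1; have vz : normc (v * (rho%:C)%C) <= rho.
    by rewrite normcM v1 mul1r normc_real ger0_norm // ltW.
  have h1 := le_trans (Re_normc _) vz; have h2 := le_trans (Im_normc _) vz.
  have m1 : `|complex.Re z0| <= Num.max `|complex.Re z0| `|complex.Im z0|.
    by rewrite le_max lexx.
  have m2 : `|complex.Im z0| <= Num.max `|complex.Re z0| `|complex.Im z0|.
    by rewrite le_max lexx orbT.
  rewrite /in_square ReD ImD ReN ImN; apply/andP.
  by split; apply: le_trans (ler_normD _ _) _; rewrite normrN; rewrite /rho in h1 h2; lra.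
have bad (v : C) : normc v = 1 ->
  (`|complex.Re (z0 - v * (rho%:C)%C)| == r) || (`|complex.Im (z0 - v * (rho%:C)%C)| == r)
  -> False.
  by move=> v1 b; have /negP := key v v1; apply; rewrite fb // inS'.
have e1 : rho = r - `|complex.Re z0| \/ rho = r - `|complex.Im z0|.
  by rewrite /rho; case: leP => _; [right | left].
exfalso; case: e1 => e1.
- have [x0|x0] := leP 0 (complex.Re z0).
    apply: (bad (-1)); first by rewrite normcN normc1.
    apply/orP; left; rewrite (_ : complex.Re _ = r) ?ger0_norm ?eqxx // ?ltW //.
    by rewrite !(ReD, ReN, ReM, ImN) /= e1 ger0_norm //; ring.
  apply: (bad 1); first by rewrite normc1.
  apply/orP; left; rewrite (_ : complex.Re _ = - r) ?normrN ?ger0_norm ?eqxx // ?ltW //.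
  by rewrite !(ReD, ReN, ReM, ImN) /= e1 ltr0_norm //; ring.
- have [x0|x0] := leP 0 (complex.Im z0).
    apply: (bad (Complex 0 (-1))); first by rewrite normc_imag normrN1.
    apply/orP; right.
    rewrite (_ : complex.Im _ = r) ?ger0_norm ?eqxx // ?ltW //.
    by rewrite !(ImD, ImN, ImM) /= e1 ger0_norm //; ring.
  apply: (bad (Complex 0 1)); first by rewrite normc_imag normr1.
  apply/orP; right.
  rewrite (_ : complex.Im _ = - r) ?normrN ?ger0_norm ?eqxx // ?ltW //.
  by rewrite !(ImD, ImN, ImM) /= e1 ltr0_norm //; ring.
Qed.

(** The product of the four quarter turns of [f] vanishes on the boundary, and its
    value at the centre is [f 0 ^ 4]. *)
Lemma square_side f r : 0 < r -> (forall z, in_square r z -> differentiable f z) ->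
  (forall z, in_square r z -> complex.Im z = - r -> f z = 0) -> f 0 = 0.
Proof.
move=> r0 df f0.
have I0 z : Complex 0 1 * z = Complex (- complex.Im z) (complex.Re z).
  by case: z => a b; apply: complex_ext; rewrite ?ReM ?ImM /=; ring.
pose g z : C := f z * f (0 + -1 * z) * (f (0 + Complex 0 1 * z) * f (0 + - Complex 0 1 * z)).
have sN z : in_square r z -> in_square r (0 + -1 * z).
  by rewrite /in_square add0r mulN1r ReN ImN !normrN.
have sI z : in_square r z -> in_square r (0 + Complex 0 1 * z).
  by rewrite /in_square add0r I0 /= normrN andbC.
have sI' z : in_square r z -> in_square r (0 + - Complex 0 1 * z).
  by rewrite /in_square add0r mulNr I0 ReN ImN /= !normrN andbC.
have : g 0 = 0.
  apply: (@square_max g r) => // z sz.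
    apply: cdiffM; apply: cdiffM; first exact: df.
    - by apply: cdiff_comp_affine; apply/df/sN.
    - by apply: cdiff_comp_affine; apply/df/sI.
    - by apply: cdiff_comp_affine; apply/df/sI'.
  case/orP; rewrite eqr_norml => /andP[/orP[] /eqP h _]; rewrite /g.
  - rewrite [X in _ * (_ * X)](f0 _ (sI' _ sz)) ?mulr0 //.
    by rewrite add0r mulNr I0 ImN /= h.
  - by rewrite [X in _ * (X * _)](f0 _ (sI _ sz)) ?mul0r ?mulr0 // add0r I0 /= h.
  - rewrite [X in _ * X * _](f0 _ (sN _ sz)) ?mulr0 ?mul0r //.
    by rewrite add0r mulN1r ImN h.
  - by rewrite (f0 _ sz) // !mul0r.
rewrite /g !mulr0 !addr0 => /eqP; rewrite !mulf_eq0 !orbb => /eqP //.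
Qed.

(** The square with vertices [- 1], [1], [1 + 2 i], [- 1 + 2 i] has its centre at
    [i] and a side on the real line. *)
Lemma identity_real_segment f :
  (forall z, `|complex.Re z| <= 1 -> 0 <= complex.Im z <= 2 -> differentiable f z) ->
  (forall x : R, `|x| <= 1 -> f (x%:C)%C = 0) -> f (Complex 0 1) = 0.
Proof.
move=> df f0; have := @square_side (fun z => f (Complex 0 1 + 1 * z)) 1.
rewrite mulr0 addr0; apply; first exact: ltr01.
  move=> z; case/andP=> h1 h2; apply: cdiff_comp_affine; apply: df; rewrite mul1r.
    by rewrite ReD add0r.
  by rewrite ImD /=; move: h2; rewrite ler_norml => /andP[? ?]; apply/andP; split; lra.
move=> z; case/andP=> h1 _ h2; rewrite mul1r.
have -> : Complex 0 1 + z = (complex.Re z)%:C%C.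
  by apply: complex_ext; rewrite ?ReD ?ImD /= ?h2; ring.
exact: f0.
Qed.

(** Vanishing propagates from a disc to one of radius larger by the factor [5 / 4]:
    a point at distance [d] from the origin is the centre of a square of side [d]
    facing the origin, whose nearest side is within [d / sqrt 2 < 4 / 5 * d] of
    it.  The squares used stay within distance [5 / 2] of the origin. *)
Lemma identity_disc f rho : 0 < rho ->
  (forall z, normc z <= 4 -> differentiable f z) ->
  (forall z, normc z < rho -> f z = 0) -> f 1 = 0.
Proof.
move=> rho0 df f0.
have step n z : normc z < 5 / 4 -> normc z < (5 / 4) ^+ n * rho -> f z = 0.
  elim: n z => [|n IH] z; first by rewrite expr0 mul1r => _; apply: f0.
  move=> z1 z2; have [->|z0] := eqVneq z 0; first by apply: f0; rewrite normc0.
  set d := normc z in z1 z2.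
  have d0 : 0 < d by rewrite normc_gt0.
  have dC : (d%:C)%C != 0 :> R[i] by rewrite eq_complex /= gt_eqF.
  pose v : C := Complex 0 (-1) * z / (d%:C)%C.
  have i1 : Complex 0 (-1) * Complex 0 1 = 1 :> R[i].
    by apply: complex_ext; rewrite ?ReM ?ImM /=; ring.
  have v1 : normc v = 1.
    by rewrite !normcM normc_imag normrN1 mul1r normcV normc_real ger0_norm ?divff ?gt_eqF // ltW.
  have := @square_side (fun w => f (z + v * w)) (d / 2).
  rewrite mulr0 addr0; apply; first by lra.
    move=> w /andP[h1 h2]; apply: cdiff_comp_affine; apply: df.
    apply: le_trans (le_normcD _ _) _; rewrite normcM v1 mul1r -/d.
    have := normc_le w; lra.
  move=> w /andP[h1 h2] h3.
  have hN : normc (z + v * w) <= 4 / 5 * d.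
    have -> : z + v * w = v * ((complex.Re w)%:C + Complex 0 1 * (d / 2)%:C)%C.
      have -> : w = ((complex.Re w)%:C - Complex 0 1 * (d / 2)%:C)%C.
        by apply: complex_ext; rewrite !(ReD,ImD,ReN,ImN,ReM,ImM) /= ?h3; ring.
      have -> : complex.Re ((complex.Re w)%:C - Complex 0 1 * (d / 2)%:C)%C = complex.Re w.
        by rewrite !(ReD,ReN,ReM) /=; ring.
      have -> : z = v * (Complex 0 1 * (d%:C)%C).
        by rewrite /v -[LHS]mul1r -i1; field.
      have -> : (d%:C)%C = ((d / 2)%:C + (d / 2)%:C)%C.
        by apply: complex_ext; rewrite ?ReD ?ImD /=; field.
      by ring.
    rewrite normcM v1 mul1r.
    have d45 : 0 <= 4 / 5 * d by lra.
    rewrite -ler_sqr ?nnegrE ?normc_ge0 //.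
    rewrite normc_sqr !(ReD,ImD,ReN,ImN,ReM,ImM) /=.
    have : complex.Re w ^+ 2 <= (d / 2) ^+ 2.
      by rewrite -[leLHS]real_normK ?num_real // ler_sqr ?nnegrE // ltW // divr_gt0.
    have : 0 <= d ^+ 2 by rewrite sqr_ge0.
    lra.
  apply: IH; apply: le_lt_trans hN _; first by lra.
  by move: z2; rewrite exprS -mulrA; set t := _ * rho; lra.
have [n hn] := expr2_unbounded rho^-1.
apply: (step (4 * n)); first by rewrite normc1; lra.
rewrite normc1 -ltr_pdivrMr // div1r; apply: lt_le_trans hn _.
by rewrite exprM lerXn2r // ?nnegrE; lra.
Qed.

End MaximumPrinciple.

(** * The principal logarithm *)

Section ComplexLogarithm.
Variable R : realType.
Local Notation C := ((R[i])^o).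
Implicit Types z w : C.

(** Principal logarithm on the plane slit along the nonpositive reals; the
    argument is twice the angle subtended at the point [- normc z]. *)
Definition clog z : C :=
  Complex (ln (normc z)) (2 * atan (complex.Im z / (normc z + complex.Re z))).

Definition slit z : Prop := 0 < normc z + complex.Re z.

Lemma slitP z : (complex.Im z = 0 -> 0 < complex.Re z) -> slit z.
Proof.
move=> h; rewrite /slit; have [I0|I0] := eqVneq (complex.Im z) 0.
  by rewrite ltr_wpDl ?normc_ge0 // h.
have I2 : 0 < complex.Im z ^+ 2 by rewrite exprn_even_gt0.
have := normc_sqr z; have := normc_ge0 z; set r := normc z => r0 rE.
rewrite -ltrBlDr sub0r; case: (leP 0 (complex.Re z)) => x0.
  rewrite lt_neqAle; apply/andP; split; last by apply: le_trans r0; rewrite oppr_le0.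
  apply/eqP => e; move: rE; rewrite -e sqrrN; lra.
have x1 : 0 <= - complex.Re z by rewrite oppr_ge0 ltW.
rewrite -(ltr_sqr (x1 : _ \in Num.nneg) (r0 : _ \in Num.nneg)) sqrrN rE; lra.
Qed.

Lemma slit_neq0 z : slit z -> z != 0.
Proof. by apply: contraTneq => ->; rewrite /slit normc0 addr0 ltxx. Qed.

Lemma slit_normc_gt0 z : slit z -> 0 < normc z.
Proof. by move=> /slit_neq0; rewrite normc_gt0. Qed.

(** If [t] is the tangent of half the argument of [z], then
    [1 / (1 + t ^ 2) = (|z| + Re z) / (2 * |z|)], and the double angle formulas
    give back [z]. *)
Lemma cexp_clog z : slit z -> cexp (clog z) = z.
Proof.
move=> sz; have r0 := slit_normc_gt0 sz; have rE := normc_sqr z.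
rewrite /cexp /clog /= lnK ?posrE //.
set t := complex.Im z / _; have cE := cos_atan t.
have D0 : normc z + complex.Re z != 0 by rewrite gt_eqF.
have rn0 : normc z != 0 by rewrite gt_eqF.
have c2 : cos (atan t) ^+ 2 = (normc z + complex.Re z) / (2 * normc z).
  have t1 : 0 <= 1 + t ^+ 2 by rewrite addr_ge0 // sqr_ge0.
  rewrite cE exprVn sqr_sqrtr // /t expr_div_n.
  have -> : complex.Im z ^+ 2 = normc z ^+ 2 - complex.Re z ^+ 2 by rewrite rE; ring.
  have -> : 1 + (normc z ^+ 2 - complex.Re z ^+ 2) / (normc z + complex.Re z) ^+ 2
    = 2 * normc z / (normc z + complex.Re z) by field.
  by rewrite invf_div.
have s_ : sin (atan t) = t * cos (atan t).
  have := atanK t; rewrite /tan => e; rewrite -{2}e mulfVK // cE invr_eq0.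
  by rewrite gt_eqF // sqrtr_gt0 ltr_pwDl // sqr_ge0.
have -> : 2 * atan t = atan t *+ 2 by rewrite mulr_natl.
rewrite cos_mulr2n sin_mulr2n s_; apply: complex_ext => /=.
  by rewrite c2 mulr2n; field.
rewrite (_ : _ * (_ *+ 2) = 2 * normc z * t * cos (atan t) ^+ 2); last by ring.
by rewrite c2 /t; field; rewrite ?D0 ?rn0.
Qed.

Lemma continuous_slit z : slit z -> \forall w \near z, slit w.
Proof.
move=> sz; have H : {for z, continuous (fun w : C => normc w + complex.Re w)}.
  by apply: (@cvgD _ _ _ (nbhs z)); [exact: continuous_normc | exact: continuous_Re].
exact: (@cvgr_gt _ _ (nbhs z) _ _ _ H _ sz).
Qed.

Lemma continuous_clog z : slit z -> {for z, continuous (clog : C -> C)}.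
Proof.
move=> sz; apply: continuous_complex.
  apply: (@continuous_comp C R R (@normc R) (@ln R) z); first exact: continuous_normc.
  by apply: continuous_ln; apply: slit_normc_gt0.
apply: (@continuous_comp C R R (fun z => complex.Im z / (normc z + complex.Re z))
  (fun t => 2 * atan t) z).
  apply: (@cvgM _ _ (nbhs z)); first exact: continuous_Im.
  apply: cvgV; first by rewrite gt_eqF.
  by apply: (@cvgD _ _ _ (nbhs z)); [exact: continuous_normc | exact: continuous_Re].
by apply: cvgM; [exact: cvg_cst | exact: continuous_atan].
Qed.

(** A continuous right inverse of the exponential is differentiable, since the
    derivative of the latter does not vanish. *)
Lemma differentiable_clog z : slit z -> differentiable (clog : C -> C) z.
Proof.
move=> sz; have z0 := slit_neq0 sz; have n0 := slit_normc_gt0 sz.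
apply/complex_differentiableP; exists z^-1 => e e0.
have [eta [eta0 eta2 etae]] : exists eta : R,
    [/\ 0 < eta, eta <= 2^-1 & 2 * eta <= e * normc z].
  exists (Num.min 2^-1 (e * normc z / 2)); split.
  - by rewrite lt_min invr_gt0 ltr0n divr_gt0 // mulr_gt0.
  - by rewrite ge_min lexx.
  - by rewrite -ler_pdivlMl // mulrC ge_min lexx orbT.
have [d d0 Hd] := @cexp_derivative0 R eta eta0.
have /nbhs_normcP[r1 r10 H1] := continuous_slit sz.
have /(@cvgrPdist_lt _ _ _ (nbhs z))/(_ (d%:C)%C) := continuous_clog sz.
rewrite ltcR => /(_ d0) /nbhs_normcP[r2 r20 H2].
exists (Num.min r1 r2); first by rewrite lt_min r10.
move=> w; rewrite lt_min => /andP[/H1 sw /H2]; rewrite normC_normc ltcR normcB => /Hd.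
set de := clog w - clog z => {}Hd.
have wE : w = z * cexp de :> R[i].
  by rewrite -[in RHS](cexp_clog sz) -cexpD /de subrKC cexp_clog.
have -> : clog w - clog z - z^-1 * (w - z) = - (cexp de - 1 - de).
  by rewrite -/de wE; field.
rewrite normcN.
have wz : w - z = z * (cexp de - 1 - de + de) by rewrite {1}wE; ring.
have h : normc de <= 2 * (normc (w - z) / normc z).
  rewrite {1}wz normcM mulrAC mulfV ?gt_eqF // mul1r.
  have := le_normcD (cexp de - 1 - de + de) (- (cexp de - 1 - de)).
  rewrite normcN addrAC subrr add0r => h.
  have h2 : eta * normc de <= 2^-1 * normc de by rewrite ler_wpM2r ?normc_ge0.
  lra.
apply: le_trans Hd _; apply: le_trans (ler_wpM2l (ltW eta0) h) _.
rewrite !mulrA ler_pdivrMr //.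
have := ler_wpM2r (normc_ge0 (w - z)) etae; lra.
Qed.

Lemma clog_real (x : R) : 0 < x -> clog (x%:C)%C = (ln x)%:C%C.
Proof.
move=> x0; rewrite /clog normc_real ger0_norm ?ltW // mul0r atan0 mulr0.
by [].
Qed.

Lemma clog_Im_bound z : `|complex.Im (clog z)| <= pi.
Proof.
rewrite /= ler_norml.
set t := _ / _; have h1 := atan_gtNpi2 t; have h2 := atan_ltpi2 t.
apply/andP; split; lra.
Qed.

End ComplexLogarithm.

(** * H-type algebras in orthonormal coordinates *)

Section EuclideanRows.
Variable R : realType.

Lemma dotC d (x y : 'rV[R]_d) : dot x y = dot y x.
Proof. by apply: eq_bigr => i _; rewrite mulrC. Qed.

Lemma dotDl d (x y z : 'rV[R]_d) : dot (x + y) z = dot x z + dot y z.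
Proof. by rewrite -big_split; apply: eq_bigr => i _; rewrite mxE mulrDl. Qed.

Lemma dotZl d (a : R) (x z : 'rV[R]_d) : dot (a *: x) z = a * dot x z.
Proof. by rewrite /dot mulr_sumr; apply: eq_bigr => i _; rewrite mxE mulrA. Qed.

Lemma dotDr d (x y z : 'rV[R]_d) : dot z (x + y) = dot z x + dot z y.
Proof. by rewrite dotC dotDl !(dotC z). Qed.

Lemma dotZr d (a : R) (x z : 'rV[R]_d) : dot z (a *: x) = a * dot z x.
Proof. by rewrite dotC dotZl (dotC z). Qed.

Lemma dotNl d (x z : 'rV[R]_d) : dot (- x) z = - dot x z.
Proof. by rewrite -scaleN1r dotZl mulN1r. Qed.

Lemma dotNr d (x z : 'rV[R]_d) : dot z (- x) = - dot z x.
Proof. by rewrite dotC dotNl dotC. Qed.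

Lemma dot0l d (x : 'rV[R]_d) : dot 0 x = 0.
Proof. by rewrite -(scale0r 0) dotZl mul0r. Qed.

Lemma dot0r d (x : 'rV[R]_d) : dot x 0 = 0.
Proof. by rewrite dotC dot0l. Qed.

Definition dotE := (dotDl, dotDr, dotZl, dotZr, dotNl, dotNr, dot0l, dot0r).

Lemma dot_ge0 d (x : 'rV[R]_d) : 0 <= dot x x.
Proof. by apply: sumr_ge0 => i _; rewrite -expr2 sqr_ge0. Qed.

Lemma dot_eq0 d (x : 'rV[R]_d) : dot x x = 0 -> x = 0.
Proof.
move=> h; apply/rowP => i; rewrite mxE; apply/eqP; rewrite -sqrf_eq0 expr2.
apply/eqP; move: i isT; apply: psumr_eq0P h => i _; by rewrite -expr2 sqr_ge0.
Qed.

Lemma dot_delta d (i : 'I_d) (x : 'rV[R]_d) : dot x (delta_mx 0 i) = x 0 i.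
Proof.
rewrite /dot (bigD1 i) //= big1 => [|j ji]; rewrite mxE ?eqxx ?mulr1 ?addr0 //.
by rewrite (negbTE ji) mulr0.
Qed.

Lemma dot_inj d (x y : 'rV[R]_d) : (forall z, dot x z = dot y z) -> x = y.
Proof. by move=> h; apply/rowP => i; rewrite -!dot_delta h. Qed.

Lemma enorm_ge0 d (x : 'rV[R]_d) : 0 <= enorm x.
Proof. exact: sqrtr_ge0. Qed.

Lemma enorm_sqr d (x : 'rV[R]_d) : enorm x ^+ 2 = dot x x.
Proof. by rewrite sqr_sqrtr // dot_ge0. Qed.

Lemma enorm0 d : enorm (0 : 'rV[R]_d) = 0.
Proof. by rewrite /enorm dot0l sqrtr0. Qed.

Lemma enorm_eq0 d (x : 'rV[R]_d) : enorm x = 0 -> x = 0.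
Proof. by move=> h; apply: dot_eq0; rewrite -enorm_sqr h expr0n. Qed.

Lemma enormZ d (a : R) (x : 'rV[R]_d) : enorm (a *: x) = `|a| * enorm x.
Proof. by rewrite /enorm !dotE mulrA -expr2 sqrtrM ?sqr_ge0 // sqrtr_sqr. Qed.

Lemma cauchy_schwarz d (x y : 'rV[R]_d) : `|dot x y| <= enorm x * enorm y.
Proof.
have [->|x0] := eqVneq x 0; first by rewrite dot0l normr0 mulr_ge0 ?enorm_ge0.
have x2 : 0 < dot x x.
  rewrite lt_neqAle dot_ge0 andbT eq_sym; apply: contra x0 => /eqP /dot_eq0 ->.
  exact: eqxx.
have := dot_ge0 (dot x x *: y - dot x y *: x); rewrite !dotE (dotC y x).
rewrite [X in 0 <= X](_ : _ = dot x x * (dot x x * dot y y - dot x y ^+ 2)); last by ring.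
rewrite pmulr_rge0 // subr_ge0 => h.
rewrite -ler_sqr ?nnegrE ?mulr_ge0 ?enorm_ge0 //.
by rewrite exprMn !enorm_sqr real_normK ?num_real.
Qed.

Lemma enormD d (x y : 'rV[R]_d) : enorm (x + y) <= enorm x + enorm y.
Proof.
rewrite -ler_sqr ?nnegrE ?addr_ge0 ?enorm_ge0 // enorm_sqr !dotE (dotC y x).
have := le_trans (ler_norm _) (cauchy_schwarz x y).
have := enorm_sqr x; have := enorm_sqr y; rewrite sqrrD mulr2n; lra.
Qed.

End EuclideanRows.

Section BracketJ.
Variables (R : realType) (m k : nat) (b : 'I_m -> 'I_m -> 'I_k -> R).
Implicit Types (x y V : 'rV[R]_m) (Z : 'rV[R]_k).

(** The operator [J_Z], characterized by [dot_Jmap]. *)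
Definition Jmap Z V : 'rV[R]_m := \row_j \sum_i \sum_c b i j c * V 0 i * Z 0 c.

Lemma dot_Jmap Z V y : dot (Jmap Z V) y = dot Z (bracket b V y).
Proof.
rewrite /dot /bracket /Jmap.
under eq_bigr do rewrite mxE mulr_suml.
under [RHS]eq_bigr do rewrite mxE mulr_sumr.
rewrite exchange_big [RHS]exchange_big; apply: eq_bigr => i _ /=.
under eq_bigr do rewrite mulr_suml.
under [RHS]eq_bigr do rewrite mulr_sumr.
rewrite exchange_big; apply: eq_bigr => c _; apply: eq_bigr => j _.
by rewrite mulrC; ring.
Qed.

Lemma bracketDl x y V : bracket b (x + y) V = bracket b x V + bracket b y V.
Proof.
apply/rowP => c; rewrite !mxE -big_split; apply: eq_bigr => i _.
rewrite -big_split; apply: eq_bigr => j _; rewrite mxE /=; ring.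
Qed.

Lemma bracketZl (a : R) x V : bracket b (a *: x) V = a *: bracket b x V.
Proof.
apply/rowP => c; rewrite !mxE mulr_sumr; apply: eq_bigr => i _.
by rewrite mulr_sumr; apply: eq_bigr => j _; rewrite mxE; ring.
Qed.

Lemma bracketDr x y V : bracket b V (x + y) = bracket b V x + bracket b V y.
Proof.
apply/rowP => c; rewrite !mxE -big_split; apply: eq_bigr => i _.
by rewrite -big_split; apply: eq_bigr => j _; rewrite mxE /=; ring.
Qed.

Lemma bracketZr (a : R) x V : bracket b V (a *: x) = a *: bracket b V x.
Proof.
apply/rowP => c; rewrite !mxE mulr_sumr; apply: eq_bigr => i _.
by rewrite mulr_sumr; apply: eq_bigr => j _; rewrite mxE; ring.
Qed.

Lemma bracketNl x V : bracket b (- x) V = - bracket b x V.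
Proof. by rewrite -scaleN1r bracketZl scaleN1r. Qed.

Lemma bracketNr x V : bracket b V (- x) = - bracket b V x.
Proof. by rewrite -scaleN1r bracketZr scaleN1r. Qed.

Lemma bracket0l V : bracket b 0 V = 0.
Proof. by rewrite -(scale0r 0) bracketZl scale0r. Qed.

Lemma bracket0r V : bracket b V 0 = 0.
Proof. by rewrite -(scale0r 0) bracketZr scale0r. Qed.

Definition bracketE :=
  (bracketDl, bracketDr, bracketZl, bracketZr, bracketNl, bracketNr, bracket0l, bracket0r).

(** All that is used of an H-type algebra.  A centre of positive dimension is
    needed to choose a direction in it. *)
Definition htype_constants : Prop :=
  [/\ (0 < k)%N, forall V, bracket b V V = 0
    & forall Z V, Jmap Z (Jmap Z V) = - dot Z Z *: V].

Hypothesis Hb : htype_constants.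

Lemma bracketC x y : bracket b x y = - bracket b y x.
Proof.
have [_ alt _] := Hb; have := alt (x + y).
by rewrite !bracketE !alt add0r addr0 => h; apply/eqP; rewrite -addr_eq0 h.
Qed.

Lemma dot_Jmap_skew Z V y : dot (Jmap Z V) y = - dot V (Jmap Z y).
Proof. by rewrite dot_Jmap bracketC dotE -dot_Jmap dotC. Qed.

Lemma dot_Jmap_self Z V : dot (Jmap Z V) V = 0.
Proof. by have [_ alt _] := Hb; rewrite dot_Jmap alt dot0r. Qed.

Lemma dot_JJ Z V : dot (Jmap Z V) (Jmap Z V) = dot Z Z * dot V V.
Proof.
by have [_ _ J2] := Hb; rewrite dot_Jmap_skew J2 !dotE; ring.
Qed.

Lemma JmapDl Z Z' V : Jmap (Z + Z') V = Jmap Z V + Jmap Z' V.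
Proof. by apply: dot_inj => y; rewrite !(dotE, dot_Jmap). Qed.

Lemma JmapDr Z x y : Jmap Z (x + y) = Jmap Z x + Jmap Z y.
Proof. by apply: dot_inj => V; rewrite !(dotE, dot_Jmap, bracketE). Qed.

Lemma JmapZr Z a x : Jmap Z (a *: x) = a *: Jmap Z x.
Proof. by apply: dot_inj => V; rewrite !(dotE, dot_Jmap, bracketE). Qed.

Lemma JmapZl Z a x : Jmap (a *: Z) x = a *: Jmap Z x.
Proof. by apply: dot_inj => V; rewrite !(dotE, dot_Jmap). Qed.

(** Polarizing [J_Z ^ 2 = - |Z| ^ 2] in [Z]. *)
Lemma dot_JJ2 Z Z' V : dot (Jmap Z V) (Jmap Z' V) = dot Z Z' * dot V V.
Proof.
have := dot_JJ (Z + Z') V; rewrite JmapDl !dotE !dot_JJ.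
rewrite (dotC (Jmap Z' V)) (dotC Z' Z); lra.
Qed.

(** Hence [ad V] is onto the centre for [V != 0], with an explicit solution of
    [[V, y] = Z]. *)
Lemma bracket_Jmap Z V : bracket b V (Jmap Z V) = dot V V *: Z.
Proof.
by apply: dot_inj => Z'; rewrite dotC -dot_Jmap dot_JJ2 !dotE (dotC Z'); ring.
Qed.

Lemma enorm_Jmap Z V : enorm (Jmap Z V) = enorm Z * enorm V.
Proof. by rewrite /enorm dot_JJ sqrtrM ?dot_ge0. Qed.

(** Pair [[x, y]] with itself and use that [J_Z] is [|Z|] times an isometry. *)
Lemma enorm_bracket x y : enorm (bracket b x y) <= enorm x * enorm y.
Proof.
set z := bracket b x y; have := enorm_ge0 z; rewrite le_eqVlt => /orP[/eqP <-|z0].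
  by rewrite mulr_ge0 ?enorm_ge0.
rewrite -(ler_pM2l z0) -expr2 enorm_sqr {2}/z -dot_Jmap mulrA -enorm_Jmap.
exact: le_trans (ler_norm _) (cauchy_schwarz _ _).
Qed.

Lemma unit_direction (Z : 'rV[R]_k) : exists u, dot u u = 1 /\ Z = enorm Z *: u.
Proof.
have [k0 _ _] := Hb.
have [z0|z0] := eqVneq (enorm Z) 0.
  exists (delta_mx 0 (Ordinal k0)); split; first by rewrite dot_delta mxE !eqxx.
  by rewrite z0 scale0r; apply: enorm_eq0.
exists ((enorm Z)^-1 *: Z); split; last by rewrite scalerA mulfV // scale1r.
by rewrite !dotE -enorm_sqr; field.
Qed.

End BracketJ.

Section HTypeCoordinates.
Variables (R : realType) (n : vectType R) (br : n -> n -> n) (ip : n -> n -> R).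
Variables (m k : nat) (e : 'I_m -> n) (f : 'I_k -> n).
Hypotheses (H : is_htype_algebra br ip)
  (He : is_orthonormal_basis ip (center_orth br ip) e)
  (Hf : is_orthonormal_basis ip (lie_center br) f).

Let b := structure_constants br ip e f.

Let linear_sum (W : lmodType R) (g : n -> W) d (a : 'I_d -> R) (v : 'I_d -> n) :
  linear g -> g (\sum_i a i *: v i) = \sum_i a i *: g (v i).
Proof.
move=> lg; have g0 : g 0 = 0.
  by have := lg (-1) 0 0; rewrite scaleN1r oppr0 addr0 scaleN1r addNr.
have gD x y : g (x + y) = g x + g y by have := lg 1 x y; rewrite !scale1r.
rewrite (big_morph g gD g0); apply: eq_bigr => i _.
by have := lg (a i) (v i) 0; rewrite !addr0 g0 addr0.
Qed.

Let vecV (x : 'rV[R]_m) : n := \sum_i x 0 i *: e i.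
Let vecZ (z : 'rV[R]_k) : n := \sum_i z 0 i *: f i.

Let ipl : (forall y, linear (ip^~ y : n -> R^o)) /\ forall x, linear (ip x : n -> R^o).
Proof. by have [_ [h _ _] _ _] := H. Qed.

Let brl : (forall y, linear (br^~ y)) /\ forall x, linear (br x).
Proof. by have [[h _ _] _ _ _] := H. Qed.

Let ip_sumr d x (a : 'I_d -> R) v : ip x (\sum_i a i *: v i) = \sum_i a i * ip x (v i).
Proof. exact: (@linear_sum R^o (ip x) d a v (ipl.2 x)). Qed.

Let ip_suml d x (a : 'I_d -> R) v : ip (\sum_i a i *: v i) x = \sum_i a i * ip (v i) x.
Proof. exact: (@linear_sum R^o (ip^~ x) d a v (ipl.1 x)). Qed.

Let ipC x y : ip x y = ip y x.
Proof. by have [_ [_ h _] _ _] := H. Qed.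

Let ip_vecV x j : ip (vecV x) (e j) = x 0 j.
Proof.
have [_ on _] := He; rewrite ip_suml (bigD1 j) //= on eqxx mulr1 big1 ?addr0 //.
by move=> i ij; rewrite on (negbTE ij) mulr0.
Qed.

Let ip_bracket x y c : ip (br (vecV x) (vecV y)) (f c) = bracket b x y 0 c.
Proof.
rewrite mxE /vecV (@linear_sum n (br^~ _) _ _ _ (brl.1 _)) ip_suml.
apply: eq_bigr => i _; rewrite (@linear_sum n (br _) _ _ _ (brl.2 _)) ip_suml mulr_sumr.
by apply: eq_bigr => j _; rewrite /b /structure_constants; ring.
Qed.

Let center_orth_vecV x : center_orth br ip (vecV x).
Proof.
move=> z hz; have [he _ _] := He; rewrite ip_suml big1 // => i _.
by rewrite (he i z hz) mulr0.
Qed.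

Let lie_center_vecZ z : lie_center br (vecZ z).
Proof.
move=> x; have [hf _ _] := Hf.
rewrite /vecZ (@linear_sum n (br^~ x) _ _ _ (brl.1 x)) big1 // => i _.
by rewrite (hf i x) scaler0.
Qed.

(** The operator given abstractly maps [vecV V] to [vecV (Jmap b Z V)], because both
    have the same inner products with the basis. *)
Lemma htype_structure_constants : htype_constants b.
Proof.
have [_ _ _ [J [HJ J2]]] := H.
have JE Z V : J (vecZ Z) (vecV V) = vecV (Jmap b Z V).
  have [coJ ipJ] := HJ _ _ (lie_center_vecZ Z) (center_orth_vecV V).
  have [he _ spanE] := He; have [a aE] := spanE _ coJ.
  have aE' : J (vecZ Z) (vecV V) = vecV (\row_i a i).
    by rewrite aE; apply: eq_bigr => i _; rewrite mxE.
  rewrite aE'; congr vecV; apply/rowP => j; rewrite -[LHS]ip_vecV -aE' ipJ; last exact: he.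
  rewrite mxE ip_suml /vecV (@linear_sum n (br^~ _) _ _ _ (brl.1 _)).
  under eq_bigr do rewrite ip_sumr mulr_sumr.
  rewrite exchange_big; apply: eq_bigr => i _; apply: eq_bigr => c _ /=.
  by rewrite /b /structure_constants ipC; ring.
split.
- have [_ _ [cbr [x [y /negP bxy]]] _] := H.
  rewrite lt0n; apply/negP => /eqP k0; apply: bxy; apply/eqP.
  have [_ _ /(_ _ (cbr x y)) [a ->]] := Hf; rewrite big1 // => i _.
  by case: i => i ik; exfalso; move: ik; rewrite k0.
- move=> V; apply/rowP => c; rewrite -ip_bracket.
  have [[_ alt _] _ _ _] := H; rewrite alt mxE.
  have := (ipl.1 (f c)) (-1) 0 0.
  by rewrite scaleN1r oppr0 addr0 /GRing.scale /= mulN1r addNr.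
- move=> Z V; have := J2 _ _ (lie_center_vecZ Z) (center_orth_vecV V).
  rewrite JE JE => E; apply/rowP => j; rewrite -[LHS]ip_vecV E.
  have -> : - ip (vecZ Z) (vecZ Z) *: vecV V = vecV (- dot Z Z *: V).
    rewrite /vecV scaler_sumr; apply: eq_bigr => i _; rewrite mxE scalerA.
    congr (- _ * _ *: _); rewrite ip_suml /dot; apply: eq_bigr => c _; congr (_ * _).
    have [_ on _] := Hf; rewrite ip_sumr (bigD1 c) //= on eqxx mulr1 big1 ?addr0 //.
    by move=> c' cc'; rewrite on eq_sym (negbTE cc') mulr0.
  by rewrite ip_vecV.
Qed.

End HTypeCoordinates.

(** * The crown as a tube *)

Section ConnectedPaths.
Variable R : realType.

Lemma path_connected_component (T : topologicalType) (A : set T) (g : R -> T) :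
  continuous g -> (forall s : R, 0 <= s <= 1 -> A (g s)) ->
  connected_component A (g 0) (g 1).
Proof.
move=> cg Ag.
have cI : connected (`[0, 1]%classic : set R).
  by apply/connected_intervalP; exact: interval_is_interval.
have cB : connected (g @` (`[0, 1]%classic : set R)).
  by apply: connected_continuous_connected => //; exact: continuous_subspaceT.
apply: (connected_component_max _ _ cB).
- by exists 0 => //=; rewrite in_itv /= lexx ler01.
- by move=> _ [s /= + <-]; rewrite in_itv /=; exact: Ag.
- by exists 1 => //=; rewrite in_itv /= lexx ler01.
Qed.

End ConnectedPaths.

Lemma continuous_pair (T U V : topologicalType) (f : T -> U) (g : T -> V) (t : T) :
  {for t, continuous f} -> {for t, continuous g} ->
  {for t, continuous (fun x => (f x, g x))}.
Proof. by move=> cf cg; apply: cvg_pair. Qed.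

Section RealImaginaryParts.
Variable R : realType.

Definition ReV d (x : 'rV[R[i]]_d) : 'rV[R]_d := map_mx (@complex.Re R) x.
Definition ImV d (x : 'rV[R[i]]_d) : 'rV[R]_d := map_mx (@complex.Im R) x.

Lemma rowC_ext d (x y : 'rV[R[i]]_d) : ReV x = ReV y -> ImV x = ImV y -> x = y.
Proof.
move=> /rowP hr /rowP hi; apply/rowP => i; apply: complex_ext.
  by have := hr i; rewrite !mxE.
by have := hi i; rewrite !mxE.
Qed.

Lemma ReVD d (x y : 'rV[R[i]]_d) : ReV (x + y) = ReV x + ReV y.
Proof. by apply/rowP => i; rewrite !mxE ReD. Qed.
Lemma ImVD d (x y : 'rV[R[i]]_d) : ImV (x + y) = ImV x + ImV y.
Proof. by apply/rowP => i; rewrite !mxE ImD. Qed.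
Lemma ReVZ d (a : R[i]) (x : 'rV[R[i]]_d) :
  ReV (a *: x) = complex.Re a *: ReV x - complex.Im a *: ImV x.
Proof. by apply/rowP => i; rewrite !mxE ReM. Qed.
Lemma ImVZ d (a : R[i]) (x : 'rV[R[i]]_d) :
  ImV (a *: x) = complex.Re a *: ImV x + complex.Im a *: ReV x.
Proof. by apply/rowP => i; rewrite !mxE ImM. Qed.
Lemma ReV_cvec d (x : 'rV[R]_d) : ReV (cvec x) = x.
Proof. by apply/rowP => i; rewrite !mxE. Qed.
Lemma ImV_cvec d (x : 'rV[R]_d) : ImV (cvec x) = 0.
Proof. by apply/rowP => i; rewrite !mxE. Qed.
Lemma Re_sum (I : finType) (F : I -> R[i]) :
  complex.Re (\sum_i F i) = \sum_i complex.Re (F i).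
Proof. by apply: (big_morph _ (@ReD R)). Qed.
Lemma Im_sum (I : finType) (F : I -> R[i]) :
  complex.Im (\sum_i F i) = \sum_i complex.Im (F i).
Proof. by apply: (big_morph _ (@ImD R)). Qed.

Variables (m k : nat) (b : 'I_m -> 'I_m -> 'I_k -> R).
Let bC i j c : R[i] := (b i j c)%:C%C.

Lemma ReV_bracket (x : 'rV[R]_m) (w : 'rV[R[i]]_m) :
  ReV (bracket bC (cvec x) w) = bracket b x (ReV w).
Proof.
apply/rowP => c; rewrite !mxE Re_sum; apply: eq_bigr => i _.
by rewrite Re_sum; apply: eq_bigr => j _; rewrite !mxE !(ReM, ImM) /=; ring.
Qed.

Lemma ImV_bracket (x : 'rV[R]_m) (w : 'rV[R[i]]_m) :
  ImV (bracket bC (cvec x) w) = bracket b x (ImV w).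
Proof.
apply/rowP => c; rewrite !mxE Im_sum; apply: eq_bigr => i _.
by rewrite Im_sum; apply: eq_bigr => j _; rewrite !mxE !(ReM, ImM) /=; ring.
Qed.

Lemma bracketC0l (w : 'rV[R[i]]_m) : bracket bC 0 w = 0.
Proof.
apply/rowP => c; rewrite !mxE big1 // => i _; rewrite big1 // => j _.
by rewrite mxE mulr0 mul0r.
Qed.

Lemma bracketC0r (w : 'rV[R[i]]_m) : bracket bC w 0 = 0.
Proof.
apply/rowP => c; rewrite !mxE big1 // => i _; rewrite big1 // => j _.
by rewrite mxE mulr0.
Qed.

End RealImaginaryParts.

Section Tube.
Variables (R : realType) (m k : nat) (b : 'I_m -> 'I_m -> 'I_k -> R).
Implicit Types (p q : csolv R m k) (x : solv R m k).

Lemma cexp_realE (t : R) : cexp (t%:C)%C = (expR t)%:C%C.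
Proof. by apply: complex_ext; rewrite /= ?cos0 ?sin0 ?mulr1 ?mulr0. Qed.

Lemma S_to_SCE x : S_to_SC b x = ((cvec x.1.1, cvec x.1.2), (expR (x.2 / 2))%:C%C).
Proof.
rewrite /S_to_SC /cmul /nmul /dilation /cexpN /cexpA /= !scaler0 !addr0 bracketC0r.
rewrite scaler0 addr0 mul1r -cexp_realE; congr (_, cexp _).
by rewrite rmorphM fmorphV rmorph_nat.
Qed.

Lemma S_to_SC_action x q : let a := expR (x.2 / 2) in
  let p := cmul b (S_to_SC b x) q in
  [/\ ReV p.1.1 = x.1.1 + a *: ReV q.1.1, ImV p.1.1 = a *: ImV q.1.1,
      ReV p.1.2 = x.1.2 + a ^+ 2 *: ReV q.1.2 + 2^-1 *: bracket b x.1.1 (a *: ReV q.1.1),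
      ImV p.1.2 = a ^+ 2 *: ImV q.1.2 + 2^-1 *: bracket b x.1.1 (a *: ImV q.1.1)
    & p.2 = (a%:C)%C * q.2].
Proof.
move=> a p; rewrite /p S_to_SCE /cmul /nmul /dilation /= -/a.
have a2 : ((a%:C)%C ^+ 2 : R[i]) = (a ^+ 2)%:C%C by rewrite rmorphXn.
have i2 : (2^-1 : R[i]) = (2^-1 : R)%:C%C by rewrite fmorphV rmorph_nat.
rewrite a2 i2 !(ReVD, ImVD) !(ReVZ, ImVZ) ReV_bracket ImV_bracket !(ReVZ, ImVZ).
rewrite !ReV_cvec !ImV_cvec /= !scale0r !subr0 !addr0 add0r; split=> //.
by rewrite add0r.
Qed.

(** The imaginary part of the central component once a real translation has made the
    [v]-component purely imaginary. *)
Definition vertical p : 'rV[R]_k :=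
  ImV p.1.2 - 2^-1 *: bracket b (ReV p.1.1) (ImV p.1.1).

(** The infimum over real [v0] of [Re h - |Im Z|] at the translates of [p] by [v0]
    (with [h] the Siegel height), hence a relative invariant of the real group. *)
Definition gap p : R :=
  complex.Re (p.2 ^+ 2) - 2^-1 * dot (ImV p.1.1) (ImV p.1.1) - enorm (vertical p).

Definition tube : set (csolv R m k) := [set p | 0 < complex.Re p.2 /\ 0 < gap p].

Lemma vertical_action x q :
  vertical (cmul b (S_to_SC b x) q) = expR (x.2 / 2) ^+ 2 *: vertical q.
Proof.
have [E1 E2 _ E4 _] := S_to_SC_action x q.
rewrite /vertical E1 E2 E4 !bracketE; apply/rowP => c; rewrite !mxE; ring.
Qed.

Lemma gap_action x q : gap (cmul b (S_to_SC b x) q) = expR (x.2 / 2) ^+ 2 * gap q.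
Proof.
have [E1 E2 _ E4 E5] := S_to_SC_action x q.
rewrite /gap vertical_action E2 E5 enormZ ger0_norm ?exprn_ge0 ?expR_ge0 //.
by rewrite !dotE !expr2 !(ReM, ImM) /=; ring.
Qed.

Lemma tube_action x q : tube q -> tube (cmul b (S_to_SC b x) q).
Proof.
move=> [q1 q2]; have [_ _ _ _ E5] := S_to_SC_action x q; split.
  by rewrite E5 ReM /= mul0r subr0 mulr_gt0 // expR_gt0.
by rewrite gap_action mulr_gt0 // exprn_gt0 // expR_gt0.
Qed.

Lemma gap_S_to_SC x : gap (S_to_SC b x) = expR (x.2 / 2) ^+ 2.
Proof.
rewrite /gap /vertical S_to_SCE /= !ImV_cvec bracket0r scaler0 subr0 dot0l enorm0.
by rewrite !expr2 /=; ring.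
Qed.

Lemma tube_S_to_SC x : tube (S_to_SC b x).
Proof.
split; first by rewrite S_to_SCE /= expR_gt0.
by rewrite gap_S_to_SC exprn_gt0 // expR_gt0.
Qed.

Definition calD_ineq (X : solv R m k) : Prop :=
  cos X.2 * (1 - 2^-1 * enorm X.1.1 ^+ 2 - enorm X.1.2)
    > 4^-1 * (1 - cos X.2) * enorm X.1.1 ^+ 2.

(** On the connected set [calD] the last coordinate cannot cross [pi / 2] or
    [- pi / 2], where the cosine vanishes and the inequality fails. *)
Lemma calD_bound (X : solv R m k) : calD X -> `|X.2| < pi / 2 /\ calD_ineq X.
Proof.
move=> DX; split; last exact: connected_component_sub DX.
have cD : connected (@calD R m k) by exact: component_connected.
have c2 : connected ((fun X : solv R m k => X.2 : R) @` (@calD R m k)).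
  apply: connected_continuous_connected => //; apply: continuous_subspaceT.
  by move=> x; exact: cvg_snd.
have D0 : (@calD R m k) 0.
  apply: connected_component_refl; rewrite /= cos0 enorm0 enorm0 expr0n /= !mulr0.
  by rewrite !subr0 mulr1 ltr01.
have I2 : is_interval ((fun X : solv R m k => X.2 : R) @` (@calD R m k)).
  exact/connected_intervalP.
have nD (t : R) : cos t = 0 -> ~ ((fun X : solv R m k => X.2 : R) @` (@calD R m k)) t.
  move=> ct [Y /connected_component_sub + Yt] => /=.
  by rewrite Yt ct; have := sqr_ge0 (enorm Y.1.1); lra.
have pi0 : 0 < pi / 2 :> R by rewrite divr_gt0 // pi_gt0.
have ME : ((fun X : solv R m k => X.2 : R) @` (@calD R m k)) X.2 by exists X.
have M0 : ((fun X : solv R m k => X.2 : R) @` (@calD R m k)) 0 by exists 0.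
rewrite ltr_norml; apply/andP; split; rewrite ltNge; apply/negP => h.
  apply: (nD (- (pi / 2))); first by rewrite cosN cos_pihalf.
  by apply: (I2 _ _ ME M0); rewrite h oppr_le0 ltW.
apply: (nD (pi / 2)); first by rewrite cos_pihalf.
by apply: (I2 _ _ M0 ME); rewrite h ltW.
Qed.

(** First shrink [V] and [Z] to zero with [t] fixed, then [t]. *)
Lemma calD_intro (V : 'rV[R]_m) (Z : 'rV[R]_k) (t : R) : `|t| < pi / 2 ->
  calD_ineq ((V, Z), t) -> calD (((V, Z), t) : solv R m k).
Proof.
move=> tb; have ct (s : R) : 0 <= s <= 1 -> 0 < cos (s * t).
  move=> /andP[s0 s1]; apply: cos_gt0_pihalf; rewrite -ltr_norml normrM ger0_norm //.
  by apply: le_lt_trans tb; rewrite ler_piMl.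
have := ct 1; rewrite ler01 lexx mul1r => /(_ isT) ct1.
rewrite /calD_ineq /= => hX.
pose X0 : solv R m k := ((0, 0), t).
pose A : set (solv R m k) := calD_ineq.
suff : connected_component A 0 ((V, Z), t) by [].
have AP (V' : 'rV[R]_m) (Z' : 'rV[R]_k) (t' : R) :
   A ((V', Z'), t') = calD_ineq ((V', Z'), t') :> Prop by [].
have s1 : connected_component A 0 X0.
  have := @path_connected_component R _ A (fun s => ((0, 0), s * t) : solv R m k).
  rewrite mul0r mul1r; apply.
    move=> s; apply: (@continuous_pair R ('rV[R]_m * 'rV[R]_k)%type R^o
      (fun=> (0, 0)) (fun s : R => s * t) s).
      exact: cvg_cst.
    by apply: cvgM; [exact: cvg_id | exact: cvg_cst].
  move=> s s01; rewrite AP /calD_ineq /= !enorm0 expr0n /= !mulr0 !subr0 mulr1.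
  exact: ct.
apply: connected_component_trans s1 _.
have := @path_connected_component R _ A (fun s => ((s *: V, s *: Z), t) : solv R m k).
rewrite !scale0r !scale1r; apply.
  move=> s; apply: (@continuous_pair R ('rV[R]_m * 'rV[R]_k)%type R^o
    (fun s : R => (s *: V, s *: Z)) (fun=> t) s).
    by apply: continuous_pair; exact: scalel_continuous.
  exact: cvg_cst.
move=> s /andP[s0 s1']; rewrite AP /calD_ineq /= !enormZ ger0_norm // exprMn.
have h1 : s ^+ 2 * enorm V ^+ 2 <= enorm V ^+ 2.
  by rewrite ler_piMl ?sqr_ge0 // expr_le1.
have h2 : s * enorm Z <= enorm Z by rewrite ler_piMl ?enorm_ge0.
have h3 := ler_wpM2l (ltW ct1) h1; have h4 := ler_wpM2l (ltW ct1) h2.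
move: hX h1 h3 h4; set c := cos t; set u := enorm V ^+ 2; lra.
Qed.

Lemma domD_parts (X : solv R m k) (u := cexp (ci * (X.2)%:C%C / 2) : R[i]) :
  cmul b (cexpA m k (ci * (X.2)%:C%C)) (cexpN (ci *: cvec X.1.1) (ci *: cvec X.1.2))
  = ((u *: (ci *: cvec X.1.1), u ^+ 2 *: (ci *: cvec X.1.2)), u).
Proof.
rewrite /cmul /nmul /dilation /cexpA /cexpN /= !add0r bracketC0l scaler0 addr0.
by rewrite mulr1.
Qed.

Lemma half_rotation (t : R) : cexp (ci * (t%:C)%C / 2) = Complex (cos (t / 2)) (sin (t / 2)).
Proof.
have -> : ci * (t%:C)%C / 2 = Complex 0 (t / 2).
  have i2 : (2^-1 : R[i]) = (2^-1 : R)%:C%C by rewrite fmorphV rmorph_nat.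
  by rewrite i2; apply: complex_ext; rewrite !(ReM, ImM) /=; ring.
by apply: complex_ext; rewrite /= expR0 mul1r.
Qed.

Lemma cos_half_sqr (t : R) : cos (t / 2) ^+ 2 = (1 + cos t) / 2.
Proof.
have := cos_mulr2n (t / 2); rewrite [t / 2 *+ 2]mulr2n -splitr => ->.
by rewrite mulr2n; field.
Qed.

Lemma sin_half_mul (t : R) : 2 * (sin (t / 2) * cos (t / 2)) = sin t.
Proof.
have := sin_mulr2n (t / 2); rewrite [t / 2 *+ 2]mulr2n -splitr => ->.
by rewrite mulr2n; ring.
Qed.

Lemma domD_coordinates (V : 'rV[R]_m) (Z : 'rV[R]_k) (t : R)
   (u := Complex (cos (t / 2)) (sin (t / 2)) : R[i])
   (p := ((u *: (ci *: cvec V), u ^+ 2 *: (ci *: cvec Z)), u) : csolv R m k) :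
  [/\ ReV p.1.1 = - sin (t / 2) *: V, ImV p.1.1 = cos (t / 2) *: V,
      ReV p.1.2 = - sin t *: Z, ImV p.1.2 = cos t *: Z
    & complex.Re (p.2 ^+ 2) = cos t].
Proof.
have u2 : u ^+ 2 = Complex (cos t) (sin t).
  have c2 := cos_half_sqr t; have s2 := sin2cos2 (t / 2).
  rewrite /u expr2; apply: complex_ext; rewrite !(ReM, ImM) /=.
    by move: c2 s2; rewrite !expr2; lra.
  by rewrite -(sin_half_mul t); ring.
rewrite /p; split; last by rewrite [_.2]/= u2.
- by apply/rowP => c; rewrite !mxE !(ReM, ImM) /=; ring.
- by apply/rowP => c; rewrite !mxE !(ReM, ImM) /=; ring.
- by rewrite [_.1]/= [_.2]/= u2; apply/rowP => c; rewrite !mxE !(ReM, ImM) /=; ring.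
- by rewrite [_.1]/= [_.2]/= u2; apply/rowP => c; rewrite !mxE !(ReM, ImM) /=; ring.
Qed.

Hypothesis Hb : htype_constants b.

Lemma calD_gap (V : 'rV[R]_m) (Z : 'rV[R]_k) (t : R)
   (u := Complex (cos (t / 2)) (sin (t / 2)) : R[i])
   (p := ((u *: (ci *: cvec V), u ^+ 2 *: (ci *: cvec Z)), u) : csolv R m k) :
  0 <= cos t -> gap p = cos t * (1 - 2^-1 * enorm V ^+ 2 - enorm Z)
    - 4^-1 * (1 - cos t) * enorm V ^+ 2.
Proof.
move=> ct; have [E1 E2 E3 E4 E5] := domD_coordinates V Z t; have [_ alt _] := Hb.
have vE : vertical p = cos t *: Z.
  by rewrite /vertical E1 E2 E4 !bracketE alt !scaler0 subr0.
rewrite /gap vE E2 E5 enormZ ger0_norm // !dotE !enorm_sqr.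
have := cos_half_sqr t; rewrite expr2 mulrA => ->; by field.
Qed.

Lemma crown_sub_tube : crown b `<=` tube.
Proof.
move=> p [x [d [[X DX <-] ->]]]; apply: tube_action.
have [tb] := calD_bound DX; rewrite (domD_parts X) half_rotation.
move: DX => _; case: X tb => -[V Z] t; rewrite [_.2]/= [_.1]/= => tb.
rewrite /calD_ineq [_.2]/= [_.1]/= => ineq.
have ct : 0 < cos t by apply: cos_gt0_pihalf; rewrite -ltr_norml.
have pi0 : 0 < pi :> R by exact: pi_gt0.
split; last by rewrite calD_gap ?ltW // subr_gt0.
rewrite /=; apply: cos_gt0_pihalf; rewrite -ltr_norml normrM.
by rewrite (ger0_norm (_ : 0 <= 2^-1)) //; have := normr_ge0 t; lra.
Qed.

(** The argument of [p.2] determines the angle [t] of the element of [domD], its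
    modulus the dilation [A].  Then [V] and [Z] come from the imaginary parts, and
    the real parts determine the translation. *)
Lemma tube_sub_crown : tube `<=` crown b.
Proof.
move=> p [p0 gp]; set tx := complex.Re p.2 in p0; set ty := complex.Im p.2.
have tau2 : complex.Re (p.2 ^+ 2) = tx ^+ 2 - ty ^+ 2.
  by rewrite expr2 ReM -/tx -/ty !expr2.
have g2 : 0 < tx ^+ 2 - ty ^+ 2.
  move: gp; rewrite /gap tau2; have := dot_ge0 (ImV p.1.1).
  have := enorm_ge0 (vertical p); lra.
have txn : tx != 0 by rewrite gt_eqF.
pose th := atan (ty / tx); pose t := 2 * th.
have t2 : t / 2 = th by rewrite /t; field.
have cth : 0 < cos th.
  by apply: cos_gt0_pihalf; rewrite atan_gtNpi2 atan_ltpi2.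
have sth : sin th = ty / tx * cos th.
  have := atanK (ty / tx); rewrite /tan -/th => e.
  by rewrite -e mulfVK // gt_eqF.
have tb : `|t| < pi / 2.
  have h : `|ty / tx| < 1.
    rewrite normrM normfV (gtr0_norm p0) ltr_pdivrMr // mul1r.
    rewrite -ltr_sqr ?nnegrE ?normr_ge0 ?ltW // real_normK ?num_real //; lra.
  move: h; rewrite ltr_norml => /andP[/lt_atan h1 /lt_atan h2].
  by move: h1 h2; rewrite atanN atan1 -/th /t ltr_norml => h1 h2; apply/andP; split; lra.
have ct : 0 < cos t by apply: cos_gt0_pihalf; rewrite -ltr_norml.
pose A := tx / cos th.
have A0 : 0 < A by rewrite divr_gt0.
have Ac : A * cos th = tx by rewrite /A mulfVK // gt_eqF.
have As : A * sin th = ty by rewrite sth mulrCA Ac mulfVK.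
have A2 : A ^+ 2 * cos t = tx ^+ 2 - ty ^+ 2.
  have := cos_half_sqr t; have := sin2cos2 th; rewrite t2 -Ac -As !exprMn => -> ->.
  by field; rewrite gt_eqF.
have An : A != 0 by rewrite gt_eqF.
have ctn : cos t != 0 by rewrite gt_eqF.
pose x := ReV p.1.1; pose y := ImV p.1.1; pose eta := vertical p.
have [V VE] : exists V, tx *: V = y.
  by exists (tx^-1 *: y); rewrite scalerA divff // scale1r.
have [Z ZE] : exists Z, (A ^+ 2 * cos t) *: Z = eta.
  exists ((A ^+ 2 * cos t)^-1 *: eta).
  by rewrite scalerA mulfV ?scale1r // mulf_neq0 // expf_neq0.
pose v0 := x + (ty / tx) *: y.
pose z0 := ReV p.1.2 + (A ^+ 2 * sin t) *: Z + (2^-1 * ty) *: bracket b v0 V.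
pose X : solv R m k := ((V, Z), t); pose s : solv R m k := ((v0, z0), 2 * ln A).
pose u := Complex (cos (t / 2)) (sin (t / 2)) : R[i].
pose d := ((u *: (ci *: cvec V), u ^+ 2 *: (ci *: cvec Z)), u) : csolv R m k.
have expA : expR (s.2 / 2) = A.
  by rewrite /s /= (_ : 2 * ln A / 2 = ln A) ?lnK //; field.
have [_ alt _] := Hb.
have pE : p = cmul b (S_to_SC b s) d.
  have [F1 F2 F3 F4 F5] := S_to_SC_action s d.
  have [E1 E2 E3 E4 _] := domD_coordinates V Z t.
  rewrite -/u -/d in E1 E2 E3 E4.
  rewrite [LHS]surjective_pairing [p.1]surjective_pairing.
  rewrite [RHS]surjective_pairing [(cmul b _ d).1]surjective_pairing.
  congr (_, _, _).
  - apply: rowC_ext; rewrite ?F1 ?F2 expA ?E1 ?E2 t2 scalerA ?mulrN ?As ?Ac ?VE //.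
    rewrite /= -/x /v0 -VE scalerA mulfVK //.
    by apply/rowP => c; rewrite !mxE; ring.
  - apply: rowC_ext; rewrite ?F3 ?F4 expA ?E1 ?E2 ?E3 ?E4 t2 !scalerA ?mulrN ?As ?Ac.
      by rewrite /= /z0 !bracketE; apply/rowP => c; rewrite !mxE; ring.
    by rewrite ZE VE /= /v0 !bracketE alt scaler0 addr0 /eta /vertical -/x -/y subrK.
  - rewrite F5 expA /d /u; apply: complex_ext; rewrite !(ReM, ImM) /= t2.
      by rewrite mul0r subr0 Ac.
    by rewrite mul0r addr0 As.
exists s, d; split=> //; exists X; last by rewrite (domD_parts X) half_rotation.
apply: calD_intro => //.
rewrite /calD_ineq -subr_gt0 -calD_gap ?ltW // -/u -/d.
by move: gp; rewrite pE gap_action pmulr_rgt0 // exprn_gt0 // expR_gt0.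
Qed.

Lemma crown_tube : crown b = tube.
Proof. by rewrite eqEsubset; split; [exact: crown_sub_tube | exact: tube_sub_crown]. Qed.

End Tube.

(** * The explicit extension is holomorphic on the tube *)

Section RealContinuity.
Variables (R : realType) (T : topologicalType).
Implicit Types f g : T -> R.

Lemma contD f g t : {for t, continuous f} -> {for t, continuous g} ->
  {for t, continuous (fun x => f x + g x)}.
Proof. by move=> ? ?; apply: cvgD. Qed.

Lemma contN f t : {for t, continuous f} -> {for t, continuous (fun x => - f x)}.
Proof. by move=> ?; apply: cvgN. Qed.

Lemma contM f g t : {for t, continuous f} -> {for t, continuous g} ->
  {for t, continuous (fun x => f x * g x)}.
Proof. by move=> ? ?; apply: cvgM. Qed.

Lemma contC (a : R) t : {for t, continuous (fun _ : T => a)}.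
Proof. exact: cvg_cst. Qed.

Lemma cont_sum n (F : 'I_n -> T -> R) t : (forall i, {for t, continuous (F i)}) ->
  {for t, continuous (fun x => \sum_i F i x)}.
Proof.
elim: n F => [|n IH] F cF.
  by rewrite (_ : (fun x => _) = fun=> 0);
    [exact: contC | apply/funext => x; rewrite big_ord0].
rewrite (_ : (fun x => _) = fun x => F ord0 x + \sum_i F (lift ord0 i) x).
  by apply: contD; [exact: cF | apply: IH => i; exact: cF].
by apply/funext => x; rewrite big_ord_recl.
Qed.

Lemma cont_comp (U : topologicalType) (f : T -> U) (h : U -> R) t :
  {for t, continuous f} -> continuous h -> {for t, continuous (fun x => h (f x))}.
Proof. by move=> cf ch; apply: (continuous_comp cf); exact: ch. Qed.

End RealContinuity.

Section TubeTopology.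
Variables (R : realType) (m k : nat) (b : 'I_m -> 'I_m -> 'I_k -> R).
Local Notation C := ((R[i])^o).
Local Notation SCn := (csolv_normed R m k).

Lemma differentiable_fst (U V : normedModType R[i]) (p : U * V) :
  differentiable (fst : U * V -> U) p.
Proof. by apply: linear_differentiable => x; exact: cvg_fst. Qed.

Lemma differentiable_snd (U V : normedModType R[i]) (p : U * V) :
  differentiable (snd : U * V -> V) p.
Proof. by apply: linear_differentiable => x; exact: cvg_snd. Qed.

Lemma cdiff_v i (p : SCn) : differentiable (fun p : SCn => p.1.1 0 i : C) p.
Proof.
have d1 : differentiable (fun p : SCn => p.1.1) p.
  apply: (@differentiable_comp R[i] SCn _ _ (fun p : SCn => p.1) fst).
    exact: differentiable_fst.
  exact: differentiable_fst.
exact: (differentiable_comp d1 (differentiable_coord _ _ _)).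
Qed.

Lemma cdiff_z i (p : SCn) : differentiable (fun p : SCn => p.1.2 0 i : C) p.
Proof.
have d1 : differentiable (fun p : SCn => p.1.2) p.
  apply: (@differentiable_comp R[i] SCn _ _ (fun p : SCn => p.1) snd).
    exact: differentiable_fst.
  exact: differentiable_snd.
exact: (differentiable_comp d1 (differentiable_coord _ _ _)).
Qed.

Lemma cdiff_t (p : SCn) : differentiable (fun p : SCn => p.2 : C) p.
Proof. exact: differentiable_snd. Qed.

Lemma cdiff_t2 (p : SCn) : differentiable (fun p : SCn => p.2 ^+ 2 : C) p.
Proof. exact: (cdiffM (cdiff_t p) (cdiff_t p)). Qed.

Lemma cont_Re (f : SCn -> C) p : differentiable f p ->
  {for p, continuous (fun p => complex.Re (f p))}.
Proof.
move=> /differentiable_continuous cf.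
exact: (cont_comp cf (@continuous_Re R)).
Qed.

Lemma cont_Im (f : SCn -> C) p : differentiable f p ->
  {for p, continuous (fun p => complex.Im (f p))}.
Proof.
move=> /differentiable_continuous cf.
exact: (cont_comp cf (@continuous_Im R)).
Qed.

Lemma continuous_gap : continuous (gap b : SCn -> R).
Proof.
move=> p; apply: (@contD R SCn (fun p : SCn => complex.Re (p.2 ^+ 2)
    - 2^-1 * dot (ImV p.1.1) (ImV p.1.1)) (fun p => - enorm (vertical b p))).
  apply: (@contD R SCn (fun p : SCn => complex.Re (p.2 ^+ 2))
    (fun p : SCn => - (2^-1 * dot (ImV p.1.1) (ImV p.1.1)))).
  - by apply: (@cont_Re (fun p : SCn => p.2 ^+ 2)); exact: cdiff_t2.
  - apply: contN; apply: contM; first exact: contC.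
    apply: cont_sum => i.
    rewrite (_ : (fun x => _) = fun x : SCn =>
      complex.Im (x.1.1 0 i) * complex.Im (x.1.1 0 i)); last first.
      by apply/funext => x; rewrite !mxE.
    by apply: contM; apply: cont_Im; exact: cdiff_v.
apply: contN; apply: (@cont_comp R SCn R (fun p : SCn => dot (vertical b p) (vertical b p))
    (@Num.sqrt R)); last exact: sqrt_continuous.
  apply: cont_sum => c.
  have cv : {for p, continuous (fun x : SCn => vertical b x 0 c)}.
    rewrite (_ : (fun x => _) = fun x : SCn => complex.Im (x.1.2 0 c) - 2^-1 *
      \sum_i \sum_j b i j c * complex.Re (x.1.1 0 i) * complex.Im (x.1.1 0 j)).
      apply: contD; first by apply: cont_Im; exact: cdiff_z.
      apply: contN; apply: contM; first exact: contC.
      apply: cont_sum => i; apply: cont_sum => j; apply: contM.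
        by apply: contM; [exact: contC | apply: cont_Re; exact: cdiff_v].
      by apply: cont_Im; exact: cdiff_v.
    apply/funext => x; rewrite !mxE; congr (_ - _ * _).
    by apply: eq_bigr => i _; apply: eq_bigr => j _; rewrite !mxE.
  exact: contM.
Qed.

Lemma continuous_Re_t : continuous (fun p : SCn => complex.Re p.2).
Proof. by move=> p; apply: cont_Re; exact: cdiff_t. Qed.

Lemma open_tube : open (tube b : set SCn).
Proof.
have -> : (tube b : set SCn) = (fun p : SCn => complex.Re p.2) @^-1` [set x | 0 < x]
    `&` (gap b : SCn -> R) @^-1` [set x | 0 < x] by [].
apply: openI; apply: open_comp; rewrite ?open_gt //.
  by move=> x _; exact: continuous_Re_t.
by move=> x _; exact: continuous_gap.
Qed.

Lemma continuous_realC : continuous (fun s : R => (s%:C)%C : C).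
Proof. by move=> s; apply: continuous_complex; [exact: cvg_id | exact: cvg_cst]. Qed.

Lemma tube_sub_SC : tube b `<=` @SC R m k.
Proof.
by move=> p [p0 _]; apply/negP => /eqP e; move: p0; rewrite e /= ltxx.
Qed.

Hypothesis Hb : htype_constants b.

Definition tube_base : csolv R m k := ((0, 0), 1).

(** The tube is contracted to the point [tube_base] along the dilations, the last
    coordinate moving on a straight line. *)
Lemma tube_component p : tube b p -> connected_component (tube b : set SCn) tube_base p.
Proof.
case: p => -[v z] tau [t0 g0].
pose g (s : R) : SCn := (((s%:C)%C *: v, (s ^+ 2)%:C%C *: z), (1 - s)%:C%C + (s%:C)%C * tau).
have cs : continuous (fun s : R => s ^+ 2).
  by move=> s; apply: contM; exact: cvg_id.
have cg : continuous g.
  move=> s; apply: continuous_pair; first apply: continuous_pair.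
  - apply: (@continuous_comp R C _ (fun s => (s%:C)%C : C) (fun a : C => a *: v) s).
      exact: continuous_realC.
    exact: scalel_continuous.
  - apply: (@continuous_comp R C _ (fun s => (s ^+ 2)%:C%C : C) (fun a : C => a *: z) s).
      by apply: (continuous_comp (cs s)); exact: continuous_realC.
    exact: scalel_continuous.
  - apply: (@cvgD _ _ _ (nbhs s)).
      apply: (@continuous_comp R R C (fun s => 1 - s) (fun s => (s%:C)%C : C) s).
        by apply: contD; [exact: contC | apply: contN; exact: cvg_id].
      exact: continuous_realC.
    by apply: (@cvgM _ _ (nbhs s)); [exact: continuous_realC | exact: cvg_cst].
have := @path_connected_component R SCn (tube b) g cg.
have -> : g 0 = tube_base.
  by rewrite /g expr0n /= subr0 !scale0r mul0r addr0.
have -> : g 1 = ((v, z), tau).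
  by rewrite /g expr1n /= subrr !scale1r mul1r add0r.
apply=> s /andP[s0 s1].
have vE : vertical b (g s) = s ^+ 2 *: vertical b ((v, z), tau).
  rewrite /vertical /= !(ReVZ, ImVZ) /= !scale0r !subr0 !addr0 !bracketE.
  by apply/rowP => c; rewrite !mxE; ring.
have gE : gap b (g s) = (1 - s) ^+ 2 + 2 * s * (1 - s) * complex.Re tau
    + s ^+ 2 * gap b ((v, z), tau).
  rewrite /gap vE enormZ ger0_norm ?sqr_ge0 //= !(ReVZ, ImVZ) /= !scale0r !addr0 !dotE.
  by rewrite !expr2 !(ReM, ReD, ImM, ImD) /=; ring.
have s1' : 0 <= 1 - s by lra.
have h1 : 0 <= s * complex.Re tau by rewrite mulr_ge0 // ltW.
have h2 : 0 <= 2 * s * (1 - s) * complex.Re tau.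
  by rewrite mulr_ge0 ?mulr_ge0 // ltW.
have h3 : 0 <= s ^+ 2 * gap b ((v, z), tau) by rewrite mulr_ge0 ?sqr_ge0 // ltW.
have h4 : 0 <= (1 - s) ^+ 2 by rewrite sqr_ge0.
have [e1|s2] := eqVneq s 1.
  split; first by rewrite /= !(ReM, ReD) /= e1 subrr mul1r mul0r subr0 add0r.
  by rewrite gE e1 !subrr expr0n /= mulr0 mul0r expr1n mul1r !add0r.
have s3 : 0 < 1 - s by rewrite subr_gt0 lt_neqAle s2.
have h4' : 0 < (1 - s) ^+ 2 by rewrite exprn_gt0.
split; last by rewrite gE; lra.
by rewrite /= !(ReM, ReD) /=; move: h1 s3; lra.
Qed.

Lemma connected_tube : connected (tube b : set SCn).
Proof.
have -> : (tube b : set SCn) = connected_component (tube b : set SCn) tube_base.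
  rewrite eqEsubset; split; first exact: tube_component.
  exact: connected_component_sub.
exact: component_connected.
Qed.

(** On the real group this is the height [a + |V| ^ 2 / 4] in the Siegel domain
    model, where [a = t ^ 2]. *)
Definition siegel_height (p : csolv R m k) : C := p.2 ^+ 2 + 4^-1 * \sum_i p.1.1 0 i ^+ 2.

Definition poisson_denom (p : csolv R m k) : C := siegel_height p ^+ 2 + \sum_c p.1.2 0 c ^+ 2.

Lemma Re_sum_sqr d (x : 'rV[R[i]]_d) :
  complex.Re (\sum_i x 0 i ^+ 2) = dot (ReV x) (ReV x) - dot (ImV x) (ImV x).
Proof.
rewrite Re_sum /dot -sumrB; apply: eq_bigr => i _.
by rewrite !mxE expr2 ReM.
Qed.

Lemma Im_sum_sqr d (x : 'rV[R[i]]_d) :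
  complex.Im (\sum_i x 0 i ^+ 2) = 2 * dot (ReV x) (ImV x).
Proof.
rewrite Im_sum /dot mulr_sumr; apply: eq_bigr => i _.
by rewrite !mxE expr2 ImM; ring.
Qed.

Lemma Re_siegel_height (p : csolv R m k) : complex.Re (siegel_height p) = complex.Re (p.2 ^+ 2)
  + 4^-1 * (dot (ReV p.1.1) (ReV p.1.1) - dot (ImV p.1.1) (ImV p.1.1)).
Proof.
have i4 : (4^-1 : R[i]) = (4^-1 : R)%:C%C by rewrite fmorphV rmorph_nat.
by rewrite /siegel_height ReD i4 [complex.Re (_%:C%C * _)]ReM Re_sum_sqr /= mul0r subr0.
Qed.

Lemma Re_poisson_denom (p : csolv R m k) : complex.Re (poisson_denom p) =
  complex.Re (siegel_height p) ^+ 2 - complex.Im (siegel_height p) ^+ 2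
  + dot (ReV p.1.2) (ReV p.1.2) - dot (ImV p.1.2) (ImV p.1.2).
Proof. by rewrite /poisson_denom ReD Re_sum_sqr expr2 ReM; ring. Qed.

Lemma Im_poisson_denom (p : csolv R m k) : complex.Im (poisson_denom p) =
  2 * (complex.Re (siegel_height p) * complex.Im (siegel_height p) + dot (ReV p.1.2) (ImV p.1.2)).
Proof. by rewrite /poisson_denom ImD Im_sum_sqr expr2 ImM; ring. Qed.

(** With [x] and [y] the real and imaginary parts of the [v]-component,
    [Re h - |Im Z|] is at least
    [gap p + (|x| - |y|) ^ 2 / 4]. *)
Lemma tube_cone p : tube b p -> enorm (ImV p.1.2) < complex.Re (siegel_height p).
Proof.
move=> [_ g0]; rewrite Re_siegel_height.
have -> : ImV p.1.2 = vertical b p + 2^-1 *: bracket b (ReV p.1.1) (ImV p.1.1).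
  by rewrite /vertical subrK.
have := enormD (vertical b p) (2^-1 *: bracket b (ReV p.1.1) (ImV p.1.1)).
rewrite enormZ ger0_norm //; have := enorm_bracket Hb (ReV p.1.1) (ImV p.1.1).
move: g0; rewrite /gap -!enorm_sqr.
have := sqr_ge0 (enorm (ReV p.1.1) - enorm (ImV p.1.1)).
by rewrite sqrrB mulr2n; lra.
Qed.

(** Put [h = al + i be] and [Z = P + i Q].  If [poisson_denom p] is real, then
    [al * be = - P.Q]; as [|Q| < al], this forces [|be| <= |P|], and the real part
    [al ^ 2 - |Q| ^ 2 + |P| ^ 2 - be ^ 2] is positive. *)
Lemma slit_poisson_denom p : tube b p -> slit (poisson_denom p).
Proof.
move=> /tube_cone; have := cauchy_schwarz (ReV p.1.2) (ImV p.1.2).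
set al := complex.Re (siegel_height p) => cs cone.
have al0 : 0 < al by apply: le_lt_trans cone; exact: enorm_ge0.
apply: slitP; rewrite Re_poisson_denom Im_poisson_denom -!enorm_sqr -/al => /eqP.
rewrite mulf_eq0 pnatr_eq0 /= addr_eq0 => /eqP pq.
set be := complex.Im (siegel_height p) in pq *.
set P := enorm (ReV p.1.2) in cs *; set Q := enorm (ImV p.1.2) in cs cone *.
have P0 : 0 <= P by exact: enorm_ge0.
have Q0 : 0 <= Q by exact: enorm_ge0.
have be1 : `|be| <= P.
  rewrite -(ler_pM2l al0) -{1}(gtr0_norm al0) -normrM pq normrN.
  by apply: le_trans cs _; rewrite mulrC ler_wpM2r // ltW.
have be2 : be ^+ 2 <= P ^+ 2.
  by rewrite -[leLHS]real_normK ?num_real // ler_sqr.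
have : Q ^+ 2 < al ^+ 2 by rewrite ltr_sqr ?nnegrE // ltW.
lra.
Qed.

Lemma slit_t2 p : tube b p -> slit (p.2 ^+ 2).
Proof.
move=> [_ g0]; apply: slitP => _; move: g0; rewrite /gap.
have := dot_ge0 (ImV p.1.1); have := enorm_ge0 (vertical b p); lra.
Qed.

Lemma cdiff_poisson_denom (p : SCn) : differentiable (poisson_denom : SCn -> C) p.
Proof.
have dh : differentiable (siegel_height : SCn -> C) p.
  apply: cdiffD; first exact: cdiff_t2.
  apply: cdiffM; first exact: cdiff_cst.
  by apply: cdiff_sum => i; exact: (cdiffM (cdiff_v i p) (cdiff_v i p)).
apply: cdiffD; first exact: cdiffM.
by apply: cdiff_sum => i; exact: (cdiffM (cdiff_z i p) (cdiff_z i p)).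
Qed.

Definition poisson_ext (l : R[i]) (p : csolv R m k) : R[i] :=
  cexp (l * (clog (p.2 ^+ 2) - clog (poisson_denom p))).

Lemma holomorphic_poisson_ext l : holomorphic_on (tube b) (poisson_ext l).
Proof.
move=> p tp.
apply: (@cdiff_comp R SCn (fun p : SCn => l * (clog (p.2 ^+ 2) - clog (poisson_denom p)))).
  apply: cdiffM; first exact: cdiff_cst.
  apply: cdiffD; last apply: cdiffN.
    apply: (@cdiff_comp R SCn (fun p : SCn => p.2 ^+ 2)); last exact/differentiable_clog/slit_t2.
    exact: cdiff_t2.
  apply: (@cdiff_comp R SCn poisson_denom); last exact/differentiable_clog/slit_poisson_denom.
  exact: cdiff_poisson_denom.
exact: differentiable_cexp.
Qed.

End TubeTopology.

(** * The left-invariant metric *)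

Section DirectionalDerivatives.
Variables (R : realType) (U W : normedModType R).

Lemma is_derive_affine (f : U -> W) (p X : U) (d : W) :
  (forall h : R, f (h *: X + p) - f p = h *: d) -> is_derive p X f d.
Proof.
move=> fE.
have c : (fun h : R => h^-1 *: ((f \o shift p) (h *: X) - f p)) @ 0^' --> d.
  apply: cvg_near_cst; near=> h.
  by rewrite /= fE scalerA mulVf ?scale1r //; near: h; exact: nbhs_dnbhs_neq.
by apply: DeriveDef; [apply: cvgP c | apply: cvg_lim c].
Unshelve. all: by end_near. Qed.

Lemma is_derive_line (f : U -> W) (p X : U) (d : W) :
  is_derive (0 : R) 1 (fun h : R => f (h *: X + p)) d -> is_derive p X f d.
Proof.
have E : (fun h : R => h^-1 *: (((fun h : R => f (h *: X + p)) \o shift 0) (h *: (1 : R))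
    - f (0 *: X + p))) = (fun h : R => h^-1 *: ((f \o shift p) (h *: X) - f p)).
  by apply/funext => h; rewrite /= addr0 scale0r add0r /GRing.scale /= mulr1.
case; rewrite /derivable /derive E => c <-; exact: DeriveDef.
Qed.

Lemma is_derive_scale (f : R -> R) (t df : R) (v : W) : is_derive t 1 f df ->
  is_derive t 1 (fun x => f x *: v) (df *: v).
Proof.
case=> d <-; have dZ : differentiable (fun x => f x *: v) t.
  by apply: differentiableZl; apply/derivable1_diffP.
apply: DeriveDef; first exact/derivable1_diffP.
rewrite deriveE // diffZl; last exact/derivable1_diffP.
by rewrite -deriveE //; apply/derivable1_diffP.
Qed.

End DirectionalDerivatives.

Section Metric.
Variables (R : realType) (m k : nat) (b : 'I_m -> 'I_m -> 'I_k -> R).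
Implicit Types (p q X Y W : solv R m k).

(** The [z]-component of the left translate to the identity of a tangent
    vector, before dilation. *)
Definition zpart p X : 'rV[R]_k := X.1.2 - 2^-1 *: bracket b p.1.1 X.1.1.

(** In this chart left translations are affine, so the difference quotient is
    constant. *)
Lemma derive_left_translation p X : 'D_X (smul b (sinv p)) p =
  ((expR (- p.2 / 2) *: X.1.1, expR (- p.2 / 2) ^+ 2 *: zpart p X), X.2).
Proof.
have H : is_derive p X (smul b (sinv p))
  ((expR (- p.2 / 2) *: X.1.1, expR (- p.2 / 2) ^+ 2 *: zpart p X), X.2).
  apply: is_derive_affine => h; rewrite /smul /nmul /dilation /sinv /zpart /=.
  set c := expR _; congr (_, _, _).
  - by apply/rowP => i; rewrite !mxE; ring.
  - by rewrite !bracketE; apply/rowP => i; rewrite !mxE; ring.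
  - by rewrite /GRing.scale /=; ring.
exact: derive_val.
Qed.

Lemma metricE p X Y : metric b p X Y = expR (- p.2) * dot X.1.1 Y.1.1
  + expR (- p.2) ^+ 2 * dot (zpart p X) (zpart p Y) + X.2 * Y.2.
Proof.
rewrite /metric !derive_left_translation /sip /= !dotE.
have e : expR (- p.2) = expR (- p.2 / 2) * expR (- p.2 / 2).
  by rewrite -expRD; congr expR; field.
by rewrite e; ring.
Qed.

Lemma derive_metric p X Y W : 'D_X (fun q => metric b q Y W : R^o) p =
  - X.2 * expR (- p.2) * dot Y.1.1 W.1.1
  - 2 * X.2 * expR (- p.2) ^+ 2 * dot (zpart p Y) (zpart p W)
  - 2^-1 * expR (- p.2) ^+ 2 * (dot (bracket b X.1.1 Y.1.1) (zpart p W)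
      + dot (zpart p Y) (bracket b X.1.1 W.1.1)).
Proof.
have H : is_derive p X (fun q => metric b q Y W : R^o)
  (- X.2 * expR (- p.2) * dot Y.1.1 W.1.1
  - 2 * X.2 * expR (- p.2) ^+ 2 * dot (zpart p Y) (zpart p W)
  - 2^-1 * expR (- p.2) ^+ 2 * (dot (bracket b X.1.1 Y.1.1) (zpart p W)
      + dot (zpart p Y) (bracket b X.1.1 W.1.1))).
  apply: is_derive_line.
  have zE h (T : solv R m k) : zpart (h *: X + p) T
      = zpart p T - (h * 2^-1) *: bracket b X.1.1 T.1.1.
    by rewrite /zpart /= !bracketE; apply/rowP => i; rewrite !mxE; ring.
  rewrite (_ : (fun h : R => _) = fun h : R =>
    expR (- (h * X.2 + p.2)) * dot Y.1.1 W.1.1 + expR (- (h * X.2 + p.2)) ^+ 2 *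
    (dot (zpart p Y) (zpart p W) - h * (2^-1 * (dot (bracket b X.1.1 Y.1.1) (zpart p W)
      + dot (zpart p Y) (bracket b X.1.1 W.1.1)))
      + h ^+ 2 * (4^-1 * dot (bracket b X.1.1 Y.1.1) (bracket b X.1.1 W.1.1)))
    + Y.2 * W.2); last first.
    by apply/funext => h; rewrite metricE !zE !dotE; congr (_ + _ * _ + _); field.
  have dE : is_derive (0:R) 1 (fun h : R => expR (- (h * X.2 + p.2)))
      (- X.2 * expR (- p.2)).
    have d0 : is_derive (0:R) 1 (fun h : R => - (h * X.2 + p.2)) (- X.2).
      by derive_tac; ring.
    eapply der_eq; first exact: (der_comp (is_derive_expR _) d0).
    by rewrite /= mul0r add0r mulrC.
  by derive_tac; rewrite /= mul0r add0r ?expr1 ?expr0; field.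
exact: derive_val.
Qed.

End Metric.

(** * Geodesics through the identity *)

(** The coefficients of a geodesic with unit initial vector [(V, Z, s)] and speed
    [L], where [q = |Z| ^ 2] and [w = |V| ^ 2].  The functions [geoA], [geoB] and
    [geoG] are the coefficients of [V], [J_Z V] and [Z]; the suffixes [1] and [2]
    mark derivatives in time, [geoR1] and [geoR2] being those of the last
    coordinate.  The first derivatives are computed, whereas [geoA2], [geoB2],
    [geoG2] and [geoR2] are what the geodesic equation prescribes; that they are
    the second derivatives is the content of the verification. *)
Section GeodesicScalars.
Variables (R : realType) (s q w L : R).
Hypotheses (q0 : 0 <= q) (w0 : 0 <= w) (unit_norm : w + q + s ^+ 2 = 1).

(** Here [e] stands for [expR (L * t)], so that [(e - 1) / (e + 1)] is
    [tanh (L * t / 2)]. *)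
Definition geoQ (e : R) := (e + 1 - s * (e - 1)) ^+ 2 + q * (e - 1) ^+ 2.
Definition geoQ' (e : R) := 2 * (e + 1 - s * (e - 1)) * (1 - s) + 2 * q * (e - 1).
Definition geoA (e : R) := 2 * (e - 1) * (e + 1 - s * (e - 1)) * (geoQ e)^-1.
Definition geoB (e : R) := 2 * (e - 1) ^+ 2 * (geoQ e)^-1.
Definition geoG (e : R) := 2 * (e - 1) * (e + 1) * (geoQ e)^-1.
Definition geoA1 (e : R) := L * e * 2 * ((e + 1 - s * (e - 1) + (e - 1) * (1 - s)) * geoQ e
  - (e - 1) * (e + 1 - s * (e - 1)) * geoQ' e) * (geoQ e)^-1 ^+ 2.
Definition geoB1 (e : R) := L * e * 2 * (2 * (e - 1) * geoQ e
  - (e - 1) ^+ 2 * geoQ' e) * (geoQ e)^-1 ^+ 2.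
Definition geoG1 (e : R) := L * e * 2 * (2 * e * geoQ e
  - (e - 1) * (e + 1) * geoQ' e) * (geoQ e)^-1 ^+ 2.
Definition geoR1 (e : R) := L - L * e * geoQ' e * (geoQ e)^-1.
Definition geoK (e : R) := 16 * L * e ^+ 2 * (geoQ e)^-1 ^+ 2.
Definition geoA2 (e : R) := geoR1 e * geoA1 e - 4 * e * L * (geoQ e)^-1 * q * geoB1 e.
Definition geoB2 (e : R) := geoR1 e * geoB1 e + 4 * e * L * (geoQ e)^-1 * geoA1 e.
Definition geoG2 (e : R) := 2^-1 * (geoA e * geoB2 e - geoB e * geoA2 e) * w
  + 2 * geoR1 e * geoK e.
Definition geoR2 (e : R) :=
  - (2^-1 * (geoQ e / (4 * e)) * (geoA1 e ^+ 2 * w + geoB1 e ^+ 2 * q * w)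
     + (geoQ e / (4 * e)) ^+ 2 * geoK e ^+ 2 * q).

Lemma geoQ_gt0 e : 0 < e -> 0 < geoQ e.
Proof.
move=> e0; have s2 : s ^+ 2 <= 1.
  by have := unit_norm; have := q0; have := w0; lra.
have s1 : `|s| <= 1.
  by rewrite -(expr_le1 (_ : (0 < 2)%N)) // real_normK ?num_real.
have c0 : 0 < e + 1 - s * (e - 1).
  rewrite (_ : _ - _ = (1 - s) * e + (1 + s)); last by ring.
  move: s1; rewrite ler_norml => /andP[h1 h2].
  have [s_lt|s_ge] := ltP s 1.
    by rewrite ltr_pwDl ?mulr_gt0 //; lra.
  have -> : s = 1 by lra.
  by rewrite subrr mul0r add0r; lra.
by rewrite /geoQ ltr_pwDl ?exprn_gt0 // mulr_ge0 ?sqr_ge0 ?q0.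
Qed.

(** The momentum of the central translations is conserved along a geodesic: its
    value, relative to [Z], is [geoK] times [expR] of minus twice the last
    coordinate, that is [L]. *)
Lemma geo_momentum e : geoQ e != 0 ->
  geoG1 e - 2^-1 * (geoA e * geoB1 e - geoB e * geoA1 e) * w = geoK e.
Proof.
have -> : w = 1 - q - s ^+ 2 by rewrite -unit_norm; ring.
rewrite /geoG1 /geoA /geoB /geoB1 /geoA1 /geoK /geoQ' /geoQ => Q0.
by field.
Qed.

Section Along.
Variables (E : R -> R) (t : R).
Hypotheses (dE : is_derive t 1 E (L * E t)) (E0 : 0 < E t).

Let Q0 : geoQ (E t) != 0. Proof. by rewrite gt_eqF // geoQ_gt0. Qed.

Let dQ : is_derive t 1 (fun t => geoQ (E t)) (geoQ' (E t) * (L * E t)).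
Proof. by rewrite /geoQ; derive_tac; rewrite /geoQ' /= !expr1; ring. Qed.

Let dQ' : is_derive t 1 (fun t => geoQ' (E t)) (2 * ((1 - s) ^+ 2 + q) * (L * E t)).
Proof. by rewrite /geoQ'; derive_tac => /=; ring. Qed.

Let dV : is_derive t 1 (fun t => (geoQ (E t))^-1)
  (- (geoQ (E t)) ^- 2 * (geoQ' (E t) * (L * E t))).
Proof. exact: derV. Qed.

Let dlnQ : is_derive t 1 (fun t => ln (geoQ (E t))) ((geoQ (E t))^-1 * (geoQ' (E t) * (L * E t))).
Proof. by apply: (der_comp (f := fun t => geoQ (E t))) => //; apply: is_derive1_ln; exact: geoQ_gt0. Qed.

Lemma derive_geoA : is_derive t 1 (fun t => geoA (E t)) (geoA1 (E t)).
Proof.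
rewrite /geoA; derive_tac; rewrite /geoA1 /=; move: (geoQ (E t)) Q0 => X X0.
by field.
Qed.

Lemma derive_geoB : is_derive t 1 (fun t => geoB (E t)) (geoB1 (E t)).
Proof.
rewrite /geoB; derive_tac; rewrite /geoB1 /= ?expr1; move: (geoQ (E t)) Q0 => X X0.
by field.
Qed.

Lemma derive_geoG : is_derive t 1 (fun t => geoG (E t)) (geoG1 (E t)).
Proof.
rewrite /geoG; derive_tac; rewrite /geoG1 /=; move: (geoQ (E t)) Q0 => X X0.
by field.
Qed.

Lemma derive_geoR (c : R) :
  is_derive t 1 (fun t => L * t + c - ln (geoQ (E t))) (geoR1 (E t)).
Proof. by derive_tac; rewrite /geoR1 /=; ring. Qed.

Lemma derive_geoA1 : is_derive t 1 (fun t => geoA1 (E t)) (geoA2 (E t)).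
Proof.
rewrite /geoA1; derive_tac; rewrite /geoA2 /geoR1 /geoA1 /geoB1 /= ?expr1.
have X0 := Q0; move: X0; rewrite /geoQ' /geoQ.
by move: (E t) => e X0; field.
Qed.

Lemma derive_geoB1 : is_derive t 1 (fun t => geoB1 (E t)) (geoB2 (E t)).
Proof.
rewrite /geoB1; derive_tac; rewrite /geoB2 /geoR1 /geoA1 /geoB1 /= ?expr1.
have X0 := Q0; move: X0; rewrite /geoQ' /geoQ.
by move: (E t) => e X0; field.
Qed.

Lemma derive_geoG1 : is_derive t 1 (fun t => geoG1 (E t)) (geoG2 (E t)).
Proof.
rewrite /geoG1; derive_tac; rewrite /geoG2 /geoA2 /geoB2 /geoR1 /geoA1 /geoB1 /geoA /geoB /geoK /= ?expr1.
have wE : w = 1 - q - s ^+ 2 by rewrite -unit_norm; ring.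
have X0 := Q0; move: X0; rewrite wE /geoQ' /geoQ.
by move: (E t) => e X0; field.
Qed.

Lemma derive_geoR1 : is_derive t 1 (fun t => geoR1 (E t)) (geoR2 (E t)).
Proof.
have En0 : E t != 0 by rewrite gt_eqF.
rewrite /geoR1; derive_tac; rewrite /geoR2 /geoA1 /geoB1 /geoK /= ?expr1.
have wE : w = 1 - q - s ^+ 2 by rewrite -unit_norm; ring.
have X0 := Q0; move: X0; rewrite wE /geoQ' /geoQ.
by move: (E t) En0 => e e0 X0; field; rewrite e0 X0.
Qed.

End Along.
End GeodesicScalars.

Section Geodesics.
Variables (R : realType) (m k : nat) (b : 'I_m -> 'I_m -> 'I_k -> R).
Hypothesis Hb : htype_constants b.

Definition dmetric (p X Y W : solv R m k) : R :=
  - X.2 * expR (- p.2) * dot Y.1.1 W.1.1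
  - 2 * X.2 * expR (- p.2) ^+ 2 * dot (zpart b p Y) (zpart b p W)
  - 2^-1 * expR (- p.2) ^+ 2 * (dot (bracket b X.1.1 Y.1.1) (zpart b p W)
      + dot (zpart b p Y) (bracket b X.1.1 W.1.1)).

Lemma christoffelE (p X Y W : solv R m k) : christoffel b p X Y W =
  2^-1 * (dmetric p X Y W + dmetric p Y X W - dmetric p W X Y).
Proof.
have h1 := derive_metric b p X Y W.
have h2 := derive_metric b p Y X W.
have h3 := derive_metric b p W X Y.
rewrite -/(dmetric p X Y W) in h1.
rewrite -/(dmetric p Y X W) in h2.
rewrite -/(dmetric p W X Y) in h3.
by rewrite -h1 -h2 -h3.
Qed.

(** Koszul's formula tested on [W]: the three hypotheses are the components of the
    geodesic equation along the last coordinate, the centre and [v]. *)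
Lemma geodesic_equation (p X Y : solv R m k) :
  Y.2 + (2^-1 * expR (- p.2) * dot X.1.1 X.1.1
    + expR (- p.2) ^+ 2 * dot (zpart b p X) (zpart b p X)) = 0 ->
  zpart b p Y = (2 * X.2) *: zpart b p X ->
  Y.1.1 = X.2 *: X.1.1 + expR (- p.2) *: Jmap b (zpart b p X) X.1.1 ->
  forall W, metric b p Y W + christoffel b p X X W = 0.
Proof.
move=> e1 e2 e3 W; have [_ alt _] := Hb.
rewrite metricE.
rewrite e2.
rewrite e3.
rewrite christoffelE /dmetric.
rewrite alt.
rewrite (bracketC Hb W.1.1).
move: e1; move: (zpart b p X) (zpart b p W) => u y e1.
rewrite !dotE dot_Jmap.
rewrite (dotC (bracket b X.1.1 W.1.1)).
move/eqP: e1; rewrite addr_eq0 => /eqP ->.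
by field.
Qed.

Section Ray.
Variables (V : 'rV[R]_m) (Z : 'rV[R]_k) (s L : R).
Hypothesis unit_norm : dot V V + dot Z Z + s ^+ 2 = 1.

Let q := dot Z Z.
Let w := dot V V.
Let E (t : R) :=  expR (L * t).

Definition ray_at (e r : R) : solv R m k :=
  ((geoA s q e *: V + geoB s q e *: Jmap b Z V, geoG s q e *: Z), r).

Definition ray (t : R) : solv R m k := ray_at (E t) (L * t + ln 4 - ln (geoQ s q (E t))).

Let vec (x y z r : R) : solv R m k := ((x *: V + y *: Jmap b Z V, z *: Z), r).

Let is_derive_vec (x y z r : R -> R) (dx dy dz dr t : R) : is_derive t 1 x dx ->
  is_derive t 1 y dy -> is_derive t 1 z dz -> is_derive t 1 r dr ->
  is_derive t 1 (fun t => vec (x t) (y t) (z t) (r t)) (vec dx dy dz dr).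
Proof.
pose e1 : solv R m k := ((V, 0), 0); pose e2 : solv R m k := ((Jmap b Z V, 0), 0).
pose e3 : solv R m k := ((0, Z), 0); pose e4 : solv R m k := ((0, 0), 1).
have vE (a a' a'' a''' : R) : vec a a' a'' a''' = a *: e1 + a' *: e2 + a'' *: e3 + a''' *: e4.
  congr (_, _, _); rewrite /= ?scaler0 ?addr0 ?add0r //.
  by rewrite /GRing.scale /= mulr1.
move=> hx hy hz hr; rewrite vE.
rewrite (_ : (fun t => _) = fun t => x t *: e1 + y t *: e2 + z t *: e3 + r t *: e4).
  by apply: is_deriveD; [apply: is_deriveD; [apply: is_deriveD|]|];
    exact: is_derive_scale.
by apply/funext => u; rewrite vE.
Qed.

Let dE (t : R) : is_derive t 1 E (L * E t).
Proof.
have dL : is_derive t 1 (fun t => L * t) L by derive_tac; rewrite /=; ring.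
by eapply der_eq; [exact: (der_comp (is_derive_expR _) dL) | rewrite mulrC].
Qed.

Let q0 : 0 <= q. Proof. exact: dot_ge0. Qed.
Let w0 : 0 <= w. Proof. exact: dot_ge0. Qed.
Let E0 (t : R) : 0 < E t. Proof. exact: expR_gt0. Qed.

Let ray1 (t : R) := vec (geoA1 s q L (E t)) (geoB1 s q L (E t)) (geoG1 s q L (E t))
  (geoR1 s q L (E t)).
Let ray2 (t : R) := vec (geoA2 s q L (E t)) (geoB2 s q L (E t)) (geoG2 s q w L (E t))
  (geoR2 s q w L (E t)).

Let dray (t : R) : is_derive t 1 ray (ray1 t).
Proof.
exact: (is_derive_vec (derive_geoA q0 w0 unit_norm (dE t) (E0 t))
  (derive_geoB q0 w0 unit_norm (dE t) (E0 t))
  (derive_geoG q0 w0 unit_norm (dE t) (E0 t))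
  (derive_geoR q0 w0 unit_norm (dE t) (E0 t) (ln 4))).
Qed.

Let dray1 (t : R) : is_derive t 1 ray1 (ray2 t).
Proof.
exact: (is_derive_vec (derive_geoA1 q0 w0 unit_norm (dE t) (E0 t))
  (derive_geoB1 q0 w0 unit_norm (dE t) (E0 t))
  (derive_geoG1 q0 w0 unit_norm (dE t) (E0 t))
  (derive_geoR1 q0 w0 unit_norm (dE t) (E0 t))).
Qed.

Let zpart_vec (x y z r x' y' z' r' : R) : zpart b (vec x y z r) (vec x' y' z' r')
  = (z' - 2^-1 * (x * y' - y * x') * w) *: Z.
Proof.
have [_ alt _] := Hb.
rewrite /zpart /= !bracketE !alt bracket_Jmap // (bracketC Hb (Jmap b Z V)) bracket_Jmap //.
by apply/rowP => c; rewrite !mxE -/w; ring.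
Qed.

Lemma geodesic_ray : geodesic b ray.
Proof.
have d1 : derive1 ray = ray1.
  by apply/funext => t; rewrite derive1E; have dr := dray t; exact: derive_val.
have d2 : derive1 ray1 = ray2.
  by apply/funext => t; rewrite derive1E; have dr := dray1 t; exact: derive_val.
have [_ _ J2] := Hb.
split=> t.
- by case: (dray t).
- by rewrite d1; case: (dray1 t).
- rewrite d1 d2.
  have Q0 : geoQ s q (E t) != 0 by rewrite gt_eqF // (geoQ_gt0 q0 w0 unit_norm).
  have En : E t != 0 by rewrite gt_eqF.
  have er : expR (- (ray t).2) = geoQ s q (E t) / (4 * E t).
    rewrite /ray /= opprB addrC opprD expRD expRD lnK ?posrE ?(geoQ_gt0 q0 w0 unit_norm) //.
    rewrite expRN expRN lnK ?posrE // -/(E t); by field.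
  have zX : zpart b (ray t) (ray1 t) = geoK s q L (E t) *: Z.
    by rewrite zpart_vec (geo_momentum L unit_norm Q0).
  apply: geodesic_equation; rewrite ?er ?zX.
  + rewrite /= !dotE dot_JJ // (dotC (Jmap b Z V)) (_ : dot V (Jmap b Z V) = 0).
      rewrite -/w -/q /geoR2; field; by rewrite En.
    by rewrite dotC dot_Jmap_self.
  + rewrite zpart_vec scalerA /geoG2; congr (_ *: _); by rewrite /=; field.
  + rewrite /= JmapZl JmapDr !JmapZr J2 -/q /geoA2 /geoB2 /geoK.
    apply/rowP => c; rewrite !mxE; field; by rewrite En Q0.
Qed.

Lemma ray0 : ray 0 = 0.
Proof.
rewrite /ray /E mulr0 expR0 /ray_at /geoA /geoB /geoG /geoQ !subrr !mulr0.
rewrite expr0n /= !mulr0 !mul0r !scale0r subr0 !addr0 add0r.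
by rewrite (_ : (1 + 1) ^+ 2 = 4) ?subrr //; ring.
Qed.

End Ray.

Lemma geodesic_zero : geodesic b (fun=> 0).
Proof.
have d0 : derive1 (fun _ : R => 0 : solv R m k) = fun=> 0.
  by apply/funext => t; rewrite derive1E derive_cst.
split=> t; rewrite ?d0; try exact: derivable_cst.
have z0 : zpart b (0 : solv R m k) 0 = 0.
  by rewrite /zpart bracket0r scaler0 subr0.
apply: geodesic_equation; rewrite ?z0 ?scaler0 //.
  by rewrite !dot0l !mulr0 !addr0.
have -> : Jmap b 0 (0 : 'rV[R]_m) = 0.
  by have := JmapZl b 0 0 (0 : 'rV[R]_m); rewrite !scale0r.
by rewrite !scaler0 addr0.
Qed.

Definition poisson_denom_real (x : solv R m k) : R :=
  (expR x.2 + 4^-1 * dot x.1.1 x.1.1) ^+ 2 + dot x.1.2 x.1.2.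

(** The exponential map is inverted by a Cayley transform: for [x = (V1, Z1, r1)] with
    [a = expR r1] and [h = a + |V1| ^ 2 / 4], identify [s + J_Z] with a complex
    number.  The point [(V', Z', s')] of the unit ball is given by
    [s' + J_Z' = (h + J_Z1 - 1) / (h + J_Z1 + 1)] and [V' = (h + J_Z1 + 1)^-1 V1].
    Its norm [rho] is the hyperbolic tangent of half the distance to [x], and
    [1 - rho ^ 2 = 4 * a / d] with [d = |h + J_Z1 + 1| ^ 2].  Passing from time [1]
    to time [- 1] changes [rho] to [- rho]. *)
Lemma geodesic_symmetry_height (sym : solv R m k -> solv R m k) :
  geodesic_symmetry b sym -> forall x, (sym x).2 = x.2 - ln (poisson_denom_real x).
Proof.
move=> Hs [[V1 Z1] r1]; rewrite /poisson_denom_real /=.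
set a := expR r1; have a0 : 0 < a by exact: expR_gt0.
have VV0 := dot_ge0 V1; have ZZ0 := dot_ge0 Z1.
set VV := dot V1 V1 in VV0 *; set ZZ := dot Z1 Z1 in ZZ0 *.
pose h := a + 4^-1 * VV; have h0 : 0 < h by rewrite /h; lra.
pose d := (1 + h) ^+ 2 + ZZ.
have d0 : 0 < d by rewrite /d ltr_pwDl // exprn_gt0 // ltr_wpDl.
have dn : d != 0 by rewrite gt_eqF.
have [s' s'E] : exists s', s' = (h ^+ 2 + ZZ - 1) / d by eexists.
have [Z' Z'E] : exists Z', Z' = (2 / d) *: Z1 by eexists.
have [V' V'E] : exists V', V' = d^-1 *: ((1 + h) *: V1 - Jmap b Z1 V1) by eexists.
have [_ _ J2] := Hb.
have V'V' : dot V' V' = VV / d.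
  rewrite V'E !dotE dot_JJ // (dotC V1) dot_Jmap_self // -/VV -/ZZ /d.
  by field; move: dn; rewrite /d.
have Z'Z' : dot Z' Z' = 4 * ZZ / d ^+ 2 by rewrite Z'E !dotE -/ZZ; field.
pose rho2 := dot V' V' + dot Z' Z' + s' ^+ 2.
have rho2E : 1 - rho2 = 4 * a / d.
  rewrite /rho2 V'V' Z'Z' s'E (_ : VV = 4 * (h - a)); last by rewrite /h; field.
  by move: dn; rewrite /d => dn'; field.
have rho20 : 0 <= rho2 by rewrite !addr_ge0 ?dot_ge0 ?sqr_ge0.
have rho21 : rho2 < 1.
  by rewrite -subr_gt0 rho2E divr_gt0 // mulr_gt0.
pose rho := Num.sqrt rho2.
have rhoE : rho ^+ 2 = rho2 by rewrite sqr_sqrtr.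
(* At the identity there is no direction to normalize; the constant geodesic
   serves. *)
have [rz|rn] := eqVneq rho2 0.
  have V'0 : VV = 0.
    have := dot_ge0 V'; have := dot_ge0 Z'; have := sqr_ge0 s'.
    move: rz; rewrite /rho2 V'V' => ? ? ? h1; have : VV / d = 0 by lra.
    by move/eqP; rewrite mulf_eq0 invr_eq0 (negbTE dn) orbF => /eqP.
  have Z'0 : ZZ = 0.
    have := dot_ge0 V'; have := dot_ge0 Z'; have := sqr_ge0 s'.
    move: rz; rewrite /rho2 Z'Z' => ? ? ? h1; have : 4 * ZZ / d ^+ 2 = 0 by lra.
    move/eqP; rewrite !mulf_eq0 invr_eq0 expf_eq0 (negbTE dn) !orbF pnatr_eq0 /=.
    by move/eqP.
  have a1 : a = 1.
    have := rho2E; rewrite rz subr0 /d Z'0 addr0 /h V'0 mulr0 addr0 => e.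
    have : (1 - a) ^+ 2 = 0.
      have : (1 + a) ^+ 2 = 4 * a.
        by rewrite -[LHS]mul1r {1}e mulfVK // expf_neq0 // gt_eqF // ltr_wpDl.
      by rewrite !expr2; lra.
    by move/eqP; rewrite sqrf_eq0 subr_eq0 => /eqP.
  have r10 : r1 = 0 by apply: expR_inj; rewrite expR0.
  have V10 := dot_eq0 V'0; have Z10 := dot_eq0 Z'0.
  have -> : ((V1, Z1), r1) = 0 :> solv R m k by rewrite V10 Z10 r10.
  have := Hs _ geodesic_zero erefl => /= ->.
  by rewrite a1 V'0 Z'0 r10 mulr0 !addr0 expr1n ln1 subrr.
have rho0 : 0 < rho by rewrite sqrtr_gt0 lt_neqAle eq_sym rn.
have rho1 : rho < 1 by rewrite -(expr_lt1 (_ : (0 < 2)%N)) ?ltW // rhoE.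
have rhon : rho != 0 by rewrite gt_eqF.
pose V := rho^-1 *: V'; pose Z := rho^-1 *: Z'; pose s := s' / rho.
have unitn : dot V V + dot Z Z + s ^+ 2 = 1.
  rewrite /V /Z /s !dotE.
  have -> : rho^-1 * (rho^-1 * dot V' V') + rho^-1 * (rho^-1 * dot Z' Z') + (s' / rho) ^+ 2
     = rho2 / rho ^+ 2 by rewrite /rho2; field.
  by rewrite rhoE divff.
pose e1 := (1 + rho) / (1 - rho).
have m1 : 0 < 1 - rho by rewrite subr_gt0.
have p1 : 0 < 1 + rho by rewrite ltr_wpDl // ltW.
have e10 : 0 < e1 by rewrite divr_gt0.
pose L := ln e1.
have EL : expR L = e1 by rewrite lnK.
have ELN : expR (- L) = (1 - rho) / (1 + rho) by rewrite expRN EL invf_div.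
have m1n : 1 - rho != 0 by rewrite gt_eqF.
have p1n : 1 + rho != 0 by rewrite gt_eqF.
(* The squared moduli of [1 - w] and [1 + w] for [w = s' + J_Z']. *)
have chi : (1 - s') ^+ 2 + dot Z' Z' = 4 / d.
  by rewrite Z'Z' s'E; move: dn; rewrite /d => dn'; field.
have chi' : (1 + s') ^+ 2 + dot Z' Z' = 4 * (h ^+ 2 + ZZ) / d.
  by rewrite Z'Z' s'E; move: dn; rewrite /d => dn'; field.
have qE : dot Z Z = dot Z' Z' / rho ^+ 2 by rewrite /Z !dotE; field.
have Q1 : geoQ s (dot Z Z) e1 = 16 / (d * (1 - rho) ^+ 2).
  have -> : geoQ s (dot Z Z) e1 = 4 * ((1 - s') ^+ 2 + dot Z' Z') / (1 - rho) ^+ 2.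
    by rewrite /geoQ qE /s /e1; field; rewrite ?rhon ?m1n.
  by rewrite chi; field; rewrite ?dn ?m1n.
have QN : geoQ s (dot Z Z) (expR (- L)) = 16 * (h ^+ 2 + ZZ) / (d * (1 + rho) ^+ 2).
  have -> : geoQ s (dot Z Z) (expR (- L)) = 4 * ((1 + s') ^+ 2 + dot Z' Z') / (1 + rho) ^+ 2.
    by rewrite /geoQ qE /s ELN; field; rewrite ?rhon ?p1n.
  by rewrite chi'; field; rewrite ?dn ?p1n.
have NN0 : 0 < h ^+ 2 + ZZ by rewrite ltr_pwDl // exprn_gt0.
have a_rho : (1 - rho) * (1 + rho) = 4 * a / d by rewrite -rho2E -rhoE; ring.
have JZV : Jmap b Z V = (2 / (d * rho ^+ 2)) *: Jmap b Z1 V'.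
  by rewrite /Z /V Z'E !(JmapZl, JmapZr) !scalerA; congr (_ *: _); field; rewrite ?dn ?rhon.
have at1 : ray V Z s L 1 = ((V1, Z1), r1).
  rewrite /ray mulr1 EL /ray_at; congr (_, _, _).
  - rewrite JZV /V !scalerA.
    have -> : geoA s (dot Z Z) e1 / rho = 1 + h.
      by rewrite /geoA Q1 /s /e1 s'E; move: dn; rewrite /d => dn'; field; rewrite ?dn' ?rhon ?m1n.
    have -> : geoB s (dot Z Z) e1 * (2 / (d * rho ^+ 2)) = 1.
      by rewrite /geoB Q1 /e1; field; rewrite ?dn ?rhon ?m1n.
    rewrite scale1r V'E !JmapZr JmapDr -scaleN1r !JmapZr J2 -/ZZ.
    apply/rowP => c; rewrite !mxE; move: dn; rewrite /d => dn'; by field.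
  - have -> : geoG s (dot Z Z) e1 = rho * d / 2.
      by rewrite /geoG Q1 /e1; field; rewrite ?dn ?rhon ?m1n.
    by rewrite /Z Z'E !scalerA (_ : _ * _ = 1) ?scale1r //; field; rewrite ?dn ?rhon.
  - rewrite Q1 /L /e1; apply: expR_inj.
    rewrite expRD expRN expRD !lnK ?posrE ?divr_gt0 ?mulr_gt0 ?exprn_gt0 //.
    rewrite -/a (_ : a = (1 - rho) * (1 + rho) * d / 4); last by rewrite a_rho; field.
    by field; rewrite ?dn ?m1n.
have := Hs _ (geodesic_ray L unitn) (ray0 V Z s L); rewrite at1 => ->.
rewrite /ray /= mulrN1 QN; apply: expR_inj.
rewrite expRD expRN !(expRD r1) expRD expRN !lnK ?posrE ?divr_gt0 ?mulr_gt0 ?exprn_gt0 //.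
rewrite ?EL -/a -/h.
rewrite (_ : a = (1 - rho) * (1 + rho) * d / 4); last by rewrite a_rho; field.
by rewrite ELN; field; rewrite ?dn ?p1n ?gt_eqF.
Qed.

End Geodesics.

(** * The identity theorem in several variables *)

Section CoordinateNeighbourhoods.
Variables (R : realType) (m k : nat).
Local Notation C := ((R[i])^o).
Local Notation SCn := (csolv_normed R m k).
Implicit Types p q : SCn.

Definition close (r : R) p q : Prop :=
  [/\ forall i, normc (q.1.1 0 i - p.1.1 0 i) < r,
      forall c, normc (q.1.2 0 c - p.1.2 0 c) < r & normc (q.2 - p.2) < r].

Lemma nbhs_closeP p (A : set SCn) :
  nbhs p A <-> exists2 r : R, 0 < r & forall q, close r p q -> A q.
Proof.
have bC (x y : C) (r : R) : ball x (r%:C)%C y <-> normc (y - x) < r.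
  by rewrite -ball_normE /ball_ /= distrC normC_normc ltcR.
split.
  move=> /nbhs_ballP[e /= /complex_gt0[r r0 ->] h]; exists r => // q [h1 h2 h3].
  have rC : 0 < (r%:C)%C :> R[i] by rewrite ltcR.
  apply: h; split; last exact/bC.
  split; split=> // i j; rewrite !ord1; exact/bC.
case=> r r0 h; apply/nbhs_ballP; exists (r%:C)%C; first by rewrite /= ltcR.
move=> q [[[_ h1] [_ h2]] h3]; apply: h; split; [move=> i|move=> c|]; exact/bC.
Qed.

Lemma continuous_row (T : topologicalType) d (f : T -> 'rV[C]_d) (t : T) :
  (forall c, {for t, continuous (fun x => f x 0 c)}) -> {for t, continuous f}.
Proof.
move=> cf A [P hP hA].
have H : \forall x \near t, forall c : 'I_d, P 0 c (f x 0 c).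
  by apply: filter_forall => c; exact: (cf c _ (hP 0 c)).
apply: filterS H => x hx; apply: hA => i j; rewrite ord1; exact: hx.
Qed.

End CoordinateNeighbourhoods.

Section IdentityTheorem.
Variables (R : realType) (m k : nat) (b : 'I_m -> 'I_m -> 'I_k -> R).
Local Notation C := ((R[i])^o).
Local Notation SCn := (csolv_normed R m k).
Implicit Types (p q w d : SCn) (D : SCn -> C).

Lemma cdiff_line D q d (z : C) : differentiable D (q + z *: d) ->
  differentiable (fun z : C => D (q + z *: d) : C) z.
Proof.
move=> dD; have dz : differentiable (fun z : C => z *: d : SCn) z.
  apply: differentiableZl; exact: (ex_diff (is_diff_def := is_diff_id z)).
have dg : differentiable (fun z : C => q + z *: d : SCn) z.
  exact: (differentiableD (differentiable_cst q z) dz).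
exact: (differentiable_comp dg dD).
Qed.

Let line_coord q d (z : C) :
  [/\ forall i, (q + z *: d).1.1 0 i = q.1.1 0 i + z * d.1.1 0 i,
      forall c, (q + z *: d).1.2 0 c = q.1.2 0 c + z * d.1.2 0 c
    & (q + z *: d).2 = q.2 + z * d.2].
Proof. by split=> [i|c|]; rewrite /= ?mxE. Qed.

(** Restrict [D] to the complex line through [q] and [w], with [q] at [0] and [w] at
    [1]; the radius [r / 16] keeps the disc of radius [4] in the domain of [D]. *)
Lemma identity_propagation D p (r : R) : 0 < r ->
  (forall q, close r p q -> differentiable D q) -> forall q w,
  close (r / 16) p q -> close (r / 16) p w -> (\forall x \near q, D x = 0) -> D w = 0.
Proof.
move=> r0 dD q w cq cw /nbhs_closeP[s s0 Ds].
have far (a0 aw ap z : R[i]) : normc (a0 - ap) < r / 16 -> normc (aw - ap) < r / 16 ->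
    normc z <= 4 -> normc (a0 + z * (aw - a0) - ap) < r.
  move=> h1 h2 h3.
  have -> : a0 + z * (aw - a0) - ap = (a0 - ap) + z * ((aw - ap) - (a0 - ap)) by ring.
  apply: le_lt_trans (le_normcD _ _) _; rewrite normcM.
  have h4 : normc ((aw - ap) - (a0 - ap)) <= r / 8.
    by apply: le_trans (le_normcD _ _) _; rewrite normcN; lra.
  have := ler_pM (normc_ge0 _) (normc_ge0 _) h3 h4; lra.
have small (a0 aw ap z : R[i]) : normc (a0 - ap) < r / 16 -> normc (aw - ap) < r / 16 ->
    normc z < s / r -> normc (a0 + z * (aw - a0) - a0) < s.
  move=> h1 h2 h3.
  have -> : a0 + z * (aw - a0) - a0 = z * ((aw - ap) - (a0 - ap)) by ring.
  rewrite normcM.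
  have h4 : normc ((aw - ap) - (a0 - ap)) <= r.
    by apply: le_trans (le_normcD _ _) _; rewrite normcN; lra.
  apply: le_lt_trans (ler_wpM2l (normc_ge0 _) h4) _.
  by rewrite -ltr_pdivlMr.
have := @identity_disc R (fun z => D (q + z *: (w - q))) (s / r).
rewrite scale1r subrKC; apply; first exact: divr_gt0.
  move=> z z4; apply: cdiff_line; apply: dD.
  have [E1 E2 E3] := line_coord q (w - q) z.
  case: cq => q1 q2 q3; case: cw => w1 w2 w3; split=> [i|c|].
  - by rewrite E1 !mxE; apply: far.
  - by rewrite E2 !mxE; apply: far.
  - by rewrite E3; apply: far.
move=> z zs; apply: Ds; have [E1 E2 E3] := line_coord q (w - q) z.
case: cq => q1 q2 q3; case: cw => w1 w2 w3; split=> [i|c|].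
- by rewrite E1 !mxE; apply: (small _ _ (p.1.1 0 i)).
- by rewrite E2 !mxE; apply: (small _ _ (p.1.2 0 c)).
- by rewrite E3; apply: (small _ _ p.2).
Qed.

Lemma S_to_SC_real (v : 'rV[R]_m) (z : 'rV[R]_k) (t : R) : 0 < t ->
  ((cvec v, cvec z), (t%:C)%C) = S_to_SC b ((v, z), 2 * ln t).
Proof.
by move=> t0; rewrite S_to_SCE /= (_ : 2 * ln t / 2 = ln t) ?lnK //; field.
Qed.

(** A point [w] near the real group is [u + i y] with real coordinates in [u] and
    [y]; the line [u + z *: y] is real for real [z], so [identity_real_segment]
    applies to it. *)
Lemma identity_near_S D (x : solv R m k) (r : R) : 0 < r -> r <= expR (x.2 / 2) ->
  (forall q, close r (S_to_SC b x) q -> differentiable D q) ->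
  (forall y, D (S_to_SC b y) = 0) ->
  forall w, close (r / 8) (S_to_SC b x) w -> D w = 0.
Proof.
move=> r0 rx dD D0 w cw.
pose u : SCn := ((cvec (ReV w.1.1), cvec (ReV w.1.2)), (complex.Re w.2)%:C%C).
pose y : SCn := ((cvec (ImV w.1.1), cvec (ImV w.1.2)), (complex.Im w.2)%:C%C).
have near (a z : R[i]) (p : R) : normc (a - (p%:C)%C) < r / 8 -> normc z <= 3 ->
    normc ((complex.Re a)%:C%C + z * (complex.Im a)%:C%C - (p%:C)%C) < r.
  move=> h1 h2; have h3 := Re_normc (a - (p%:C)%C); have h4 := Im_normc (a - (p%:C)%C).
  rewrite !(ReD, ImD, ReN, ImN) /= oppr0 addr0 in h3 h4.
  have -> : (complex.Re a)%:C%C + z * (complex.Im a)%:C%C - (p%:C)%C =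
     (complex.Re a - p)%:C%C + z * (complex.Im a)%:C%C.
    by apply: complex_ext; rewrite !(ReD, ImD, ReN, ImN, ReM, ImM) /=; ring.
  apply: le_lt_trans (le_normcD _ _) _; rewrite normcM !normc_real.
  have h5 : `|complex.Im a| <= r / 8 by lra.
  have := ler_pM (normc_ge0 _) (normr_ge0 _) h2 h5; lra.
have cl (z : C) : normc z <= 3 -> close r (S_to_SC b x) (u + z *: y).
  move=> z3; have [E1 E2 E3] := line_coord u y z.
  move: cw; rewrite S_to_SCE => -[w1 w2 w3]; split=> [i|c|].
  - by rewrite E1 !mxE; apply: near => //; have := w1 i; rewrite !mxE.
  - by rewrite E2 !mxE; apply: near => //; have := w2 c; rewrite !mxE.
  - by rewrite E3; apply: near.
have <- : u + (Complex 0 1 : C) *: y = w.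
  rewrite [RHS]surjective_pairing [w.1]surjective_pairing; congr (_, _, _).
  - by apply/rowP => i; apply: complex_ext; rewrite !mxE !(ReD, ImD, ReM, ImM) /= ?mxE /=; ring.
  - by apply/rowP => i; apply: complex_ext; rewrite !mxE !(ReD, ImD, ReM, ImM) /= ?mxE /=; ring.
  - by apply: complex_ext; rewrite /= ; ring.
apply: (@identity_real_segment R (fun z => D (u + z *: y))).
  move=> z h1 /andP[h2 h3]; apply: cdiff_line; apply: dD; apply: cl.
  by apply: le_trans (normc_le _) _; rewrite (ger0_norm h2); lra.
move=> t t1.
have -> : u + (t%:C)%C *: y = ((cvec (ReV w.1.1 + t *: ImV w.1.1),
   cvec (ReV w.1.2 + t *: ImV w.1.2)), (complex.Re w.2 + t * complex.Im w.2)%:C%C).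
  congr (_, _, _).
  - by apply/rowP => i; apply: complex_ext; rewrite !mxE !(ReD, ImD, ReM, ImM) /=; ring.
  - by apply/rowP => i; apply: complex_ext; rewrite !mxE !(ReD, ImD, ReM, ImM) /=; ring.
  - by apply: complex_ext; rewrite /= ; ring.
rewrite S_to_SC_real //.
have t3 : normc (t%:C)%C <= 3 by rewrite normc_real; lra.
have [_ _ h] := cl _ t3; have [_ _ E3] := line_coord u y (t%:C)%C.
rewrite {}E3 in h; have := le_lt_trans (Re_normc _) h.
by rewrite S_to_SCE /= ltr_norml => /andP[h1 _]; lra.
Qed.

End IdentityTheorem.

(** * Maximality *)

Section UnipotentTranslations.
Variables (R : realType) (m k : nat) (b : 'I_m -> 'I_m -> 'I_k -> R).
Local Notation C := ((R[i])^o).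
Local Notation SCn := (csolv_normed R m k).

(** Translations by the nilpotent group suffice for the proof of maximality.  They
    are affine, and [nshiftZ] exhibits them as endpoints of segments. *)
Definition ntrans (v : 'rV[R]_m) (z : 'rV[R]_k) (q : SCn) : SCn :=
  cmul b (S_to_SC b ((v, z), 0)) q.

Let bC i j c : R[i] := (b i j c)%:C%C.

Definition nshift (v : 'rV[R]_m) (z : 'rV[R]_k) (q : SCn) : SCn :=
  ((cvec v, cvec z + 2^-1 *: bracket bC (cvec v) q.1.1), 0).

Lemma ntransE v z q : ntrans v z q = q + nshift v z q.
Proof.
rewrite /ntrans S_to_SCE /= mul0r expR0 /cmul /nmul /dilation /nshift /=.
rewrite expr1n !scale1r mul1r; congr (_, _, _); last by rewrite /= addr0.
  by rewrite addrC.
by rewrite /= addrA (addrC q.1.2).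
Qed.

Lemma nshiftZ (s : R) v z q : nshift (s *: v) (s *: z) q = (s%:C)%C *: nshift v z q.
Proof.
have cZ d (x : 'rV[R]_d) : cvec (s *: x) = (s%:C)%C *: cvec x.
  by apply/rowP => i; rewrite !mxE rmorphM.
rewrite /nshift !cZ; congr (_, _, _); last by rewrite /= scaler0.
rewrite /= scalerDr; congr (_ + _); rewrite scalerA mulrC -scalerA; congr (_ *: _).
apply/rowP => c; rewrite !mxE mulr_sumr; apply: eq_bigr => i _.
by rewrite mulr_sumr; apply: eq_bigr => j _; rewrite !mxE; ring.
Qed.

Lemma continuous_ntrans v z : continuous (ntrans v z).
Proof.
move=> q; rewrite (_ : ntrans v z = fun q : SCn =>
  ((q.1.1 + cvec v, q.1.2 + (cvec z + 2^-1 *: bracket bC (cvec v) q.1.1)), q.2 + 0));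
  last by apply/funext => x; rewrite ntransE.
apply: (@continuous_pair SCn _ C (fun q : SCn =>
  (q.1.1 + cvec v, q.1.2 + (cvec z + 2^-1 *: bracket bC (cvec v) q.1.1)))).
  apply: continuous_pair; apply: continuous_row => c; apply: differentiable_continuous.
    rewrite (_ : (fun x => _) = fun x : SCn => x.1.1 0 c + cvec v 0 c); last first.
      by apply/funext => x; rewrite mxE.
    by apply: cdiffD; [exact: cdiff_v | exact: cdiff_cst].
  rewrite (_ : (fun x => _) = fun x : SCn => x.1.2 0 c + (cvec z 0 c + 2^-1 *
      \sum_i \sum_j bC i j c * cvec v 0 i * x.1.1 0 j)); last first.
    by apply/funext => x; rewrite !mxE.
  apply: cdiffD; first exact: cdiff_z.
  apply: cdiffD; first exact: cdiff_cst.
  apply: cdiffM; first exact: cdiff_cst.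
  apply: cdiff_sum => i; apply: cdiff_sum => j.
  by apply: cdiffM; [exact: cdiff_cst | exact: cdiff_v].
apply: differentiable_continuous.
by apply: cdiffD; [exact: cdiff_t | exact: cdiff_cst].
Qed.

Lemma ntrans_parts v z q : let p := ntrans v z q in
  [/\ ReV p.1.1 = v + ReV q.1.1, ImV p.1.1 = ImV q.1.1,
      ReV p.1.2 = z + ReV q.1.2 + 2^-1 *: bracket b v (ReV q.1.1),
      ImV p.1.2 = ImV q.1.2 + 2^-1 *: bracket b v (ImV q.1.1) & p.2 = q.2].
Proof.
have a1 : expR ((0 : R) / 2) = 1 by rewrite mul0r expR0.
have [E1 E2 E3 E4 E5] := S_to_SC_action b ((v, z), 0) q.
split; rewrite /ntrans ?E1 ?E2 ?E3 ?E4 ?E5 /= a1 ?expr1n ?scale1r //.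
by rewrite mul1r.
Qed.

Lemma vertical_ntrans v z q : vertical b (ntrans v z q) = vertical b q.
Proof.
have [E1 E2 E3 E4 _] := ntrans_parts v z q.
rewrite /vertical E1 E2 E4 bracketDl scalerDr opprD addrA.
by apply/rowP => c; rewrite !mxE; ring.
Qed.

End UnipotentTranslations.

Section Maximality.
Variables (R : realType) (m k : nat) (b : 'I_m -> 'I_m -> 'I_k -> R).
Local Notation C := ((R[i])^o).
Local Notation SCn := (csolv_normed R m k).
Hypothesis Hb : htype_constants b.

Lemma poisson_denom_S_to_SC (x : solv R m k) : poisson_denom (S_to_SC b x) = (poisson_denom_real x)%:C%C.
Proof.
have sumE d (y : 'rV[R]_d) : \sum_i cvec y 0 i ^+ 2 = (dot y y)%:C%C :> R[i].
  by rewrite /dot rmorph_sum; apply: eq_bigr => i _; rewrite !mxE expr2 rmorphM.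
have i4 : (4^-1 : R[i]) = (4^-1 : R)%:C%C by rewrite fmorphV rmorph_nat.
have ex : expR x.2 = expR (x.2 / 2) ^+ 2.
  by rewrite expr2 -expRD; congr expR; field.
rewrite /poisson_denom /siegel_height S_to_SCE /= !sumE i4 /poisson_denom_real ex.
by rewrite -!(rmorphXn, rmorphM, rmorphD).
Qed.

Lemma poisson_ext_S (l : R[i]) (x : solv R m k) :
  poisson_ext l (S_to_SC b x) = cexp (l * (x.2 - ln (poisson_denom_real x))%:C%C).
Proof.
have N0 : 0 < poisson_denom_real x.
  by rewrite /poisson_denom_real ltr_pwDl ?dot_ge0 // exprn_gt0 // ltr_pwDl ?expR_gt0 // mulr_ge0 ?dot_ge0.
rewrite /poisson_ext poisson_denom_S_to_SC clog_real //.
have -> : (S_to_SC b x).2 ^+ 2 = (expR x.2)%:C%C.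
  by rewrite S_to_SCE /= -rmorphXn /= expr2 -expRD; congr ((expR _)%:C)%C; field.
by rewrite clog_real ?expR_gt0 // expRK rmorphB.
Qed.

(** The imaginary part of the difference of the two logarithms is at most [2 * pi], so the
    imaginary part of [l] changes the modulus by a bounded factor only. *)
Lemma normc_poisson_ext (l : R[i]) (p : csolv R m k) : 0 < complex.Re l ->
  expR (complex.Re l * (ln (normc (p.2 ^+ 2)) - ln (normc (poisson_denom p)))
    - 2 * pi * `|complex.Im l|) <= normc (poisson_ext l p).
Proof.
move=> l0; rewrite /poisson_ext normc_cexp ler_expR ReM !(ReD, ReN).
rewrite lerD2l lerN2; apply: le_trans (ler_norm _) _; rewrite normrM mulrC.
apply: ler_wpM2r => //; rewrite ImD ImN; apply: le_trans (ler_normD _ _) _.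
rewrite normrN.
have := clog_Im_bound (p.2 ^+ 2); have := clog_Im_bound (poisson_denom p); lra.
Qed.

(** Let [u] be the direction of [vertical b p] and [y] the imaginary part of the
    [v]-component.  The real part [- J_u y] for the latter, of norm [|y|], turns
    [vertical b p] and the imaginary part of the central component into multiples
    of [u], the second having norm [Re h] since [gap b p] is zero.  Taking then
    [- (Im h) u] for the real part of the central component makes [Z.Z = - h ^ 2]. *)
Lemma boundary_zero (p : csolv R m k) : 0 < complex.Re p.2 -> gap b p = 0 ->
  exists v1 z1 v2 z2, poisson_denom (ntrans b v2 z2 (ntrans b v1 z1 p)) = 0.
Proof.
move=> p0 gp; have [u [uu eta]] := unit_direction Hb (vertical b p).
set y := ImV p.1.1; set ne := enorm (vertical b p) in eta.
have [_ alt _] := Hb.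
pose v1 := - Jmap b u y - ReV p.1.1.
have [p1 p1E] : exists p1, p1 = ntrans b v1 0 p by eexists.
have [A1 A2 _ A4 A5] := ntrans_parts b v1 0 p; rewrite -p1E in A1 A2 A4 A5.
have R1 : ReV p1.1.1 = - Jmap b u y by rewrite A1 /v1 subrK.
have br1 : bracket b (- Jmap b u y) y = dot y y *: u.
  by rewrite bracketNl (bracketC Hb) opprK bracket_Jmap.
have I1 : ImV p1.1.2 = (ne + 2^-1 * dot y y) *: u.
  have e1 : ImV p1.1.2 = vertical b p1 + 2^-1 *: bracket b (ReV p1.1.1) (ImV p1.1.1).
    by rewrite /vertical subrK.
  have e2 : vertical b p1 = vertical b p by rewrite p1E vertical_ntrans.
  by rewrite e1 e2 R1 A2 -/y br1 {1}eta scalerDl scalerA.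
have al : complex.Re (siegel_height p1) = ne + 2^-1 * dot y y.
  rewrite Re_siegel_height A5 R1 A2 -/y !dotE dot_JJ // uu mul1r.
  by move: gp; rewrite /gap -/y -/ne; lra.
set be := complex.Im (siegel_height p1).
pose z2 := - be *: u - ReV p1.1.2.
have [p2 p2E] : exists p2, p2 = ntrans b 0 z2 p1 by eexists.
have [B1 B2 B3 B4 B5] := ntrans_parts b 0 z2 p1; rewrite -p2E in B1 B2 B3 B4 B5.
rewrite !bracket0l scaler0 !addr0 add0r in B1 B3 B4.
have v2E : p2.1.1 = p1.1.1 by apply: rowC_ext.
have hE : siegel_height p2 = siegel_height p1 by rewrite /siegel_height v2E B5.
have R2 : ReV p2.1.2 = - be *: u by rewrite B3 /z2 subrK.
exists v1, 0, 0, z2; rewrite -p1E -p2E; apply: complex_ext.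
  by rewrite Re_poisson_denom hE R2 B4 I1 al -/be !dotE uu /=; ring.
by rewrite Im_poisson_denom hE R2 B4 I1 al -/be !dotE uu /=; ring.
Qed.

Variables (l : R[i]) (P : solv R m k -> R[i]) (Om : set (csolv R m k)).
Hypothesis l0 : 0 < complex.Re l.
Hypothesis PE : forall x, P x = cexp (l * (x.2 - ln (poisson_denom_real x))%:C%C).
Hypothesis HOm : invariant_domain b Om.
Variable F : csolv R m k -> R[i].
Hypothesis hF : holomorphic_on Om F.
Hypothesis FS : forall x, F (S_to_SC b x) = P x.

Let D (p : SCn) : C := F p - poisson_ext l p.

(** Agreement is required on a neighbourhood, because the intersection of the domain
    with the tube may be disconnected, so that [F] and the explicit extension may
    differ on some of its components. *)
Definition agree : set SCn :=
  [set p : SCn | [/\ Om p, tube b p & \forall q \near p, D q = 0]].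

Let Om_open : open (Om : set SCn).
Proof. by have [_ h _ _ _] := HOm. Qed.

Let dD (p : SCn) : Om p -> tube b p -> differentiable D p.
Proof.
move=> Op tp; apply: cdiffD; first exact: hF.
by apply: cdiffN; exact: (holomorphic_poisson_ext Hb).
Qed.

Let both_close (p : SCn) : Om p -> tube b p -> exists2 r : R, 0 < r &
  forall q, close r p q -> Om q /\ tube b q.
Proof.
move=> Op tp; apply/nbhs_closeP; apply: filterI; first exact: open_nbhs_nbhs.
by apply: open_nbhs_nbhs; split => //; exact: open_tube.
Qed.

Lemma agree_open : open agree.
Proof.
rewrite openE => p [Op tp np]; rewrite /interior.
have h1 : \forall q \near p, Om q by exact: open_nbhs_nbhs.
have h2 : \forall q \near p, tube b q.
  by apply: open_nbhs_nbhs; split => //; exact: open_tube.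
have h3 := nbhs_interior np.
by apply: filterS3 h1 h2 h3 => q ? ? ?; split.
Qed.

Lemma agree_S x : agree (S_to_SC b x).
Proof.
have Ox : Om (S_to_SC b x) by have [_ _ _ h _] := HOm.
have tx := tube_S_to_SC b x.
split=> //; have [r r0 hr] := both_close Ox tx.
pose r' := Num.min r (expR (x.2 / 2)).
have r'0 : 0 < r' by rewrite lt_min r0 expR_gt0.
apply/nbhs_closeP; exists (r' / 8); first exact: divr_gt0.
have r'x : r' <= expR (x.2 / 2) by rewrite ge_min lexx orbT.
apply: (identity_near_S r'0 r'x).
- move=> q [q1 q2 q3]; have [] : Om q /\ tube b q; last exact: dD.
  have rr : r' <= r by rewrite ge_min lexx.
  by apply: hr; split=> [i|c|]; apply: lt_le_trans rr.
- by move=> y; rewrite /D FS PE poisson_ext_S subrr.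
Qed.

Lemma agree_closed (p : SCn) : Om p -> tube b p -> closure agree p -> agree p.
Proof.
move=> Op tp cp; split=> //; have [r r0 hr] := both_close Op tp.
have rr : 0 < r / 16 by exact: divr_gt0.
have nb : nbhs p (close (r / 16) p) by apply/nbhs_closeP; exists (r / 16).
have [q [[_ _ nq] cq]] := cp _ nb.
apply/nbhs_closeP; exists (r / 16); first exact: rr.
move=> w cw; have hD q' : close r p q' -> differentiable D q' by move=> /hr[]; exact: dD.
exact: (identity_propagation r0 hD cq cw nq).
Qed.

(** The segment of translates of [q] stays in the domain and in the tube, and its
    intersection with [agree] is open and closed in it. *)
Lemma agree_ntrans v z (q : SCn) : agree q -> agree (ntrans b v z q).
Proof.
move=> aq; have [Oq tq _] := aq.
have [_ _ _ _ Oinv] := HOm.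
pose g (s : R) : SCn := q + (s%:C)%C *: nshift b v z q.
have gE s : g s = ntrans b (s *: v) (s *: z) q by rewrite ntransE nshiftZ.
have cg : continuous g.
  move=> s; apply: (@cvgD _ SCn _ (nbhs s)); first exact: cvg_cst.
  apply: (@continuous_comp R C SCn (fun s => (s%:C)%C : C)
    (fun a : C => a *: nshift b v z q) s); first exact: continuous_realC.
  exact: scalel_continuous.
pose K : set SCn := g @` (`[0, 1]%classic : set R).
have cK : connected K.
  apply: connected_continuous_connected; last exact: continuous_subspaceT.
  by apply/connected_intervalP; exact: interval_is_interval.
have KO p : K p -> Om p /\ tube b p.
  move=> [s _ <-]; rewrite gE; split; first exact: Oinv.
  exact: tube_action.
have KA : K `&` agree = K.
  apply: cK.
  - exists q; split=> //; exists 0; first by rewrite /= in_itv /= lexx ler01.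
    by rewrite /g scale0r addr0.
  - by exists agree => //; exact: agree_open.
  - exists (closure agree); first exact: closed_closure.
    rewrite eqEsubset; split=> p [Kp h]; (split; first exact: Kp).
      exact: subset_closure.
    by have [Op tp] := KO p Kp; exact: agree_closed.
have : K (ntrans b v z q).
  exists 1; first by rewrite /= in_itv /= lexx ler01.
  by rewrite gE !scale1r.
by rewrite -KA => -[].
Qed.

Lemma closure_agree_ntrans v z (p : SCn) : closure agree p -> closure agree (ntrans b v z p).
Proof.
move=> cp A nA; have nA' : nbhs p (ntrans b v z @^-1` A).
  exact: (@continuous_ntrans R m k b v z p A nA).
have [q [aq Aq]] := cp (ntrans b v z @^-1` A) nA'; exists (ntrans b v z q).
by split; [exact: agree_ntrans | exact: Aq].
Qed.

(** Near a zero of [poisson_denom] the explicit extension is unbounded, also along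
    [agree], where it equals [F]. *)
Lemma no_zero_in_closure (p : SCn) : Om p -> closure agree p -> p.2 != 0 -> poisson_denom p != 0.
Proof.
move=> Op cp p2; apply/negP => /eqP N0.
have cF : {for p, continuous (F : SCn -> C)}.
  by apply: differentiable_continuous; exact: hF.
pose M : R := normc (F p) + 1.
have M0 : 0 < M by rewrite ltr_pwDr // normc_ge0.
have nF : \forall q \near p, normc (F q) < M.
  have cn := cont_comp cF (@continuous_normc R).
  by apply: (@cvgr_lt _ _ (nbhs p) _ _ _ cn); rewrite ltrDl.
pose c : R := normc (p.2 ^+ 2) / 2.
have c0 : 0 < c by rewrite divr_gt0 // normc_gt0 expf_neq0.
have nt : \forall q \near p, c < normc (q.2 ^+ 2).
  have dt := differentiable_continuous (@cdiff_t2 R m k p).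
  have cn := cont_comp dt (@continuous_normc R).
  apply: (@cvgr_gt _ _ (nbhs p) _ _ _ cn); rewrite /= -/c.
  by rewrite [ltRHS]splitr -/c ltrDl.
pose eps : R := expR (ln c - (ln M + 2 * pi * `|complex.Im l|) / complex.Re l).
have nN : \forall q \near p, normc (poisson_denom q) < eps.
  have dN := differentiable_continuous (@cdiff_poisson_denom R m k p).
  have cn := cont_comp dN (@continuous_normc R).
  by apply: (@cvgr_lt _ _ (nbhs p) _ _ _ cn); rewrite N0 normc0 expR_gt0.
have [q [[Oq tq Dq] [[h1 h2] h3]]] := cp _ (filterI (filterI nF nt) nN).
have Fq : F q = poisson_ext l q.
  by apply/eqP; rewrite -subr_eq0; apply/eqP; exact: (nbhs_singleton Dq).
have := normc_poisson_ext q l0; rewrite -Fq => /le_lt_trans /(_ h1).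
apply/negP; rewrite -leNgt.
have Nq : 0 < normc (poisson_denom q) by exact: slit_normc_gt0 (slit_poisson_denom Hb tq).
rewrite -[leLHS](lnK (_ : M \is Num.pos)) // ler_expR.
have hc : ln c <= ln (normc (q.2 ^+ 2)) by rewrite ler_ln ?posrE ?(lt_trans c0 h2) ?(ltW h2) ?c0.
have hN : ln (normc (poisson_denom q)) <= ln c - (ln M + 2 * pi * `|complex.Im l|) / complex.Re l.
  by rewrite -[leRHS]expRK ler_ln ?posrE ?expR_gt0 ?Nq ?(ltW h3).
have hd : (ln M + 2 * pi * `|complex.Im l|) / complex.Re l <=
   ln (normc (q.2 ^+ 2)) - ln (normc (poisson_denom q)) by lra.
by move: hd; rewrite ler_pdivrMr // mulrC; lra.
Qed.

(** The set [agree] is open in the domain; it is closed in it, as a limit point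
    outside the tube would have [gap] zero and a translate contradicting
    [no_zero_in_closure]. *)
Lemma domain_sub_tube : Om `<=` tube b.
Proof.
have [OSC _ cO _ Oinv] := HOm.
suff -> : Om = agree by move=> p [].
apply/esym; apply: (cO (agree : set SCn)).
- by exists (S_to_SC b 0); exact: agree_S.
- exists agree; first exact: agree_open.
  by rewrite eqEsubset; split=> p; [move=> ap; split=> //; case: ap | case].
exists (closure agree); first exact: closed_closure.
rewrite eqEsubset; split=> p.
  by move=> ap; split; [case: ap | exact: subset_closure].
move=> [Op cp]; apply: agree_closed => //.
have Re0 : 0 <= complex.Re p.2.
  rewrite leNgt; apply/negP => h.
  have n : \forall q \near (p : SCn), complex.Re q.2 < 0.
    exact: (@cvgr_lt _ _ (nbhs (p : SCn)) _ _ _ (@continuous_Re_t R m k p)).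
  by have [q [[_ [q0 _] _] qn]] := cp _ n; move: (lt_trans q0 qn); rewrite ltxx.
have g0 : 0 <= gap b p.
  rewrite leNgt; apply/negP => h.
  have n : \forall q \near (p : SCn), gap b q < 0.
    exact: (@cvgr_lt _ _ (nbhs (p : SCn)) _ _ _ (@continuous_gap R m k b p)).
  by have [q [[_ [_ q0] _] qn]] := cp _ n; move: (lt_trans q0 qn); rewrite ltxx.
have p2 : p.2 != 0 := OSC p Op.
have Re1 : 0 < complex.Re p.2.
  rewrite lt_neqAle Re0 andbT; apply/eqP => e.
  have I2 : complex.Im p.2 = 0.
    move: g0; rewrite /gap expr2 ReM -e mulr0 sub0r => g0.
    apply/eqP; rewrite -sqrf_eq0 expr2 eq_le -expr2 sqr_ge0 andbT expr2.
    have := dot_ge0 (ImV p.1.1); have := enorm_ge0 (vertical b p); lra.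
  by move/negP: p2; apply; apply/eqP; apply: complex_ext.
split=> //; rewrite lt_neqAle g0 andbT; apply/eqP => e.
have [v1 [z1 [v2 [z2 N0]]]] := boundary_zero Re1 (esym e).
have act v z (q : SCn) : Om q -> closure agree q -> q.2 != 0 ->
  [/\ Om (ntrans b v z q), closure agree (ntrans b v z q) & (ntrans b v z q).2 != 0].
  move=> h1 h2 h3; split; [exact: Oinv | exact: closure_agree_ntrans|].
  by rewrite ntransE /= addr0.
have [h1 h2 h3] := act v1 z1 p Op cp p2; have [h4 h5 h6] := act v2 z2 _ h1 h2 h3.
by have := no_zero_in_closure h4 h5 h6; rewrite N0 eqxx.
Qed.

End Maximality.

Theorem theorem4p3 (R : realType) (n : vectType R) (br : n -> n -> n)
    (ip : n -> n -> R) (m k : nat) (e : 'I_m -> n) (f : 'I_k -> n)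
    (l : R[i]) (s : solv R m k -> solv R m k) :
  is_htype_algebra br ip ->
  is_orthonormal_basis ip (center_orth br ip) e ->
  is_orthonormal_basis ip (lie_center br) f ->
  geodesic_symmetry (structure_constants br ip e f) s ->
  positive_param l ->
  largest_invariant_domain (structure_constants br ip e f)
    (poisson_kernel s l) (crown (structure_constants br ip e f)).
Proof.
move=> H He Hf Hs l0; have Hb := htype_structure_constants H He Hf.
have PE x : poisson_kernel s l x = cexp (l * (x.2 - ln (poisson_denom_real x))%:C%C).
  by rewrite /poisson_kernel /= /apow (geodesic_symmetry_height Hb Hs).
rewrite (crown_tube Hb); split.
- split; [exact: tube_sub_SC | exact: open_tube | exact: connected_tube | |].
    exact: tube_S_to_SC.
  exact: tube_action.
- exists (poisson_ext l); split; first exact: holomorphic_poisson_ext.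
  by move=> x; rewrite PE poisson_ext_S.
- move=> Om HOm [F [hF FS]]; exact: (domain_sub_tube Hb l0 PE HOm hF FS).
Qed.
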